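(* With the notation of the context, let $\{(s_h^j,\boldsymbol n_h^j)\}_{j\in\mathbb N_0}$ be the approximations generated by Algorithm G. Let $j\ge1$. The following holds. (i) Suppose that the norm induced by the metric $\langle\cdot,\cdot\rangle_*$ is an upper bound for the $L^2$-norm, i.e., there exists $C_*>0$ such that $\|\boldsymbol\phi_h\|_{L^2(\Omega)}\le C_*\|\boldsymbol\phi_h\|_*$ for all $\boldsymbol\phi_h\in\mathbf V_{h,D}$. Then $$\big\|I_h\big[|\boldsymbol n_h^j|^2-1\big]\big\|_{L^1(\Omega)}\le C_1\,\tau_{\boldsymbol n}\,E^h[s_h^0,\boldsymbol n_h^0],$$ where $C_1>0$ depends only on $C_*$ and the shape-regularity of $\{\mathcal T_h\}$. (ii) Suppose that $\tau_{\boldsymbol n}$ fulfills the CFL-type condition $$\tau_{\boldsymbol n}h_{\min}^{-d}\le C^*\quad\text{if }\langle\cdot,\cdot\rangle_*\text{ is the }L^2\text{-metric},$$ $$\tau_{\boldsymbol n}h_{\min}^{2-d-\alpha}|\log h_{\min}|^2\le C^*\quad\text{if }\langle\cdot,\cdot\rangle_*\text{ is the weighted }H^1\text{-metric},$$ where $h_{\min}:=\min_{K\in\mathcal T_h}\operatorname{diam}(K)$ and $C^*>0$ is arbitrary. Then $$\|\boldsymbol n_h^j\|_{L^\infty(\Omega)}\le1+C_2\,E^h[s_h^0,\boldsymbol n_h^0],$$ where $C_2>0$ is proportional to $C^*$, with proportionality constant depending on the shape-regularity of $\{\mathcal T_h\}$.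
   Context: Setting. $d\in\{2,3\}$; $\Omega\subset\mathbb R^d$ is a bounded Lipschitz polytopal domain; $\kappa>0$ is a constant; $\Gamma_D\subseteq\partial\Omega$ is relatively open with $|\Gamma_D|>0$. $\{\mathcal T_h\}$ is a shape-regular family of simplicial meshes of $\Omega$, $h=\max_{K\in\mathcal T_h}\operatorname{diam}(K)$, $\mathcal N_h$ is the set of vertices of $\mathcal T_h$; $V_h$ is the space of continuous functions on $\overline\Omega$ that are affine on each element, $\mathbf V_h=(V_h)^d$, $I_h$ is the nodal interpolant. $V_{h,D}=\{v_h\in V_h: v_h(z)=0\ \forall z\in\mathcal N_h\cap\Gamma_D\}$, $\mathbf V_{h,D}=(V_{h,D})^d$. For $\boldsymbol n_h\in\mathbf V_h$, $\boldsymbol{\mathcal K}_h[\boldsymbol n_h]=\{\boldsymbol\phi_h\in\mathbf V_{h,D}:\boldsymbol n_h(z)\cdot\boldsymbol\phi_h(z)=0\ \forall z\in\mathcal N_h\}$. $\langle\cdot,\cdot\rangle$ is the $L^2(\Omega)$ inner product of scalar-, vector- or matrix-valued functions; $(\boldsymbol a\otimes\boldsymbol b)_{ij}=a_ib_j$; $|\cdot|$ is the Euclidean/Frobenius norm; $\mathbb N_0=\{0,1,2,\dots\}$. Boundary data: $(g,\boldsymbol q,\boldsymbol r)\in W^{1,\infty}(\mathbb R^d)\times L^\infty(\mathbb R^d;\mathbb R^d)\times W^{1,\infty}(\mathbb R^d;\mathbb R^d)$ with $-1/(d-1)<g<1$, $|\boldsymbol q|=1$, $\boldsymbol r=g\boldsymbol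 q$ a.e., and $g\ge\delta_0$ on $\Gamma_D$ for some sufficiently small $\delta_0>0$; $g_h=I_h[g]$, $\boldsymbol r_h=I_h[\boldsymbol r]$. Potential: the double well potential $\psi:(-1/(d-1),1)\to\mathbb R_{\ge0}$ satisfies $\psi\in C^2(-1/(d-1),1)$; $\lim_{s\to1^-}\psi(s)=+\infty=\lim_{s\to(-1/(d-1))^+}\psi(s)$; $\psi(0)>\psi(s^* )=\min_{s\in(-1/(d-1),1)}\psi(s)=0$ for some $s^*\in(0,1)$; $\psi'(0)=0$. For the algorithm a convex splitting $\psi=\psi_c-\psi_e$ is assumed, where $\psi_c$ and $\psi_e$ are both convex and $\psi_c$ is quadratic. Discrete energies, for $s_h\in V_h$ and $\boldsymbol n_h\in\mathbf V_h$: $E_1^h[s_h,\boldsymbol n_h]=\frac12\int_\Omega(\kappa|\boldsymbol n_h\otimes\nabla s_h|^2+s_h^2|\nabla\boldsymbol n_h|^2)$, $E_2^h[s_h]=\int_\Omega\psi(s_h)$, $E^h[s_h,\boldsymbol n_h]=E_1^h[s_h,\boldsymbol n_h]+E_2^h[s_h]$. Metric: $\langle\cdot,\cdot\rangle_*$, with induced norm $\|\cdot\|_*$, is either the $L^2$-metric $\langle\boldsymbol\phi,\boldsymbol\psi\rangle_*=\langle\boldsymbol\phi,\boldsymbol\psi\rangle$ or the weighted $H^1$-metric $\langle\boldsymbol\phi,\boldsymbol\psi\rangle_*=\langle h^\alpha\nabla\boldsymbol\phi,\nabla\boldsymbol\psi\rangle$ with $0<\alpha\le2$. Algorithm G (alternating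 direction discrete gradient flow). Parameters: time-step sizes $\tau_{\boldsymbol n},\tau_s>0$, tolerance $\mathsf{tol}>0$. Notation: $d_ts_h^{i+1}=(s_h^{i+1}-s_h^i)/\tau_s$. Input: $s_h^0\in V_h$, $\boldsymbol n_h^0\in\mathbf V_h$ with $|\boldsymbol n_h^0(z)|=1$ for all $z\in\mathcal N_h$, and $\boldsymbol n_h^0(z)=\boldsymbol r_h(z)/g_h(z)$, $s_h^0(z)=g_h(z)$ for all $z\in\mathcal N_h\cap\Gamma_D$. Outer loop: for all $i\in\mathbb N_0$ do: Inner loop: set $\boldsymbol n_h^{i,0}=\boldsymbol n_h^i$; for $\ell=0,1,2,\dots$, compute $\boldsymbol t_h^{i,\ell}\in\boldsymbol{\mathcal K}_h[\boldsymbol n_h^{i,\ell}]$ such that for all $\boldsymbol\phi_h\in\boldsymbol{\mathcal K}_h[\boldsymbol n_h^{i,\ell}]$ $\langle\boldsymbol t_h^{i,\ell},\boldsymbol\phi_h\rangle_*+\tau_{\boldsymbol n}\kappa\langle\boldsymbol t_h^{i,\ell}\otimes\nabla s_h^i,\boldsymbol\phi_h\otimes\nabla s_h^i\rangle+\tau_{\boldsymbol n}\langle s_h^i\nabla\boldsymbol t_h^{i,\ell},s_h^i\nabla\boldsymbol\phi_h\rangle=-\kappa\langle\boldsymbol n_h^{i,\ell}\otimes\nabla s_h^i,\boldsymbol\phi_h\otimes\nabla s_h^i\rangle-\langle s_h^i\nabla\boldsymbol n_h^{i,\ell},s_h^i\nabla\boldsymbol\phi_h\rangle$, and update $\boldsymbol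 n_h^{i,\ell+1}=\boldsymbol n_h^{i,\ell}+\tau_{\boldsymbol n}\boldsymbol t_h^{i,\ell}$; stop when $|E_1^h[s_h^i,\boldsymbol n_h^{i,\ell+1}]-E_1^h[s_h^i,\boldsymbol n_h^{i,\ell}]|<\mathsf{tol}$. Let $\ell_i\in\mathbb N_0$ be the smallest integer for which this stopping criterion holds and set $\boldsymbol n_h^{i+1}=\boldsymbol n_h^{i,\ell_i+1}$. Then compute $s_h^{i+1}\in V_h$ with $s_h^{i+1}(z)=g_h(z)$ for all $z\in\mathcal N_h\cap\Gamma_D$ and, for all $w_h\in V_{h,D}$, $\langle d_ts_h^{i+1},w_h\rangle+\kappa\langle\boldsymbol n_h^{i+1}\otimes\nabla s_h^{i+1},\boldsymbol n_h^{i+1}\otimes\nabla w_h\rangle+\langle s_h^{i+1}\nabla\boldsymbol n_h^{i+1},w_h\nabla\boldsymbol n_h^{i+1}\rangle+\langle\psi_c'(s_h^{i+1}),w_h\rangle=\langle\psi_e'(s_h^i),w_h\rangle$. Output: the sequence $\{(s_h^i,\boldsymbol n_h^i)\}_{i\in\mathbb N_0}$.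
   Formalization: The convex splitting is assumed only on a subinterval containing the iterates' values (on the full interval it contradicts the blow-up of ψ); in (ii), H¹ case, |log h_min| ≥ λ0 > 0 is assumed and the constant may depend on λ0 and Ω, since the claim fails at h_min = 1. *)

(* Defs.v *)
From HB Require Import structures.
From mathcomp Require Import all_boot all_order all_algebra.
From mathcomp Require Import all_classical all_reals all_analysis.

Set Implicit Arguments.
Unset Strict Implicit.
Unset Printing Implicit Defensive.
Import Order.TTheory GRing.Theory Num.Theory.
Import numFieldNormedType.Exports.
Local Open Scope classical_set_scope.
Local Open Scope ring_scope.

(* The sigma-algebra on row vectors generated by the coordinate functions,
   i.e. the Borel sigma-algebra of R^n. *)
Section measurable_rV.
Context {R : realType} {n : nat}.

Definition rV_coord (i : 'I_n) (v : 'rV[R]_n) : R := v 0 i.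

Let rV_set0 : g_sigma_preimage rV_coord set0.
Proof. exact: sigma_algebra0. Qed.

Let rV_setC A : g_sigma_preimage rV_coord A -> g_sigma_preimage rV_coord (~` A).
Proof. exact: sigma_algebraC. Qed.

Let rV_bigcup (F : _^nat) :
  (forall i, g_sigma_preimage rV_coord (F i)) ->
  g_sigma_preimage rV_coord (\bigcup_i (F i)).
Proof. exact: sigma_algebra_bigcup. Qed.

HB.instance Definition _ := @isMeasurable.Build
  (measure_tuple_display default_measure_display) 'rV[R]_n
  (g_sigma_preimage rV_coord) rV_set0 rV_setC rV_bigcup.

End measurable_rV.

Section lebesgue_rV.
Context {R : realType}.

Definition rV_cons n (p : 'rV[R]_n * measurableTypeR R) : 'rV[R]_n.+1 :=
  \row_(i < n.+1) (if unlift ord0 i is Some j then p.1 0 j else p.2).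

Lemma measurable_rV_coord n (i : 'I_n) :
  measurable_fun [set: 'rV[R]_n] (rV_coord i).
Proof.
move=> _ Y mY; rewrite setTI; apply: sub_sigma_algebra => /=.
rewrite -bigcup_seq/=; exists i => /=; first by rewrite mem_index_enum.
by exists Y => //; rewrite setTI.
Qed.

Lemma measurable_rV_cons n : measurable_fun setT (@rV_cons n).
Proof.
have mc (i : 'I_n.+1) : measurable_fun setT (rV_coord i \o @rV_cons n).
  case: (unliftP ord0 i) => [j ->|->].
    rewrite (_ : _ \o _ = rV_coord j \o fst); last first.
      by apply/funext => p /=; rewrite /rV_coord mxE liftK.
    exact: measurableT_comp (measurable_rV_coord j) measurable_fst.
  rewrite (_ : _ \o _ = snd); first exact: measurable_snd.
  by apply/funext => p /=; rewrite /rV_coord mxE unlift_none.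
suff H : measurable `<=` [set A : set 'rV[R]_n.+1 |
    measurable (@rV_cons n @^-1` A)].
  by move=> _ Y /H /=; rewrite setTI.
apply: smallest_sub.
  split => /=.
  - by rewrite preimage_set0.
  - by move=> A mA; rewrite setTD -preimage_setC; exact: measurableC.
  - by move=> F mF; rewrite preimage_bigcup; exact: bigcupT_measurable.
rewrite -bigcup_mkord_ord; apply: bigcup_sub => i _ A [B mB <-] /=.
rewrite setTI.
by have := mc (inord i) measurableT B mB; rewrite setTI.
Qed.

Section rV_cons_measure.
Variables (n : nat) (mu : {measure set 'rV[R]_n -> \bar R}).

Definition rV_cons_measure : set 'rV[R]_n.+1 -> \bar R :=
  pushforward (mu \x lebesgue_measure)%E (@rV_cons n).

HB.instance Definition _ := Measure.copy rV_cons_measure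
  (measure_function_pushforward__canonical__measure_function_Measure
     (mu \x lebesgue_measure)%E (@measurable_rV_cons n)).

End rV_cons_measure.

(* Lebesgue measure on R^n: the n-fold product of the one-dimensional one. *)
Fixpoint lebesgue_rV (n : nat) : {measure set 'rV[R]_n -> \bar R} :=
  match n with
  | 0%N => \d_(0 : 'rV[R]_0)
  | m.+1 => rV_cons_measure (lebesgue_rV m)
  end.

End lebesgue_rV.

Section euclidean.
Context {R : realType}.

(* Euclidean inner product of vectors, Frobenius inner product of matrices.
   The library norm `|.| on matrices is the maximum norm. *)
Definition mxdot m n (A B : 'M[R]_(m, n)) : R := \sum_i \sum_j A i j * B i j.

Definition enorm m n (A : 'M[R]_(m, n)) : R := Num.sqrt (mxdot A A).

Definition tensor m n (a : 'rV[R]_m) (b : 'rV[R]_n) : 'M[R]_(m, n) := a^T *m b.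

(* Classical gradients.  On functions that are affine on each cell of a mesh
   they are defined off the mesh skeleton, which is negligible. *)
Definition grad d (f : 'rV[R]_d -> R) (x : 'rV[R]_d) : 'rV[R]_d :=
  \row_j 'D_(delta_mx 0 j) f x.

Definition mxgrad m d (f : 'rV[R]_d -> 'rV[R]_m) (x : 'rV[R]_d) :
    'M[R]_(m, d) :=
  \matrix_(i, j) 'D_(delta_mx 0 j) (fun y => f y 0 i) x.

Definition diam d (A : set 'rV[R]_d) : R :=
  sup [set enorm (p.1 - p.2) | p in A `*` A].

Definition inradius d (A : set 'rV[R]_d) : R :=
  sup [set r | 0 <= r /\
               exists x, forall y : 'rV[R]_d, enorm (y - x) <= r -> A y].

(* The k-dimensional Hausdorff (outer) measure, up to normalization. *)
Definition hausdorff d (k : nat) (A : set 'rV[R]_d) : \bar R :=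
  ereal_sup [set ereal_inf
      [set (\sum_(0 <= i <oo) (diam (U i) ^+ k)%:E)%E
         | U in [set U : (set 'rV[R]_d)^nat | A `<=` \bigcup_i U i /\
             forall i x y, U i x -> U i y -> enorm (x - y) <= delta]]
    | delta in [set delta : R | 0 < delta]].

End euclidean.

Section function_spaces.
Context {R : realType} {d : nat}.
Implicit Types (Omega : set 'rV[R]_d) (f : 'rV[R]_d -> R).

(* Norm of L^p(Omega), as an extended real. *)
Definition Lp_norm Omega (p : \bar R) f : \bar R :=
  Lnorm (lebesgue_rV d) p (fun x => (f x * \1_Omega x)%:E).

Definition Linfty f : Prop :=
  measurable_fun setT f /\ (Lp_norm setT +oo%E f < +oo)%E.

Definition test_function f : Prop :=
  (forall (vs : seq 'rV[R]_d) x,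
     differentiable (foldr (fun v g => 'D_v g) f vs) x) /\
  exists r, forall x, r < enorm x -> f x = 0.

(* W^{1,oo}(R^d), represented by continuous functions. *)
Definition W1infty f : Prop :=
  [/\ continuous f, Linfty f &
      forall i : 'I_d, exists2 f', Linfty f' &
        forall phi, test_function phi ->
          \int[lebesgue_rV d]_x (f x * 'D_(delta_mx 0 i) phi x) =
          - \int[lebesgue_rV d]_x (f' x * phi x)].

Definition L2_scal Omega f g : R := \int[lebesgue_rV d]_(x in Omega) (f x * g x).

Definition L2_mx m n Omega (F G : 'rV[R]_d -> 'M[R]_(m, n)) : R :=
  \int[lebesgue_rV d]_(x in Omega) mxdot (F x) (G x).

End function_spaces.

Section domains_and_meshes.
Context {R : realType} {d : nat}.
Implicit Types (Omega : set 'rV[R]_d).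

(* Points p i, i in A, span a nondegenerate simplex. *)
Definition affinely_independent (T : finType) (p : T -> 'rV[R]_d)
    (A : {set T}) : Prop :=
  forall l : T -> R, (forall i, i \notin A -> l i = 0) ->
    \sum_i l i = 0 -> \sum_i l i *: p i = 0 -> forall i, l i = 0.

(* l is a system of barycentric coordinates of x in the convex hull of the
   points p i, i in A. *)
Definition barycentric (T : finType) (p : T -> 'rV[R]_d) (A : {set T})
    (x : 'rV[R]_d) (l : T -> R) : Prop :=
  [/\ forall i, 0 <= l i, forall i, i \notin A -> l i = 0,
      \sum_i l i = 1 & \sum_i l i *: p i = x].

Definition hull (T : finType) (p : T -> 'rV[R]_d) (A : {set T}) :
    set 'rV[R]_d :=
  [set x | exists l, barycentric p A x l].

Record mesh := Mesh {
  nvtx : nat;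
  vtx : 'I_nvtx -> 'rV[R]_d;
  cells : {set {set 'I_nvtx}} }.

Definition cell (M : mesh) (K : {set 'I_(nvtx M)}) : set 'rV[R]_d :=
  hull (@vtx M) K.

Record simplicial_mesh Omega (M : mesh) : Prop := {
  mesh_vtx_inj : injective (@vtx M);
  mesh_simplex : forall K, K \in cells M ->
    #|K| = d.+1 /\ affinely_independent (@vtx M) K;
  mesh_vtx_used : forall i, exists2 K, K \in cells M & i \in K;
  mesh_conforming : forall K K', K \in cells M -> K' \in cells M ->
    cell K `&` cell K' = cell (K :&: K');
  mesh_cover : closure Omega = \bigcup_(K in [set` cells M]) cell K }.

Definition hmax (M : mesh) : R :=
  \big[Num.max/0]_(K in cells M) diam (cell K).

Definition hmin (M : mesh) : R :=
  \big[Num.min/hmax M]_(K in cells M) diam (cell K).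

Definition shape_regular (sigma : R) (M : mesh) : Prop :=
  forall K, K \in cells M -> diam (cell K) <= sigma * (2 * inradius (cell K)).

Definition boundary Omega : set 'rV[R]_d := closure Omega `\` interior Omega.

(* Near each boundary point, Omega is the side y . e > gamma y of a Lipschitz
   graph, where gamma is constant in the direction of the unit vector e. *)
Definition lipschitz_boundary Omega : Prop :=
  forall x, boundary Omega x ->
  exists (e : 'rV[R]_d) (r L : R) (gamma : 'rV[R]_d -> R),
    [/\ enorm e = 1, 0 < r,
        forall y t, gamma (y + t *: e) = gamma y,
        forall y z, `|gamma y - gamma z| <= L * enorm (y - z) &
        forall y, enorm (y - x) < r -> (Omega y <-> gamma y < mxdot y e)].

Definition polytopal Omega : Prop :=
  exists (n : nat) (p : 'I_n -> 'rV[R]_d) (S : {set {set 'I_n}}),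
    (forall K, K \in S -> #|K| = d.+1 /\ affinely_independent p K) /\
    closure Omega = \bigcup_(K in [set` S]) hull p K.

Record polytopal_lipschitz_domain Omega : Prop := {
  dom_open : open Omega;
  dom_nonempty : Omega !=set0;
  dom_connected : connected Omega;
  dom_bounded : bounded_set Omega;
  dom_lipschitz : lipschitz_boundary Omega;
  dom_polytopal : polytopal Omega }.

End domains_and_meshes.

Arguments mesh : clear implicits.

Section finite_elements.
Context {R : realType} {d : nat}.
Variables (Omega GammaD : set 'rV[R]_d) (M : mesh R d).

(* Finite element functions are functions on closure Omega; their values
   elsewhere are irrelevant. *)
Definition Vh (v : 'rV[R]_d -> R) : Prop :=
  {within closure Omega, continuous v} /\
  forall K, K \in cells M ->
    exists (a : 'rV[R]_d) (b : R), forall x, cell K x -> v x = mxdot a x + b.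

Definition VhD (v : 'rV[R]_d -> R) : Prop :=
  Vh v /\ forall i, GammaD (@vtx _ _ M i) -> v (@vtx _ _ M i) = 0.

Definition Vh_vec (v : 'rV[R]_d -> 'rV[R]_d) : Prop :=
  forall k, Vh (fun x => v x 0 k).

Definition VhD_vec (v : 'rV[R]_d -> 'rV[R]_d) : Prop :=
  forall k, VhD (fun x => v x 0 k).

Definition Kh (n phi : 'rV[R]_d -> 'rV[R]_d) : Prop :=
  VhD_vec phi /\
  forall i, mxdot (n (@vtx _ _ M i)) (phi (@vtx _ _ M i)) = 0.

(* Nodal interpolant.  On closure Omega the barycentric coordinates do not
   depend on the cell, by conformity. *)
Definition nodal_interp (f : 'rV[R]_d -> R) (x : 'rV[R]_d) : R :=
  let l := xget (fun=> 0)
    [set l | exists2 K, K \in cells M & barycentric (@vtx _ _ M) K x l] in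
  \sum_i l i * f (@vtx _ _ M i).

Definition nodal_interp_vec (f : 'rV[R]_d -> 'rV[R]_d) (x : 'rV[R]_d) :
    'rV[R]_d :=
  \row_k nodal_interp (fun y => f y 0 k) x.

End finite_elements.

Section potential.
Context {R : realType} (d : nat).

(* Lower end of the physical range of the degree of orientation. *)
Definition s_low : R := - (d%:R - 1)^-1.

Record double_well (psi : R -> R) : Prop := {
  dw_ge0 : forall s, s_low < s < 1 -> 0 <= psi s;
  dw_C2 : forall s, s_low < s < 1 ->
    [/\ derivable psi s 1, derivable (derive1 psi) s 1 &
      {for s, continuous (derive1n 2 psi)}];
  dw_lim_1 : psi s @[s --> 1^'-] --> +oo;
  dw_lim_low : psi s @[s --> s_low^'+] --> +oo;
  dw_min : exists2 s, 0 < s < 1 & psi s = 0;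
  dw_zero : 0 < psi 0;
  dw_crit : derive1 psi 0 = 0 }.

(* Convex splitting on an interval ]a, b[ of the physical range ]s_low, 1[.
   On the whole range it contradicts the infinite limits of psi: the convex
   psie is bounded below there and the quadratic psic is bounded, so psi would
   be bounded above. *)
Record convex_splitting (a b : R) (psi psic psie : R -> R) : Prop := {
  cs_low : s_low <= a;
  cs_high : b <= 1;
  cs_eq : forall s, a < s < b -> psi s = psic s - psie s;
  cs_convc : @convex_function R R^o [set` `]a, b[] psic;
  cs_conve : @convex_function R R^o [set` `]a, b[] psie;
  cs_quad : exists a2 a1 a0, a2 != 0 /\
    forall s, psic s = a2 * s ^+ 2 + a1 * s + a0 }.

End potential.

Section problem_data.
Context {R : realType} {d : nat}.

Record problem := Problem {
  GammaD : set 'rV[R]_d;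
  kappa : R;
  gdat : 'rV[R]_d -> R;
  qdat : 'rV[R]_d -> 'rV[R]_d;
  rdat : 'rV[R]_d -> 'rV[R]_d;
  psi : R -> R;
  psic : R -> R;
  psie : R -> R;
  split_lo : R;
  split_hi : R }.

Record admissible (Omega : set 'rV[R]_d) (P : problem) : Prop := {
  adm_GammaD : exists2 U, open U & GammaD P = boundary Omega `&` U;
  adm_GammaD_gt0 : (0 < hausdorff d.-1 (GammaD P))%E;
  adm_kappa : 0 < kappa P;
  adm_g : W1infty (gdat P);
  adm_q : forall k, Linfty (fun x => qdat P x 0 k);
  adm_r : forall k, W1infty (fun x => rdat P x 0 k);
  adm_g_range : {ae lebesgue_rV d, forall x, s_low d < gdat P x < 1};
  adm_q_unit : {ae lebesgue_rV d, forall x, enorm (qdat P x) = 1};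
  adm_rgq : {ae lebesgue_rV d, forall x, rdat P x = gdat P x *: qdat P x};
  adm_g_GammaD : exists2 delta0, 0 < delta0 &
    forall x, GammaD P x -> delta0 <= gdat P x;
  adm_psi : double_well d (psi P);
  adm_split :
    convex_splitting d (split_lo P) (split_hi P) (psi P) (psic P) (psie P) }.

End problem_data.

Arguments problem : clear implicits.

Section algorithm.
Context {R : realType} {d : nat}.
Variables (Omega : set 'rV[R]_d) (P : problem R d) (M : mesh R d).
Implicit Types (s w : 'rV[R]_d -> R) (n t phi : 'rV[R]_d -> 'rV[R]_d).

Definition energy1 s n : R :=
  2^-1 * \int[lebesgue_rV d]_(x in Omega)
    (kappa P * enorm (tensor (n x) (grad s x)) ^+ 2
     + s x ^+ 2 * enorm (mxgrad n x) ^+ 2).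

Definition energy2 s : R := \int[lebesgue_rV d]_(x in Omega) psi P (s x).

Definition energy s n : R := energy1 s n + energy2 s.

Inductive metric := L2_metric | H1_metric of R.

Definition star (m : metric) phi t : R :=
  match m with
  | L2_metric => L2_mx Omega phi t
  | H1_metric alpha =>
      L2_mx Omega (fun x => hmax M `^ alpha *: mxgrad phi x) (mxgrad t)
  end.

Definition star_norm (m : metric) phi : R := Num.sqrt (star m phi phi).

(* The second clause says that star is definite, i.e. an inner product, on the
   space of vector fields vanishing at the Dirichlet vertices; for the weighted
   H^1 metric this excludes meshes without vertices on GammaD. *)
Definition metric_ok (m : metric) : Prop :=
  (if m is H1_metric alpha then 0 < alpha <= 2 else True) /\
  forall phi, VhD_vec Omega (GammaD P) M phi -> star m phi phi = 0 ->
    {in closure Omega, phi =1 fun=> 0}.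

Variables (m : metric) (taun taus tol : R).

Definition tangent_step s n t : Prop :=
  Kh Omega (GammaD P) M n t /\
  forall phi, Kh Omega (GammaD P) M n phi ->
    star m t phi
    + taun * kappa P * L2_mx Omega (fun x => tensor (t x) (grad s x))
                                   (fun x => tensor (phi x) (grad s x))
    + taun * L2_mx Omega (fun x => s x *: mxgrad t x)
                         (fun x => s x *: mxgrad phi x)
    = - (kappa P * L2_mx Omega (fun x => tensor (n x) (grad s x))
                               (fun x => tensor (phi x) (grad s x)))
      - L2_mx Omega (fun x => s x *: mxgrad n x)
                    (fun x => s x *: mxgrad phi x).

Definition inner_stop s n n' : Prop := `|energy1 s n' - energy1 s n| < tol.

(* The inner loop, run with s, takes n to n'. *)
Definition inner_loop s n n' : Prop :=
  exists (nl tl : nat -> 'rV[R]_d -> 'rV[R]_d) (ell : nat),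
    [/\ {in closure Omega, nl 0%N =1 n},
        forall l, (l <= ell)%N -> tangent_step s (nl l) (tl l) /\
          {in closure Omega, nl l.+1 =1 fun x => nl l x + taun *: tl l x},
        inner_stop s (nl ell) (nl ell.+1),
        forall l, (l < ell)%N -> ~ inner_stop s (nl l) (nl l.+1) &
        {in closure Omega, n' =1 nl ell.+1}].

Definition dirichlet_s s : Prop :=
  forall i, GammaD P (@vtx _ _ M i) ->
    s (@vtx _ _ M i) = nodal_interp M (gdat P) (@vtx _ _ M i).

Definition dirichlet_n n : Prop :=
  forall i, GammaD P (@vtx _ _ M i) ->
    n (@vtx _ _ M i) = (nodal_interp M (gdat P) (@vtx _ _ M i))^-1 *:
                       nodal_interp_vec M (rdat P) (@vtx _ _ M i).

(* s' is computed from s and the updated director n'. *)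
Definition scalar_step s n' s' : Prop :=
  [/\ Vh Omega M s', dirichlet_s s' &
    forall w, VhD Omega (GammaD P) M w ->
      L2_scal Omega (fun x => (s' x - s x) / taus) w
      + kappa P * L2_mx Omega (fun x => tensor (n' x) (grad s' x))
                              (fun x => tensor (n' x) (grad w x))
      + L2_mx Omega (fun x => s' x *: mxgrad n' x) (fun x => w x *: mxgrad n' x)
      + L2_scal Omega (fun x => derive1 (psic P) (s' x)) w
      = L2_scal Omega (fun x => derive1 (psie P) (s x)) w].

(* The range condition makes psi, psie and their derivatives meaningful at the
   iterates. *)
Record algorithmG (s : nat -> 'rV[R]_d -> R)
    (n : nat -> 'rV[R]_d -> 'rV[R]_d) : Prop := {
  alg_s0 : Vh Omega M (s 0%N);
  alg_n0 : Vh_vec Omega M (n 0%N);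
  alg_n0_unit : forall i, enorm (n 0%N (@vtx _ _ M i)) = 1;
  alg_n0_bc : dirichlet_n (n 0%N);
  alg_s0_bc : dirichlet_s (s 0%N);
  alg_range : forall i x, closure Omega x ->
    split_lo P < s i x < split_hi P;
  alg_inner : forall i, inner_loop (s i) (n i) (n i.+1);
  alg_scalar : forall i, scalar_step (s i) (n i.+1) (s i.+1) }.

(* All standing assumptions, with sigma the shape-regularity constant. *)
Record algorithm_run (sigma : R) (s : nat -> 'rV[R]_d -> R)
    (n : nat -> 'rV[R]_d -> 'rV[R]_d) : Prop := {
  run_domain : polytopal_lipschitz_domain Omega;
  run_data : admissible Omega P;
  run_mesh : simplicial_mesh Omega M;
  run_shape : shape_regular sigma M;
  run_metric : metric_ok m;
  run_taun : 0 < taun;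
  run_taus : 0 < taus;
  run_tol : 0 < tol;
  run_iterates : algorithmG s n }.

End algorithm.

Arguments metric : clear implicits.
Arguments L2_metric {R}.
Arguments H1_metric {R}.

(* Main.v *)
Require Import Defs.
From mathcomp Require Import all_boot all_order all_algebra.
From mathcomp Require Import all_classical all_reals all_analysis.
From mathcomp Require Import measurable_realfun ess_sup_inf.
From mathcomp Require Import ring lra.

Set Implicit Arguments.
Unset Strict Implicit.
Unset Printing Implicit Defensive.
Import Order.TTheory GRing.Theory Num.Theory.
Import numFieldNormedType.Exports.
Local Open Scope classical_set_scope.
Local Open Scope ring_scope.

(** Testing the tangential problem with the update [t], and the scalar problem
    with the increment, gives an energy law that telescopes: [tau_n] times the
    sum of all [|t|_*^2] is at most the initial energy.  Since [t] is orthogonal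
    to [n] at every vertex, Pythagoras gives
    [|n^j(z)|^2 - 1 = tau_n^2 * sum |t(z)|^2].  It remains to compare nodal values
    of piecewise affine functions with the metric.

    For the L^2 metric, a shape-regular simplex of diameter [h] contains a cube
    of comparable size, so [h^d f(z)^2] is bounded by the integral of [f^2]; this
    gives the L^1 bound and the first L^oo bound.

    For the H^1 metric one needs the discrete Sobolev inequality
    [f(z)^2 <= C hmin^(2-d) (ln hmin)^2 * int |grad f|^2] for [f] vanishing at some
    vertex.  The mean of [f] over a cube changes by at most
    [diameter * side^(-d/2) * |grad f|_(L^2)] when the cube moves inside the
    domain.  Cubes shrinking dyadically from size 1 to size [hmin] towards a
    vertex, within a simplex of the polytopal cover, cost one such term per
    scale, hence the logarithm; below [hmin] an inverse estimate bounds
    [grad f].  Large cubes in different simplices are joined by connectedness of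
    the domain.  A Dirichlet vertex exists because the metric is definite. *)

(** * Lebesgue measure on R^d *)

(** Along an affine motion, the mean over a cube is an integral over the fixed unit cube, so its
    change is controlled with only homothetic changes of variables, dominated convergence, the mean
    value theorem and a Cauchy-Schwarz bound. At scale [s] the change costs [s * s^(-d/2)]. With
    [d = e + 2] this is [s^(-e/2)], at most [hmin^(-e/2)] for every scale above [hmin]. Summing
    about [|ln hmin|] such terms and squaring gives [hmin^(2-d) (ln hmin)^2]. The constant must not
    depend on the mesh. Hence the large cubes and the links between them are fixed in simplices
    covering the domain before any mesh is chosen, and a function enters these links only through a
    bound on its Dirichlet energy. Contributions without a logarithm, from the links and the inverse
    estimate, are absorbed by the lower bound [lambda0] for [|ln hmin|]. Finite element functions
    are known only cell by cell on the closure, and their gradients only in the interior of cells.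
    Integrals over [Om] are therefore evaluated off the hyperplanes of the facets; the Lipschitz
    boundary ensures that [Om] and its closure agree off them. *)

Section integral_arbitrary.
Local Open Scope ereal_scope.
Context d (T : measurableType d) (R : realType) (mu : {measure set T -> \bar R}).
Implicit Types (D N : set T) (f g : T -> \bar R).
Import HBNNSimple.

(* The integral is the difference of two suprema over simple functions, so
   the next lemmas need no measurability of the integrand. *)
Lemma ge0_le_integral_arbitrary D f g :
  (forall x, D x -> 0 <= f x) -> (forall x, D x -> f x <= g x) ->
  \int[mu]_(x in D) f x <= \int[mu]_(x in D) g x.
Proof.
move=> f0 fg; rewrite !ge0_integralE//; last first.
  by move=> x Dx; exact: le_trans (f0 _ Dx) (fg _ Dx).
apply: le_ereal_sup => _ /= [h hf <-]; exists h => // x.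
rewrite (le_trans (hf x))// /patch; case: ifPn => // /set_mem; exact: fg.
Qed.

Lemma ge0_integral_setD_null D N f : measurable N -> mu N = 0 ->
  (forall x, D x -> 0 <= f x) ->
  \int[mu]_(x in D) f x = \int[mu]_(x in D `\` N) f x.
Proof.
move=> mN N0 f0; have f0' x : (D `\` N) x -> 0 <= f x by case=> /f0.
apply/eqP; rewrite eq_le; apply/andP; split; rewrite !ge0_integralE//.
  apply: ge_ereal_sup => _ /= [h hf <-].
  apply: ereal_sup_ubound => /=.
  (* A simple function below [f] on [D] is cut off on [N]; its integral is unchanged because [N] is
     null. *)
  exists (proj_nnsfun h (measurableC mN)).
    move=> x; rewrite -mrestrict /patch in_setD in_setC.
    have := hf x; rewrite /patch.
    case: (x \in N) => /=; last by rewrite andbT.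
    by rewrite andbF.
  rewrite -!integralT_nnsfun.
  transitivity (\int[mu]_(x in ~` N) (h x)%:E).
    rewrite [RHS]integral_mkcond; apply: eq_integral => x _.
    by rewrite -mrestrict /patch in_setC; case: (x \in N).
  rewrite -setTD -ge0_negligible_integral//.
    by apply/measurable_EFinP; exact: measurable_funP.
  by move=> x _; rewrite lee_fin.
apply: le_ereal_sup => _ /= [h hf <-]; exists h => // x.
rewrite (le_trans (hf x))// /patch in_setD.
case: (boolP (x \in D)) => //= xD; case: (x \in N) => //=.
by apply: f0; exact: set_mem.
Qed.

(** [N] will be the mesh skeleton or its preimage under a homothety, where gradients carry no
    information. *)
Lemma integral_setD_null D N f : measurable N -> mu N = 0 ->
  \int[mu]_(x in D) f x = \int[mu]_(x in D `\` N) f x.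
Proof.
move=> mN N0; rewrite integralE [RHS]integralE.
by congr (_ - _); apply: ge0_integral_setD_null.
Qed.

End integral_arbitrary.

Section measurable_rV.
Context {R : realType}.

Lemma measurable_fun_rV d (T : measurableType d) n (f : T -> 'rV[R]_n) :
  (forall i, measurable_fun setT (rV_coord i \o f)) -> measurable_fun setT f.
Proof.
move=> mc.
suff H : measurable `<=` [set A : set 'rV[R]_n | measurable (f @^-1` A)].
  by move=> _ Y /H /=; rewrite setTI.
apply: smallest_sub.
  split => /=.
  - by rewrite preimage_set0.
  - by move=> A mA; rewrite setTD -preimage_setC; exact: measurableC.
  - by move=> F mF; rewrite preimage_bigcup; exact: bigcupT_measurable.
rewrite -bigcup_seq; apply: bigcup_sub => i _ A [B mB <-] /=.
by rewrite setTI; have := mc i measurableT B mB; rewrite setTI.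
Qed.

Definition hom n (x0 : 'rV[R]_n) (r : R) (u : 'rV[R]_n) : 'rV[R]_n :=
  x0 + r *: u.

Lemma measurable_hom n x0 r : measurable_fun setT (@hom n x0 r).
Proof.
apply: measurable_fun_rV => i.
rewrite (_ : _ \o _ = fun u => x0 0 i + r * rV_coord i u); last first.
  by apply/funext => u; rewrite /rV_coord /hom/= !mxE.
apply: measurable_funD; first exact: measurable_cst.
apply: measurable_funM; first exact: measurable_cst.
exact: measurable_rV_coord.
Qed.

End measurable_rV.

Section lebesgue_rV_theory.
Context {R : realType}.
Local Notation leb := (@lebesgue_measure R).
Local Notation mu n := (@lebesgue_rV R n).

Lemma measurable_affine1 (c r : R) :
  measurable_fun setT (fun a : measurableTypeR R => c + r * a : measurableTypeR R).
Proof.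
by apply: measurable_funD => //; exact: measurable_funM.
Qed.

(** Uniqueness of Lebesgue measure: the image measure under [a |-> c + r a], multiplied by [r],
    gives half-open intervals their length. *)
Lemma lebesgue_measure_affine (c r : R) (A : set (measurableTypeR R)) :
  0 < r -> measurable A ->
  leb ((fun a => c + r * a) @^-1` A) = ((r^-1)%:E * leb A)%E.
Proof.
move=> r0 mA; pose f (a : measurableTypeR R) : measurableTypeR R := c + r * a.
have mf : measurable_fun setT f by exact: measurable_affine1.
pose nu : {measure set (measurableTypeR R) -> \bar R} :=
  mscale (NngNum (ltW r0))
      (measure_function_pushforward__canonical__measure_function_Measure leb mf).
have -> : leb A = nu A.
  apply: lebesgue_measure_unique => //= _ [[a b]] _ <- /=.
  rewrite /mscale/= /pushforward.
  have -> : f @^-1` `]a, b]%classic =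
            `](a - c) / r, (b - c) / r]%classic.
    apply/seteqP; split => x /=; rewrite !in_itv/= /f => /andP[ha hb].
      by rewrite ltr_pdivrMr// ler_pdivlMr//; lra.
    by move: ha hb; rewrite ltr_pdivrMr// ler_pdivlMr// => ha hb; lra.
  rewrite !lebesgue_measure_itv/= !lte_fin ltr_pM2r ?invr_gt0// ltrD2r.
  case: ifPn => _; last by rewrite mule0.
  rewrite -!EFinB -EFinM; congr EFin.
  by field; rewrite gt_eqF.
rewrite /nu/= /mscale/= muleA -EFinM mulVf ?gt_eqF// mul1e//.
Qed.

Lemma lebesgue_rVS n (A : set 'rV[R]_n.+1) :
  mu n.+1 A = (\int[mu n]_v leb [set a | A (rV_cons (v, a))])%E.
Proof.
rewrite /= /rV_cons_measure/= /pushforward /product_measure1/=.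
by apply: eq_integral => v _ /=; congr (leb _); apply/seteqP; split => a /=;
  rewrite /xsection/= ?inE.
Qed.

Lemma measurable_slice n (A : set 'rV[R]_n.+1) : measurable A ->
  measurable_fun setT (fun v : 'rV[R]_n => leb [set a | A (rV_cons (v, a))]).
Proof.
move=> mA.
have mB : measurable (@rV_cons R n @^-1` A).
  by rewrite -[X in measurable X]setTI; exact: measurable_rV_cons.
have := measurable_fun_xsection leb mB.
apply: eq_measurable_fun => v _ /=; congr (leb _); apply/seteqP.
by split => a /=; rewrite /xsection/= ?inE.
Qed.

Lemma measurable_slice_set n (A : set 'rV[R]_n.+1) (v : 'rV[R]_n) :
  measurable A -> measurable [set a : measurableTypeR R | A (rV_cons (v, a))].
Proof.
move=> mA; have mB : measurable (@rV_cons R n @^-1` A).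
  by rewrite -[X in measurable X]setTI; exact: measurable_rV_cons.
have := measurable_xsection v mB; congr measurable.
by apply/seteqP; split => a /=; rewrite /xsection/= ?inE.
Qed.

(** Induction over slices: the coordinate [ord0] contributes [r^-1] by the one-dimensional case, and
    transporting the outer integral by the homothety of the other coordinates contributes [r^-n]. *)
Lemma lebesgue_rV_hom n (x0 : 'rV[R]_n) (r : R) (A : set 'rV[R]_n) :
  0 < r -> measurable A ->
  mu n (hom x0 r @^-1` A) = ((r ^- n)%:E * mu n A)%E.
Proof.
move=> r0; elim: n x0 A => [|n IH] x0 A mA.
  by rewrite /= invr1 mul1e; congr (\d__ _); apply/seteqP; split => u /=;
    rewrite (_ : hom _ _ _ = u)//; apply/rowP => -[].
rewrite !lebesgue_rVS.
pose x0' : 'rV[R]_n := \row_j x0 0 (lift ord0 j).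
have consE v a : hom x0 r (rV_cons (v, a)) =
    rV_cons (hom x0' r v, x0 0 ord0 + r * a).
  apply/rowP => j; rewrite /hom !mxE; case: (unliftP ord0 j) => [k ->|->//].
  by rewrite /= !mxE.
pose g v := leb [set a | A (rV_cons (v, a))].
have mg : measurable_fun setT g by exact: measurable_slice.
have g0 v : (0 <= g v)%E by exact: measure_ge0.
transitivity (\int[mu n]_v ((r^-1)%:E * g (hom x0' r v)))%E.
  apply: eq_integral => v _.
  rewrite -(lebesgue_measure_affine (x0 0 ord0))//; last exact: measurable_slice_set.
  by congr (leb _); apply/seteqP; split => a /=; rewrite consE.
rewrite ge0_integralZl//; last 2 first.
- by apply: measurableT_comp => //; exact: measurable_hom.
- by rewrite lee_fin invr_ge0 ltW.
rewrite exprS invfM EFinM -muleA; congr (_ * _)%E.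
have := @ge0_integral_pushforward _ _ _ _ R _ (measurable_hom x0' r) (mu n)
  setT g measurableT mg (fun y _ => g0 y).
rewrite preimage_setT => <-.
have rn0 : 0 <= r ^- n by rewrite invr_ge0 exprn_ge0// ltW.
rewrite -(ge0_integral_mscale (mu n) measurableT (NngNum rn0) mg)//.
apply: eq_measure_integral => [|mf B mB _]; first exact: measurable_hom.
exact: IH.
Qed.

Definition unit_cube n : set 'rV[R]_n := [set u | forall i, 0 <= u 0 i <= 1].

Arguments unit_cube : clear implicits.

Definition cube n (x : 'rV[R]_n) (r : R) : set 'rV[R]_n :=
  [set y | forall i, x 0 i <= y 0 i <= x 0 i + r].

Lemma measurable_coord_itv n (i : 'I_n) (I : interval R) :
  measurable [set y : 'rV[R]_n | y 0 i \in I].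
Proof.
rewrite -[X in measurable X]setTI.
exact: (@measurable_rV_coord R n i measurableT [set` I] (measurable_itv _)).
Qed.

Lemma measurable_cube n (x : 'rV[R]_n) (r : R) : measurable (cube x r).
Proof.
rewrite (_ : cube x r = \big[setI/setT]_(i < n) [set y : 'rV[R]_n |
    y 0 i \in `[x 0 i, x 0 i + r]]); last first.
  apply/seteqP; split => y /=; rewrite -bigcap_seq /cube/= => h i.
    by move=> _ /=; rewrite in_itv/=.
  by have := h i (mem_index_enum _); rewrite /= in_itv/=.
by apply: bigsetI_measurable => i _; exact: measurable_coord_itv.
Qed.

Lemma unit_cubeE n : unit_cube n = cube 0 1.
Proof.
by apply/seteqP; split => u h i; have := h i; rewrite !mxE add0r.
Qed.

Lemma measurable_unit_cube n : measurable (unit_cube n).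
Proof. by rewrite unit_cubeE; exact: measurable_cube. Qed.

Lemma lebesgue_unit_cube n : mu n (unit_cube n) = 1%E.
Proof.
elim: n => [|n IH].
  by rewrite /= diracE mem_set//; case.
rewrite lebesgue_rVS -IH -[unit_cube n]setIT -integral_indic//; last first.
  exact: measurable_unit_cube.
apply: eq_integral => v _.
have [vU|vU] := pselect (unit_cube n v).
  rewrite indicE mem_set//; transitivity (leb `[0, 1]%classic); last first.
    by rewrite lebesgue_measure_itv/= lte_fin ltr01 oppr0 adde0.
  congr (leb _); apply/seteqP; split => a /=.
    by move=> /(_ ord0); rewrite mxE unlift_none in_itv.
  rewrite in_itv/= => a01 i; rewrite mxE.
  by case: (unliftP ord0 i) => [j _|_] //=.
rewrite indicE memNset// (_ : [set a | _] = set0) ?measure0//.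
apply/seteqP; split => a //= h; apply: vU => i.
by have := h (lift ord0 i); rewrite mxE liftK.
Qed.

Lemma hom_cube n (x : 'rV[R]_n) (r : R) : 0 < r ->
  hom x r @^-1` cube x r = unit_cube n.
Proof.
move=> r0; have E i u : (x 0 i <= hom x r u 0 i <= x 0 i + r) = (0 <= u 0 i <= 1).
  rewrite /hom !mxE lerDl lerD2l pmulr_rge0//.
  by rewrite -[X in _ && (_ <= X)]mulr1 ler_pM2l.
by apply/seteqP; split => u h i; [rewrite -E|rewrite E]; exact: h.
Qed.

Lemma lebesgue_cube n (x : 'rV[R]_n) (r : R) : 0 < r ->
  mu n (cube x r) = (r ^+ n)%:E.
Proof.
move=> r0; have := lebesgue_rV_hom x r0 (measurable_cube x r).
rewrite hom_cube// lebesgue_unit_cube => /(congr1 (fun z => ((r ^+ n)%:E * z)%E)).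
by rewrite mule1 muleA -EFinM divff ?mul1e// expf_neq0// gt_eqF.
Qed.

Lemma measurable_linear_form n (a : 'rV[R]_n) :
  measurable_fun setT (fun x : 'rV[R]_n => mxdot a x).
Proof.
rewrite (_ : (fun _ => _) = fun x : 'rV[R]_n => \sum_(j < n) a 0 j * rV_coord j x).
  apply: measurable_sum => j; apply: measurable_funM => //.
  exact: measurable_rV_coord.
by apply/funext => x; rewrite /mxdot big_ord1.
Qed.

Lemma measurable_affine_form n (a : 'rV[R]_n) (b : R) :
  measurable_fun setT (fun x : 'rV[R]_n => mxdot a x + b).
Proof. by apply: measurable_funD => //; exact: measurable_linear_form. Qed.

Lemma measurable_hyperplane n (a : 'rV[R]_n) (b : R) :
  measurable [set x : 'rV[R]_n | mxdot a x + b = 0].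
Proof.
rewrite -[X in measurable X]setTI.
exact: (measurable_affine_form a b measurableT (measurable_set1 0)).
Qed.

Lemma measurable_halfspace n (a : 'rV[R]_n) (b : R) :
  measurable [set x : 'rV[R]_n | 0 <= mxdot a x + b].
Proof.
rewrite (_ : [set _ | _] = setT `&` (fun x => mxdot a x + b) @^-1` `[0, +oo[).
  by apply: measurable_affine_form => //; exact: measurable_itv.
by rewrite setTI; apply/seteqP; split => x /=; rewrite in_itv/= andbT.
Qed.

(** Slicing along the coordinate [ord0]: if its coefficient is nonzero, every slice is a point;
    otherwise the slices are empty off the hyperplane of the other coefficients, which is null by
    induction. *)
Lemma lebesgue_hyperplane n (a : 'rV[R]_n) (b : R) : a != 0 ->
  mu n [set x | mxdot a x + b = 0] = 0%E.
Proof.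
elim: n a b => [|n IH] a b a0.
  by case/eqP: a0; apply/rowP => -[].
rewrite lebesgue_rVS.
pose a' : 'rV[R]_n := \row_j a 0 (lift ord0 j).
have consE v c : mxdot a (rV_cons (v, c)) = a 0 ord0 * c + mxdot a' v.
  rewrite /mxdot !big_ord1 big_ord_recl mxE unlift_none; congr (_ + _).
  by apply: eq_bigr => j _; rewrite !mxE liftK.
have [a00|a00] := eqVneq (a 0 ord0) 0; last first.
  apply: integral0_eq => v _.
  rewrite (_ : [set _ | _] = [set - (mxdot a' v + b) / a 0 ord0]).
    exact: lebesgue_measure_set1.
  apply/seteqP; split => c /=; rewrite consE => h.
    apply: (mulfI a00); rewrite mulrC (mulrC _ (_ / _)) divfK//.
    by apply/eqP; rewrite -subr_eq0 opprK addrA mulrC; apply/eqP.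
  by rewrite h mulrC divfK//; ring.
have a'0 : a' != 0.
  apply: contra_neq a0 => a'0; apply/rowP => j; rewrite mxE.
  case: (unliftP ord0 j) => [k ->|->//].
  by have /rowP/(_ k) := a'0; rewrite !mxE.
pose B := [set v : 'rV[R]_n | mxdot a' v + b = 0].
rewrite (ge0_integral_setD_null _ (N := B)) => [|||x _].
- apply: integral0_eq => v [_ Bv].
  rewrite (_ : [set _ | _] = set0) ?measure0//.
  by apply/seteqP; split => c //=; rewrite consE a00 mul0r add0r.
- exact: measurable_hyperplane.
- exact: IH.
- exact: measure_ge0.
Qed.

End lebesgue_rV_theory.

(** * Euclidean geometry *)

Section euclidean_theory.
Context {R : realType}.

Section mxdot_theory.
Variables (m n : nat).
Implicit Types (A B C : 'M[R]_(m, n)).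

Lemma mxdotC A B : mxdot A B = mxdot B A.
Proof. by apply: eq_bigr => i _; apply: eq_bigr => j _; rewrite mulrC. Qed.

Lemma mxdotDl A B C : mxdot (A + B) C = mxdot A C + mxdot B C.
Proof.
rewrite /mxdot -big_split; apply: eq_bigr => i _ /=.
by rewrite -big_split; apply: eq_bigr => j _ /=; rewrite mxE mulrDl.
Qed.

Lemma mxdotDr A B C : mxdot C (A + B) = mxdot C A + mxdot C B.
Proof. by rewrite !(mxdotC C) mxdotDl. Qed.

Lemma mxdotZl a A B : mxdot (a *: A) B = a * mxdot A B.
Proof.
rewrite /mxdot mulr_sumr; apply: eq_bigr => i _.
by rewrite mulr_sumr; apply: eq_bigr => j _ /=; rewrite mxE mulrA.
Qed.

Lemma mxdotZr a A B : mxdot B (a *: A) = a * mxdot B A.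
Proof. by rewrite !(mxdotC B) mxdotZl. Qed.

Lemma mxdotNr A B : mxdot B (- A) = - mxdot B A.
Proof. by rewrite -scaleN1r mxdotZr mulN1r. Qed.

Lemma mxdotNl A B : mxdot (- A) B = - mxdot A B.
Proof. by rewrite -scaleN1r mxdotZl mulN1r. Qed.

Lemma mxdot0l A : mxdot 0 A = 0.
Proof. by rewrite -(scale0r A) mxdotZl mul0r. Qed.

Lemma mxdot_sumr (I : finType) (P : pred I) (F : I -> 'M[R]_(m, n)) A :
  mxdot A (\sum_(i | P i) F i) = \sum_(i | P i) mxdot A (F i).
Proof.
by elim/big_ind2 : _ => [|x1 x2 y1 y2 <- <-|//]; rewrite ?mxdotDr// mxdotC mxdot0l.
Qed.

Lemma mxdot_ge0 A : 0 <= mxdot A A.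
Proof. by apply: sumr_ge0 => i _; apply: sumr_ge0 => j _; rewrite -expr2 sqr_ge0. Qed.

Lemma enorm_ge0 A : 0 <= enorm A. Proof. exact: sqrtr_ge0. Qed.

Lemma sqr_enorm A : enorm A ^+ 2 = mxdot A A.
Proof. by rewrite sqr_sqrtr// mxdot_ge0. Qed.

Lemma sqr_entry_le A i j : A i j ^+ 2 <= mxdot A A.
Proof.
rewrite /mxdot (bigD1 i)//= (bigD1 j)//= -expr2 -addrA lerDl addr_ge0//.
  by apply: sumr_ge0 => k _; rewrite -expr2 sqr_ge0.
by apply: sumr_ge0 => k _; apply: sumr_ge0 => l _; rewrite -expr2 sqr_ge0.
Qed.

Lemma entry_le_enorm A i j : `|A i j| <= enorm A.
Proof. by rewrite -sqrtr_sqr ler_wsqrtr// sqr_entry_le. Qed.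

Lemma mxdot_eq0 A : mxdot A A = 0 -> A = 0.
Proof.
move=> A0; apply/matrixP => i j; rewrite mxE; apply/eqP.
by rewrite -sqrf_eq0 eq_le sqr_ge0 andbT -A0 sqr_entry_le.
Qed.

Lemma sqr_mxdot_le A B : mxdot A B ^+ 2 <= mxdot A A * mxdot B B.
Proof.
have [B0|] := eqVneq (mxdot B B) 0.
  by rewrite (mxdot_eq0 B0) mxdotC !mxdot0l mulr0 expr2 mulr0.
rewrite neq_lt ltNge mxdot_ge0/= => B0.
have := mxdot_ge0 (mxdot B B *: A - mxdot A B *: B).
rewrite !(mxdotDl, mxdotDr, mxdotNl, mxdotNr, mxdotZl, mxdotZr) (mxdotC B A).
move=> H; rewrite -subr_ge0 -(pmulr_rge0 _ B0).
by apply: le_trans H _; rewrite le_eqVlt; apply/orP; left; apply/eqP; ring.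
Qed.

Lemma mxdot_le_enorm A B : mxdot A B <= enorm A * enorm B.
Proof.
apply: le_trans (ler_norm _) _; rewrite -sqrtr_sqr -sqrtrM ?mxdot_ge0//.
by rewrite ler_wsqrtr// sqr_mxdot_le.
Qed.

Lemma enormZ a A : enorm (a *: A) = `|a| * enorm A.
Proof. by rewrite /enorm mxdotZl mxdotZr mulrA -expr2 sqrtrM ?sqr_ge0// sqrtr_sqr. Qed.

Lemma enormN A : enorm (- A) = enorm A.
Proof. by rewrite /enorm mxdotNl mxdotNr opprK. Qed.

Lemma enormB A B : enorm (A - B) = enorm (B - A).
Proof. by rewrite -enormN opprB. Qed.

Lemma enormD A B : enorm (A + B) <= enorm A + enorm B.
Proof.
rewrite -(@ler_pXn2r _ 2)// ?nnegrE ?addr_ge0 ?enorm_ge0//.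
rewrite sqrrD !sqr_enorm mxdotDl !mxdotDr (mxdotC B A).
have := mxdot_le_enorm A B; lra.
Qed.

End mxdot_theory.

Lemma mxdot_rV n (a x : 'rV[R]_n) : mxdot a x = \sum_j a 0 j * x 0 j.
Proof. by rewrite /mxdot big_ord1. Qed.

Lemma enorm_le_coord n (v : 'rV[R]_n) e : 0 <= e -> (forall i, `|v 0 i| <= e) ->
  enorm v <= n%:R * e.
Proof.
move=> e0 h; rewrite -(@ler_pXn2r _ 2)// ?nnegrE ?enorm_ge0 ?mulr_ge0//.
rewrite sqr_enorm mxdot_rV; apply: (@le_trans _ _ (n%:R * e ^+ 2)).
  rewrite mulr_natl -[n in leRHS]card_ord -sumr_const; apply: ler_sum => i _.
  by rewrite -expr2 -real_normK ?num_real// ler_pXn2r// nnegrE.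
rewrite exprMn ler_wpM2r ?sqr_ge0// -natrX ler_nat.
by case: n {v h} => // n; rewrite leq_pmulr.
Qed.

Lemma nbhs_enorm n (x : 'rV[R]_n) e : 0 < e ->
  nbhs x [set y | enorm (y - x) < e].
Proof.
move=> e0; apply/nbhs_ballP; exists (e / n.+1%:R); first by rewrite /= divr_gt0.
move=> y /= [_ xy]; apply: (@le_lt_trans _ _ (n%:R * (e / n.+1%:R))).
  apply: enorm_le_coord => [|i]; first by rewrite divr_ge0// ltW.
  by rewrite !mxE distrC; exact/ltW/xy.
by rewrite mulrCA gtr_pMr// ltr_pdivrMr// mul1r ltr_nat.
Qed.

Lemma nbhs_coord n (x : 'rV[R]_n) (U : set 'rV[R]_n) : nbhs x U ->
  exists2 e : R, 0 < e &
    forall y : 'rV[R]_n, (forall i, `|y 0 i - x 0 i| < e) -> U y.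
Proof.
move=> /nbhs_ballP[e /= e0 h]; exists e => // y yx; apply: h; split=> //= i j.
by rewrite ord1 /ball/= distrC; exact: yx.
Qed.

End euclidean_theory.

(** * Barycentric coordinates as affine functions *)

Section barycentric_coordinates.
Context {R : realType} {d : nat}.

Definition aff (a : 'rV[R]_d) (b : R) (x : 'rV[R]_d) : R := mxdot a x + b.

Lemma aff_comb (T : finType) (l : T -> R) (p : T -> 'rV[R]_d) a b :
  \sum_i l i = 1 -> aff a b (\sum_i l i *: p i) = \sum_i l i * aff a b (p i).
Proof.
move=> l1; rewrite /aff mxdot_sumr -[in LHS](mul1r b) -l1 mulr_suml -big_split.
by apply: eq_bigr => i _ /=; rewrite mxdotZr mulrDr.
Qed.

Lemma affD a b x t v : aff a b (x + t *: v) = aff a b x + t * mxdot a v.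
Proof. by rewrite /aff mxdotDr mxdotZr; ring. Qed.

Lemma nbhs_aff_pos (T : finType) (A : {set T}) (a : T -> 'rV[R]_d) (b : T -> R) x :
  (forall i, i \in A -> 0 < aff (a i) (b i) x) ->
  nbhs x [set y | forall i, i \in A -> 0 <= aff (a i) (b i) y].
Proof.
(* An affine form with linear part [a i] varies by at most [enorm (a i)] times the distance; [+ 1]
   avoids a zero divisor. *)
move=> Kx; pose e i := aff (a i) (b i) x / (enorm (a i) + 1).
have c0 i : 0 < enorm (a i) + 1 by rewrite ltr_wpDl// enorm_ge0.
pose e0 := \big[Num.min/1]_(i in A) e i.
have e0_gt0 : 0 < e0.
  rewrite /e0; elim/big_ind : _ => [//|u v u0 v0|i iA].
    by rewrite lt_min u0 v0.
  by rewrite divr_gt0// Kx.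
apply: filterS (nbhs_enorm x e0_gt0) => y /= yx i iA.
have {}yx : enorm (y - x) < e i by apply: lt_le_trans yx _; exact: bigmin_le_cond.
have -> : aff (a i) (b i) y = aff (a i) (b i) x - mxdot (a i) (x - y).
  by rewrite /aff mxdotDr mxdotNr; ring.
rewrite subr_ge0; apply: le_trans (mxdot_le_enorm _ _) _.
rewrite enormB; move: yx; rewrite /e ltr_pdivlMr// => /ltW; apply: le_trans.
by rewrite mulrC ler_wpM2l ?enorm_ge0// lerDl.
Qed.

(** Affine independence makes the matrix with rows [(1, p_k)] invertible. The columns of its inverse
    hold the coefficients of the barycentric coordinates, which thus extend to affine functions on
    the whole space. *)
Lemma affine_independent_dual (T : finType) (p : T -> 'rV[R]_d) (A : {set T}) :
  #|A| = d.+1 -> affinely_independent p A ->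
  exists (a : T -> 'rV[R]_d) (b : T -> R),
    [/\ forall i x, i \notin A -> aff (a i) (b i) x = 0,
        forall x, \sum_i aff (a i) (b i) x = 1 &
        forall x, \sum_i aff (a i) (b i) x *: p i = x].
Proof.
move=> cA ind; pose e (k : 'I_(1 + d)) : T := enum_val (cast_ord (esym cA) k).
have e_inj : injective e by move=> i j /enum_val_inj /cast_ord_inj.
have eA k : e k \in A by exact: enum_valP.
pose P : 'M[R]_(1 + d) := \matrix_k row_mx 1%:M (p (e k)).
have Punit : P \in unitmx.
  rewrite -row_free_unit -kermx_eq0; apply/eqP/row_matrixP => r; rewrite row0.
  set v := row r (kermx P).
  have vP : v *m P = 0 by rewrite /v -row_mul mulmx_ker row0.
  pose l i := \sum_(k | e k == i) v 0 k.
  have lk k : l (e k) = v 0 k.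
    rewrite /l (bigD1 k)//= big1 ?addr0// => k' /andP[/eqP/e_inj->].
    by rewrite eqxx.
  have sumE (V : lmodType R) (F : T -> V) :
      \sum_i l i *: F i = \sum_k v 0 k *: F (e k).
    rewrite [RHS](partition_big e xpredT)//=; apply: eq_bigr => i _.
    by rewrite /l scaler_suml; apply: eq_bigr => k /eqP->.
  have vE : \sum_k v 0 k *: row_mx 1%:M (p (e k)) = (0 : 'rV_(1 + d)).
    by rewrite -[RHS]vP mulmx_sum_row; apply: eq_bigr => k _; rewrite rowK.
  have l0 : forall i, l i = 0.
    apply: ind.
    - move=> i iA; apply: big1 => k /eqP ki; move: iA.
      by rewrite -ki eA.
    - have := sumE R^o (fun=> 1); under eq_bigr do rewrite scaler1.
      move=> ->; move/rowP/(_ (lshift d 0)): vE; rewrite summxE mxE => {2}<-.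
      by apply: eq_bigr => k _; rewrite !mxE (unsplitK (inl _)) mxE eqxx.
    - rewrite sumE; apply/rowP => j; move/rowP/(_ (rshift 1 j)): vE.
      rewrite !summxE !mxE => {2}<-.
      by apply: eq_bigr => k _; rewrite !mxE (unsplitK (inr _)).
  by apply/rowP => k; rewrite -lk l0 mxE.
pose a0 (k : 'I_(1 + d)) : 'rV[R]_d := \row_j invmx P (rshift 1 j) k.
pose b0 (k : 'I_(1 + d)) := invmx P (lshift d 0) k.
pose c x := row_mx 1%:M x *m invmx P.
have cE x k : c x 0 k = aff (a0 k) (b0 k) x.
  rewrite /c mxE big_split_ord/= big_ord1 row_mxEl mxE eqxx mul1r addrC.
  rewrite /aff mxdot_rV; congr (_ + _).
  by apply: eq_bigr => j _; rewrite row_mxEr mxE mulrC.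
exists (fun i => \sum_(k | e k == i) a0 k), (fun i => \sum_(k | e k == i) b0 k).
have affE i x : aff (\sum_(k | e k == i) a0 k) (\sum_(k | e k == i) b0 k) x =
    \sum_(k | e k == i) c x 0 k.
  rewrite /aff mxdotC mxdot_sumr -big_split/=; apply: eq_bigr => k _.
  by rewrite cE mxdotC.
have sumE x (V : lmodType R) (F : T -> V) :
    \sum_i aff (\sum_(k | e k == i) a0 k) (\sum_(k | e k == i) b0 k) x *: F i =
    \sum_k c x 0 k *: F (e k).
  rewrite [RHS](partition_big e xpredT)//=; apply: eq_bigr => i _.
  by rewrite affE scaler_suml; apply: eq_bigr => k /eqP->.
have cP x : \sum_k c x 0 k *: row_mx 1%:M (p (e k)) = row_mx 1%:M x.
  rewrite -[RHS](mulmxKV Punit) mulmx_sum_row.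
  by apply: eq_bigr => k _; rewrite rowK.
split=> [i x iA|x|x].
- by rewrite affE big1// => k /eqP ki; move: iA; rewrite -ki eA.
- have := sumE x R^o (fun=> 1); under eq_bigr do rewrite scaler1.
  move=> ->; move/rowP/(_ (lshift d 0)): (cP x).
  rewrite summxE row_mxEl mxE eqxx => E; rewrite -[RHS]E.
  by apply: eq_bigr => k _; rewrite !mxE (unsplitK (inl _)) mxE eqxx.
- rewrite sumE; apply/rowP => j; move/rowP/(_ (rshift 1 j)): (cP x).
  rewrite !summxE row_mxEr => <-.
  by apply: eq_bigr => k _; rewrite !mxE (unsplitK (inr _)).
Qed.

Lemma barycentric_unique (T : finType) (p : T -> 'rV[R]_d) (A : {set T})
    (l l' : T -> R) :
  affinely_independent p A ->
  (forall i, i \notin A -> l i = 0) -> (forall i, i \notin A -> l' i = 0) ->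
  \sum_i l i = \sum_i l' i -> \sum_i l i *: p i = \sum_i l' i *: p i ->
  l = l'.
Proof.
move=> ind lA l'A s1 s2; apply/funext => i.
apply/eqP; rewrite -subr_eq0; apply/eqP.
apply: (ind (fun i => l i - l' i)).
- by move=> j jA; rewrite lA// l'A// subrr.
- by rewrite sumrB s1 subrr.
- by under eq_bigr do rewrite scalerBl; rewrite sumrB s2 subrr.
Qed.

End barycentric_coordinates.

(** * Simplicial meshes *)

Section mesh_theory.
Context {R : realType} {d : nat}.

Section cells.
Variables (Om : set 'rV[R]_d) (M : mesh R d).
Hypothesis d_gt0 : (0 < d)%N.
Hypothesis meshM : simplicial_mesh Om M.

Notation vert := 'I_(nvtx M).

Definition dual_coef (K : {set vert}) : (vert -> 'rV[R]_d) * (vert -> R) :=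
  xget (fun=> 0, fun=> 0) [set ab |
    [/\ forall i x, i \notin K -> aff (ab.1 i) (ab.2 i) x = 0,
        forall x, \sum_i aff (ab.1 i) (ab.2 i) x = 1 &
        forall x, \sum_i aff (ab.1 i) (ab.2 i) x *: @vtx _ _ M i = x]].

Definition lamgrad K i := (dual_coef K).1 i.

Definition lam (K : {set vert}) (i : vert) : 'rV[R]_d -> R :=
  aff (lamgrad K i) ((dual_coef K).2 i).

Lemma lamP K : K \in cells M ->
  [/\ forall i x, i \notin K -> lam K i x = 0,
      forall x, \sum_i lam K i x = 1 &
      forall x, \sum_i lam K i x *: @vtx _ _ M i = x].
Proof.
move=> /(mesh_simplex meshM)[cK indK].
have [a [b [h1 h2 h3]]] := affine_independent_dual cK indK.
rewrite /lam /lamgrad /dual_coef; case: xgetP => [ab _ //|/(_ (a, b))[]].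
by split.
Qed.

Lemma barycentric_lam K x l : K \in cells M ->
  barycentric (@vtx _ _ M) K x l -> l = lam K ^~ x.
Proof.
move=> KM [l0 lK l1 lx]; have [h1 h2 h3] := lamP KM.
have [cK indK] := mesh_simplex meshM KM.
apply: (barycentric_unique indK) => //.
- by move=> i iK; exact: h1.
- by rewrite l1 h2.
- by rewrite lx h3.
Qed.

Lemma cellP K x : K \in cells M -> cell K x <-> (forall i, 0 <= lam K i x).
Proof.
move=> KM; have [h1 h2 h3] := lamP KM; split => [[l lb] i|l0].
  by have [l0 _ _ _] := lb; have := l0 i; rewrite (barycentric_lam KM lb).
by exists (lam K ^~ x); split=> // i iK; exact: h1.
Qed.

Lemma lam_vtx K i j : K \in cells M -> j \in K ->
  lam K i (vtx j) = (i == j)%:R.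
Proof.
move=> KM jK; rewrite -[LHS]/((lam K ^~ (vtx j)) i).
rewrite -(@barycentric_lam K (vtx j) (fun i => (i == j)%:R))//.
split => [k|k kK||].
- exact: ler0n.
- by case: eqP => // kj; move: kK; rewrite kj jK.
- by rewrite (bigD1 j)//= eqxx big1 ?addr0// => k /negPf->.
- rewrite (bigD1 j)//= eqxx scale1r big1 ?addr0// => k /negPf->.
  by rewrite scale0r.
Qed.

Lemma lamgrad_neq0 K i : K \in cells M -> i \in K -> lamgrad K i != 0.
Proof.
move=> KM iK; have [cK _] := mesh_simplex meshM KM.
have /card_gt0P[j] : (0 < #|K :\ i|)%N.
  by have := cardsD1 i K; rewrite iK cK add1n => -[<-].
rewrite !inE => /andP[ji jK]; apply/eqP => a0.
have := lam_vtx i KM iK; have := lam_vtx i KM jK.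
rewrite eqxx eq_sym (negPf ji) /lam a0 /aff !mxdot0l !add0r => ->.
by move/eqP; rewrite eq_sym oner_eq0.
Qed.

Lemma cell_vtx K i : K \in cells M -> i \in K -> cell K (vtx i).
Proof. by move=> KM iK; apply/cellP => // j; rewrite lam_vtx// ler0n. Qed.

Lemma closureP x : closure Om x <-> exists2 K, K \in cells M & cell K x.
Proof.
by rewrite (mesh_cover meshM); split => [[K KM Kx]|[K KM Kx]]; exists K.
Qed.

Lemma vtx_closure (i : vert) : closure Om (vtx i).
Proof.
by have [K KM iK] := mesh_vtx_used meshM i; apply/closureP; exists K => //; exact: cell_vtx.
Qed.

(** Contains the whole hyperplane through each facet, not just the facet. The set is still null, and
    off it a point of a closed cell is interior to that cell. *)
Definition skel : set 'rV[R]_d :=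
  \bigcup_(Ki in [set Ki : {set vert} * vert | (Ki.1 \in cells M) && (Ki.2 \in Ki.1)])
    [set x | lam Ki.1 Ki.2 x = 0].

Lemma measurable_skel : measurable skel.
Proof.
by apply: fin_bigcup_measurable => [|Ki _]; [exact: finite_finset|exact: measurable_hyperplane].
Qed.

Lemma skel_null : lebesgue_rV d skel = 0%E.
Proof.
pose P := [pred Ki : {set vert} * vert | (Ki.1 \in cells M) && (Ki.2 \in Ki.1)].
have -> : skel = \big[setU/set0]_(Ki in P) [set x | lam Ki.1 Ki.2 x = 0].
  by rewrite -bigcup_pred.
suff : measurable (\big[setU/set0]_(Ki in P) [set x | lam Ki.1 Ki.2 x = 0]) /\
  lebesgue_rV d (\big[setU/set0]_(Ki in P) [set x | lam Ki.1 Ki.2 x = 0]) = 0%E.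
  by case.
elim/big_ind : _ => [|A B [mA A0] [mB B0]|Ki /andP[KM iK]].
- by split => //; exact: measure0.
- by split; [exact: measurableU|rewrite measureU0].
- split; first exact: measurable_hyperplane.
  exact: lebesgue_hyperplane (lamgrad_neq0 KM iK).
Qed.

Lemma measurable_cell K : K \in cells M -> measurable (cell K).
Proof.
move=> KM; rewrite (_ : cell K = \big[setI/setT]_(i : vert) [set x | 0 <= lam K i x]).
  by apply: bigsetI_measurable => i _; exact: measurable_halfspace.
apply/seteqP; split => x /=; rewrite -bigcap_seq/=.
  by move/cellP => h i _; exact: h.
by move=> h; apply/cellP => // i; apply: h; rewrite /= mem_index_enum.
Qed.

Lemma measurable_closure : measurable (closure Om).
Proof.
rewrite (mesh_cover meshM); apply: fin_bigcup_measurable => [|K KM].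
  exact: finite_finset.
exact: measurable_cell.
Qed.

Lemma cell_off_skel K x : K \in cells M -> cell K x -> ~ skel x ->
  forall i, i \in K -> 0 < lam K i x.
Proof.
move=> KM /cellP-/(_ KM) Kx sx i iK; rewrite lt_neqAle Kx andbT eq_sym.
by apply/eqP => l0; apply: sx; exists (K, i) => //=; rewrite KM iK.
Qed.

Lemma nbhs_cell K x : K \in cells M -> (forall i, i \in K -> 0 < lam K i x) ->
  nbhs x (cell K).
Proof.
move=> KM Kx; apply: filterS (nbhs_aff_pos Kx) => y /= yK; apply/cellP => // i.
have [/yK//|iK] := boolP (i \in K).
by have [h1 _ _] := lamP KM; rewrite h1.
Qed.

(** By conformity a common point lies in the face spanned by the common vertices. If a vertex of [K]
    is missing there, the corresponding coordinate vanishes and the point is on the skeleton. *)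
Lemma cell_unique K K' x : K \in cells M -> K' \in cells M ->
  cell K x -> cell K' x -> ~ skel x -> K = K'.
Proof.
move=> KM KM' Kx K'x sx; apply/eqP; rewrite eqEcard.
have [cK _] := mesh_simplex meshM KM; have [cK' _] := mesh_simplex meshM KM'.
rewrite cK cK' leqnn andbT; apply/fintype.subsetP => i iK.
have : (cell K `&` cell K') x by [].
rewrite (mesh_conforming meshM KM KM') => -[l [l0 lK l1 lx]].
apply: contra_notT sx => iK'; exists (K, i) => /=; first by rewrite KM iK.
have -> : lam K i x = l i; last by apply: lK; rewrite inE (negPf iK') andbF.
suff -> : l = lam K ^~ x by [].
apply: (barycentric_lam KM); split => // j jK; apply: lK.
by rewrite inE (negPf jK).
Qed.

(** A point of the closure off the skeleton has a neighbourhood inside a cell, hence inside the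
    closure. At a boundary point this is impossible, because the side below the Lipschitz graph
    contains no point of [Om]; in particular slits are excluded. *)
Lemma Omega_setD_skel : polytopal_lipschitz_domain Om ->
  Om `\` skel = closure Om `\` skel.
Proof.
move=> dom; apply/seteqP; split => x [Ox sx]; split => //.
  exact: subset_closure.
apply: contrapT => nOx.
have [K KM Kx] := (closureP x).1 Ox.
have nbK : nbhs x (cell K) by apply: nbhs_cell => //; exact: cell_off_skel.
have bx : boundary Om x by split => // h; apply: nOx; exact: interior_subset h.
have [e [r [L [gamma [e1 r0 ge gL gO]]]]] := dom_lipschitz dom bx.
have gx : mxdot x e <= gamma x.
  rewrite leNgt; apply/negP => h; apply: nOx; apply/gO => //.
  by rewrite subrr /enorm mxdot0l sqrtr0.
have [eps eps0 hK] := nbhs_coord nbK.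
(* Moving down by [t] stays both in the cell and in the chart of the graph. *)
pose t := Num.min (eps / 2) (r / 2).
have t0 : 0 < t by rewrite lt_min !divr_gt0.
have tr : t < r by rewrite gt_min; apply/orP; right; rewrite ltr_pdivrMr// ltr_pMr// ltr1n.
have te : t < eps by rewrite gt_min; apply/orP; left; rewrite ltr_pdivrMr// ltr_pMr// ltr1n.
pose y := x + (- t) *: e.
have Ky : cell K y.
  apply: hK => i; rewrite /y !mxE (_ : _ - _ = - t * e 0 i); last by ring.
  rewrite normrM normrN (gtr0_norm t0)//.
  apply: le_lt_trans te; rewrite -[leRHS]mulr1 ler_pM2l//.
  by have := entry_le_enorm e 0 i; rewrite e1.
have Cy : closure Om y by apply/closureP; exists K.
pose L' := `|L| + 1.
have L'0 : 0 < L' by rewrite ltr_wpDl.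
(* From [y] to a point within [t / (L' + 1)], the height along [e] and the graph together move by at
   most [t], and [y] lies at least [t] below the graph. *)
pose del := Num.min (r - t) (t / (L' + 1)).
have del0 : 0 < del by rewrite lt_min subr_gt0 tr divr_gt0// addr_gt0.
have [w [Ow /= wy]] := Cy _ (nbhs_enorm y del0).
have wr : enorm (w - x) < r.
  rewrite (_ : w - x = (w - y) + (y - x)); last by rewrite addrA subrK.
  apply: le_lt_trans (enormD _ _) _.
  rewrite (_ : y - x = (- t) *: e); last by rewrite /y addrC addKr.
  rewrite enormZ e1 mulr1 normrN gtr0_norm// -ltrBrDr.
  by apply: lt_le_trans wy _; rewrite ge_min lexx.
have := (gO _ wr).1 Ow; apply/negP; rewrite -leNgt.
have gy : gamma y = gamma x by exact: ge.
have h1 : gamma y - gamma w <= L' * enorm (w - y).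
  apply: le_trans (ler_norm _) _; apply: le_trans (gL _ _) _.
  rewrite enormB ler_wpM2r ?enorm_ge0//.
  by rewrite (le_trans (ler_norm _))// lerDl.
have h2 : mxdot w e = mxdot x e - t + mxdot (w - y) e.
  rewrite /y mxdotDl mxdotNl mxdotDl mxdotZl -(sqr_enorm e) e1 expr1n; ring.
have h3 : mxdot (w - y) e <= enorm (w - y).
  by apply: le_trans (mxdot_le_enorm _ _) _; rewrite e1 mulr1.
have h4 : (L' + 1) * enorm (w - y) <= t.
  have L'1 : 0 < L' + 1 by rewrite addr_gt0.
  rewrite -ler_pdivlMl// mulrC; apply: ltW.
  by apply: lt_le_trans wy _; rewrite ge_min lexx orbT.
by rewrite h2; nra.
Qed.

Definition offskel : set 'rV[R]_d := closure Om `\` skel.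

Lemma measurable_offskel : measurable offskel.
Proof. by apply: measurableD; [exact: measurable_closure|exact: measurable_skel]. Qed.

Definition mesh_bound : R := \sum_i \sum_j `|@vtx _ _ M i 0 j|.

Lemma cell_bounded (K : {set vert}) x j : cell K x -> `|x 0 j| <= mesh_bound.
Proof.
move=> [l [l0 _ l1 <-]]; rewrite summxE; apply: le_trans (ler_norm_sum _ _ _) _.
apply: ler_sum => i _; rewrite mxE normrM ger0_norm//.
have li1 : l i <= 1.
  by rewrite -l1 (bigD1 i)//= lerDl sumr_ge0.
apply: (@le_trans _ _ `|vtx i 0 j|); first by rewrite ler_piMl.
by rewrite (bigD1 j)//= lerDl sumr_ge0.
Qed.

Lemma closure_bounded x j : closure Om x -> `|x 0 j| <= mesh_bound.
Proof. by move=> /closureP[K _]; exact: cell_bounded. Qed.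

Lemma mesh_bound_ge0 : 0 <= mesh_bound.
Proof. by apply: sumr_ge0 => i _; apply: sumr_ge0. Qed.

Lemma closure_finite : (lebesgue_rV d (closure Om) < +oo)%E.
Proof.
pose B := mesh_bound + 1.
have B0 : 0 < B by rewrite ltr_wpDl// mesh_bound_ge0.
have B2 : 0 < 2 * B by rewrite mulr_gt0.
apply: (@le_lt_trans _ _ (lebesgue_rV d (cube (const_mx (- B)) (2 * B)))).
  apply: le_measure; rewrite ?inE//.
  - exact: measurable_closure.
  - exact: measurable_cube.
  - move=> x /closure_bounded h i; rewrite mxE.
    by have := h i; rewrite ler_norml /B => /andP[]; lra.
by rewrite lebesgue_cube// ltry.
Qed.

Lemma offskel_finite : (lebesgue_rV d offskel < +oo)%E.
Proof.
apply: le_lt_trans closure_finite; apply: le_measure; rewrite ?inE.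
- exact: measurable_offskel.
- exact: measurable_closure.
- by move=> x [].
Qed.

Lemma derive_aff (f : 'rV[R]_d -> R) (a : 'rV[R]_d) b x v :
  (\near x, f x = aff a b x) -> 'D_v f x = mxdot a v.
Proof.
move=> fa; rewrite (near_eq_derive _ fa) /derive; apply: cvg_lim => //.
apply: cvg_trans (_ : cst (mxdot a v) @ 0^' --> mxdot a v); last exact: cvg_cst.
apply: near_eq_cvg; near=> h; rewrite /cst.
have -> : (aff a b \o shift x) (h *: v) = aff a b (x + h *: v) by rewrite /= addrC.
rewrite affD addrAC subrr add0r /GRing.scale/= mulrA mulVf ?mul1r//.
by near: h; exact: nbhs_dnbhs_neq.
Unshelve. all: by end_near. Qed.

End cells.

End mesh_theory.

(** * Piecewise affine functions *)

Section piecewise_functions.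
Context {R : realType} {d : nat}.
Variables (Om : set 'rV[R]_d) (M : mesh R d).
Hypothesis d_gt0 : (0 < d)%N.
Hypothesis meshM : simplicial_mesh Om M.
Hypothesis domOm : polytopal_lipschitz_domain Om.

Notation vert := 'I_(nvtx M).
Notation U := (offskel Om M).
Notation mu := (@lebesgue_rV R d).
Implicit Types (F G : 'rV[R]_d -> R).

Let mU : measurable U. Proof. exact: measurable_offskel. Qed.

Lemma offskel_cell x : U x -> exists2 K, K \in cells M & cell K x.
Proof. by case=> /(closureP meshM). Qed.

Lemma integral_Omega (f : 'rV[R]_d -> \bar R) :
  (\int[mu]_(x in Om) f x = \int[mu]_(x in U) f x)%E.
Proof.
rewrite (integral_setD_null _ _ (measurable_skel M) (skel_null d_gt0 meshM)).
by rewrite (Omega_setD_skel meshM domOm).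
Qed.

Lemma Rintegral_Omega F : \int[mu]_(x in Om) F x = \int[mu]_(x in U) F x.
Proof. by rewrite /Rintegral integral_Omega. Qed.

(** Boundedness is preserved by products, unlike integrability, so all integrands of the scheme can
    be expanded and integrated termwise. *)
Definition good F :=
  measurable_fun U F /\ exists C, forall x, U x -> `|F x| <= C.

Lemma good_integrable F : good F -> mu.-integrable U (EFin \o F).
Proof.
move=> [mF [C FC]]; apply: measurable_bounded_integrable => //.
  exact: offskel_finite.
exists C; split; first exact: num_real.
by move=> x Cx y Uy /=; apply: le_trans (FC _ Uy) (ltW Cx).
Qed.

Lemma eq_good F G : (forall x, U x -> F x = G x) -> good F -> good G.
Proof.
move=> FG [mF [C FC]]; split.
  by apply: eq_measurable_fun mF => x /set_mem; exact: FG.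
by exists C => x Ux; rewrite -FG// FC.
Qed.

Lemma good_cst c : good (fun=> c).
Proof. by split; [exact: measurable_cst|exists `|c|]. Qed.

Lemma goodD F G : good F -> good G -> good (fun x => F x + G x).
Proof.
move=> [mF [C FC]] [mG [C' GC]]; split; first exact: measurable_funD.
by exists (C + C') => x Ux; rewrite (le_trans (ler_normD _ _))// lerD ?FC ?GC.
Qed.

Lemma goodM F G : good F -> good G -> good (fun x => F x * G x).
Proof.
move=> [mF [C FC]] [mG [C' GC]]; split; first exact: measurable_funM.
by exists (C * C') => x Ux; rewrite normrM ler_pM ?FC ?GC.
Qed.

Lemma goodZ c F : good F -> good (fun x => c * F x).
Proof. by apply: goodM; exact: good_cst. Qed.

Lemma goodN F : good F -> good (fun x => - F x).
Proof. by move=> /(goodZ (-1)); apply: eq_good => x _; rewrite mulN1r. Qed.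

Lemma goodB F G : good F -> good G -> good (fun x => F x - G x).
Proof. by move=> gF /goodN; exact: goodD. Qed.

Lemma goodX F k : good F -> good (fun x => F x ^+ k).
Proof.
move=> gF; elim: k => [|k IH]; first exact: good_cst.
by apply: eq_good (goodM gF IH) => x _; rewrite exprS.
Qed.

Lemma good_sum (I : finType) (P : pred I) (f : I -> 'rV[R]_d -> R) :
  (forall i, P i -> good (f i)) -> good (fun x => \sum_(i | P i) f i x).
Proof.
move=> gf; rewrite (_ : (fun x => _) = \sum_(i | P i) f i); last first.
  by apply/funext => x; rewrite fct_sumE.
by elim/big_ind : _ => [|F G|//]; [exact: good_cst|exact: goodD].
Qed.

Lemma good_cells F (G : {set vert} -> 'rV[R]_d -> R) :
  (forall K, K \in cells M -> measurable_fun setT (G K)) ->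
  (forall K, K \in cells M -> exists C, forall x, cell K x -> `|G K x| <= C) ->
  (forall K x, K \in cells M -> U x -> cell K x -> F x = G K x) -> good F.
Proof.
move=> mG bG FG; split.
  move=> _ Y mY; rewrite (_ : U `&` F @^-1` Y =
      \bigcup_(K in [set` cells M]) ((U `&` cell K) `&` (setT `&` G K @^-1` Y))).
    apply: fin_bigcup_measurable => [|K KM]; first exact: finite_finset.
    apply: measurableI; last exact: mG.
    by apply: measurableI => //; exact: (measurable_cell meshM).
  apply/seteqP; split => x /=.
    move=> [Ux FY]; have [K KM Kx] := offskel_cell Ux.
    by exists K => //; split=> //; split=> //=; rewrite -(FG K).
  by move=> [K KM [[Ux Kx] [_ /=]]]; rewrite -(FG K).
have /choice[C CP] : forall K, exists C, K \in cells M ->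
    forall x, cell K x -> `|G K x| <= C.
  move=> K; by have [/bG[C CK]|/negP KN] := boolP (K \in cells M); [exists C|exists 0].
exists (\sum_(K in cells M) `|C K|) => x Ux.
have [K KM Kx] := offskel_cell Ux; rewrite (FG K)//.
apply: le_trans (CP _ KM _ Kx) _; apply: le_trans (ler_norm _) _.
by rewrite (bigD1 K)//= lerDl sumr_ge0.
Qed.

Lemma aff_bounded a b (K : {set vert}) :
  exists C, forall x, cell K x -> `|aff a b x| <= C.
Proof.
exists (\sum_j `|a 0 j| * mesh_bound M + `|b|) => x Kx.
rewrite /aff (le_trans (ler_normD _ _))// lerD2r mxdot_rV.
apply: le_trans (ler_norm_sum _ _ _) _; apply: ler_sum => j _.
by rewrite normrM ler_wpM2l// (cell_bounded _ Kx).
Qed.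

Definition pwaff (v : 'rV[R]_d -> R) : Prop := forall K, K \in cells M ->
  exists (a : 'rV[R]_d) (b : R), forall x, cell K x -> v x = mxdot a x + b.

Lemma pwaff_coef v : pwaff v -> exists (a : {set vert} -> 'rV[R]_d) (b : {set vert} -> R),
  forall K x, K \in cells M -> cell K x -> v x = aff (a K) (b K) x.
Proof.
move=> pv; have /choice[ab abP] : forall K : {set vert}, exists ab : 'rV[R]_d * R,
    K \in cells M -> forall x, cell K x -> v x = aff ab.1 ab.2 x.
  move=> K; have [/pv[a [b vE]]|/negP KN] := boolP (K \in cells M); last by exists (0, 0).
  by exists (a, b) => _.
by exists (fun K => (ab K).1), (fun K => (ab K).2) => K x KM; exact: abP.
Qed.

Lemma derive_cell v K x a b w : K \in cells M -> cell K x -> ~ skel M x ->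
  (forall y, cell K y -> v y = aff a b y) -> 'D_w v x = mxdot a w.
Proof.
move=> KM Kx sx vE; apply: (@derive_aff _ _ _ _ b).
by apply: filterS (nbhs_cell meshM KM (cell_off_skel meshM KM Kx sx)) => y; exact: vE.
Qed.

Lemma grad_cell v K x a b : K \in cells M -> cell K x -> ~ skel M x ->
  (forall y, cell K y -> v y = aff a b y) -> grad v x = a.
Proof.
move=> KM Kx sx vE; apply/rowP => j; rewrite mxE (derive_cell _ KM Kx sx vE).
rewrite mxdot_rV (bigD1 j)//= mxE !eqxx mulr1 big1 ?addr0// => k kj.
by rewrite mxE eqxx (negPf kj) mulr0.
Qed.

Lemma good_pwaff v : pwaff v -> good v.
Proof.
move=> /pwaff_coef[a [b vE]].
apply: (@good_cells _ (fun K => aff (a K) (b K))) => [K KM|K KM|K x KM _ Kx].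
- exact: measurable_affine_form.
- exact: aff_bounded.
- exact: vE.
Qed.

Lemma good_grad v j : pwaff v -> good (fun x => grad v x 0 j).
Proof.
move=> /pwaff_coef[a [b vE]].
apply: (@good_cells _ (fun K => cst (a K 0 j))) => [K KM|K KM|K x KM [_ sx] Kx].
- exact: measurable_cst.
- by exists `|a K 0 j|.
- by rewrite (grad_cell KM Kx sx (b := b K) (a := a K))// => y; exact: vE.
Qed.

Lemma pwaff_comb v w u t : pwaff v -> pwaff w ->
  (forall x, closure Om x -> u x = v x + t * w x) -> pwaff u.
Proof.
move=> pv pw uE K KM; have [a [b vE]] := pv K KM; have [a' [b' wE]] := pw K KM.
exists (a + t *: a'), (b + t * b') => x Kx.
rewrite uE; last by apply/(closureP meshM); exists K.
by rewrite vE// wE// mxdotDl mxdotZl; ring.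
Qed.

Lemma grad_comb v w u t x : pwaff v -> pwaff w ->
  (forall x, closure Om x -> u x = v x + t * w x) -> U x ->
  grad u x = grad v x + t *: grad w x.
Proof.
move=> pv pw uE Ux; have [K KM Kx] := offskel_cell Ux; have [_ sx] := Ux.
have [a [b vE]] := pv K KM; have [a' [b' wE]] := pw K KM.
rewrite (grad_cell KM Kx sx vE) (grad_cell KM Kx sx wE).
apply: (@grad_cell _ K _ _ (b + t * b')) => // y Ky.
rewrite uE; last by apply/(closureP meshM); exists K.
by rewrite vE// wE// /aff mxdotDl mxdotZl; ring.
Qed.

Lemma pwaff_eq v u : pwaff v -> (forall x, closure Om x -> u x = v x) -> pwaff u.
Proof.
by move=> pv uE; apply: (@pwaff_comb v v u 0) => // y cy; rewrite mul0r addr0 uE.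
Qed.

Definition pwaff_vec (v : 'rV[R]_d -> 'rV[R]_d) := forall k, pwaff (fun x => v x 0 k).

Definition mxgood p q (A : 'rV[R]_d -> 'M[R]_(p, q)) :=
  forall i j, good (fun x => A x i j).

Lemma good_mxdot p q (A B : 'rV[R]_d -> 'M[R]_(p, q)) :
  mxgood A -> mxgood B -> good (fun x => mxdot (A x) (B x)).
Proof.
move=> gA gB; apply: good_sum => i _; apply: good_sum => j _; exact: goodM.
Qed.

Lemma mxgood_tensor v s : pwaff_vec v -> pwaff s ->
  mxgood (fun x => tensor (v x) (grad s x)).
Proof.
move=> pv ps i j; apply: eq_good (goodM (good_pwaff (pv i)) (good_grad j ps)).
by move=> x _; rewrite /tensor [RHS]mxE big_ord1 [in RHS]mxE.
Qed.


Lemma mxgood_mxgrad v : pwaff_vec v -> mxgood (mxgrad v).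
Proof.
by move=> pv i j; apply: eq_good (good_grad j (pv i)) => x _; rewrite !mxE.
Qed.

Lemma mxgoodZ p q (A : 'rV[R]_d -> 'M[R]_(p, q)) F :
  good F -> mxgood A -> mxgood (fun x => F x *: A x).
Proof. by move=> gF gA i j; apply: eq_good (goodM gF (gA i j)) => x _; rewrite mxE. Qed.

Lemma mxgood_vec v : pwaff_vec v -> mxgood v.
Proof. by move=> pv i j; rewrite ord1; exact: good_pwaff. Qed.

Lemma mxgrad_comb v w u t x : pwaff_vec v -> pwaff_vec w ->
  (forall x, closure Om x -> u x = v x + t *: w x) -> U x ->
  mxgrad u x = mxgrad v x + t *: mxgrad w x.
Proof.
move=> pv pw uE Ux; apply/matrixP => i j.
have := @grad_comb _ _ (fun x => u x 0 i) t x (pv i) (pw i).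
move=> /(_ _ Ux)/rowP/(_ j); rewrite !mxE => -> // y cy.
by rewrite uE// !mxE.
Qed.

Lemma pwaff_vec_comb v w u t : pwaff_vec v -> pwaff_vec w ->
  (forall x, closure Om x -> u x = v x + t *: w x) -> pwaff_vec u.
Proof.
move=> pv pw uE i; apply: (pwaff_comb (t := t) (pv i) (pw i)) => x cx.
by rewrite uE// !mxE.
Qed.

Lemma Rint_ext F G : (forall x, U x -> F x = G x) ->
  \int[mu]_(x in Om) F x = \int[mu]_(x in Om) G x.
Proof.
by move=> FG; rewrite !Rintegral_Omega; apply: eq_Rintegral => x /set_mem; exact: FG.
Qed.

Lemma Rint_D F G : good F -> good G ->
  \int[mu]_(x in Om) (F x + G x) = \int[mu]_(x in Om) F x + \int[mu]_(x in Om) G x.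
Proof.
by move=> gF gG; rewrite !Rintegral_Omega RintegralD//; exact: good_integrable.
Qed.

Lemma Rint_Z c F : good F ->
  \int[mu]_(x in Om) (c * F x) = c * \int[mu]_(x in Om) F x.
Proof. by move=> gF; rewrite !Rintegral_Omega RintegralZl//; exact: good_integrable. Qed.

Lemma Rint_sum (I : finType) (Q : pred I) (f : I -> 'rV[R]_d -> R) :
  (forall i, Q i -> good (f i)) ->
  \int[mu]_(x in Om) (\sum_(i | Q i) f i x) = \sum_(i | Q i) \int[mu]_(x in Om) f i x.
Proof.
move=> gf; elim: (index_enum I) => [|i r IH].
  rewrite big_nil; under eq_Rintegral do rewrite big_nil.
  by have := Rint_Z 0 (good_cst 0); rewrite mul0r => ->; rewrite mul0r.
rewrite big_cons -IH; case: ifPn => Qi; last first.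
  by apply: eq_Rintegral => x _; rewrite big_cons (negPf Qi).
rewrite -Rint_D; [|exact: gf|].
  by apply: eq_Rintegral => x _; rewrite big_cons Qi.
elim: {IH} r => [|k r IH].
  by apply: eq_good (good_cst 0) => x _; rewrite big_nil.
have [Qk|Qk] := boolP (Q k).
  by apply: eq_good (goodD (gf _ Qk) IH) => x _; rewrite big_cons Qk.
by apply: eq_good IH => x _; rewrite big_cons (negPf Qk).
Qed.

Lemma Rint_N F : good F -> \int[mu]_(x in Om) (- F x) = - \int[mu]_(x in Om) F x.
Proof.
by move=> gF; rewrite -mulN1r -Rint_Z//; apply: Rint_ext => x _; rewrite mulN1r.
Qed.

Lemma Rint_B F G : good F -> good G ->
  \int[mu]_(x in Om) (F x - G x) = \int[mu]_(x in Om) F x - \int[mu]_(x in Om) G x.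
Proof. by move=> gF gG; rewrite Rint_D ?Rint_N//; exact: goodN. Qed.

Lemma Rint_le F G : good F -> good G -> (forall x, U x -> F x <= G x) ->
  \int[mu]_(x in Om) F x <= \int[mu]_(x in Om) G x.
Proof.
move=> gF gG FG; rewrite !Rintegral_Omega; apply: le_Rintegral => //.
all: exact: good_integrable.
Qed.

Lemma integral_good F : good F ->
  (\int[mu]_(x in Om) (F x)%:E = (\int[mu]_(x in Om) F x)%R%:E)%E.
Proof.
move=> gF; rewrite Rintegral_Omega integral_Omega /Rintegral fineK//.
by apply: integrable_fin_num => //; exact: good_integrable.
Qed.

End piecewise_functions.

(** * Tangent inequality and composition with the potential *)

Section convex_tangent.
Context {R : realType}.
Implicit Types (h : R -> R) (a b x y : R).

(** By convexity the right difference quotients of [h] at [x] in direction [y - x] never exceed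
    [h y - h x]; let the step tend to zero. *)
Lemma convex_tangent h a b x y :
  @convex_function R R^o [set` `]a, b[] h -> a < x < b -> a < y < b ->
  derivable h x 1 -> h x + derive1 h x * (y - x) <= h y.
Proof.
move=> ch ax ay dh; set v := y - x.
have dfh : differentiable h x by exact/derivable1_diffP.
have dE : 'D_v h x = derive1 h x * v.
  by rewrite deriveE// diff1E// /GRing.scale/= mulrC.
rewrite -dE addrC -lerBrDr.
have dv : derivable h x v by exact: diff_derivable.
have cv : (fun t : R => t^-1 *: ((h \o shift x) (t *: v) - h x)) @ 0^'+ --> 'D_v h x.
  exact: cvg_dnbhs_at_right dv.
apply: (cvgr_to_le cv); near=> t.
have t0 : 0 < t by near: t; exact: nbhs_right_gt.
have t1 : t < 1 by near: t; exact: nbhs_right_lt.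
have tb : (0 <= t <= 1)%R by rewrite !ltW.
rewrite /GRing.scale/= mulrC ler_pdivrMr//.
pose p : {i01 R} := Itv01 (ltW t0) (ltW t1).
have /(_ p y x) := ch; rewrite !inE/= !in_itv/= => /(_ ay ax).
rewrite !convRE/= => hh.
have -> : t * v + x = t * y + (1 - t) * x by rewrite /v; ring.
have : h (t * y + (1 - t) * x) <= t * h y + (1 - t) * h x by exact: hh.
lra.
Unshelve. all: by end_near. Qed.

End convex_tangent.

Section composition.
Context {R : realType} {d : nat}.
Variables (Om : set 'rV[R]_d) (M : mesh R d).
Hypothesis d_gt0 : (0 < d)%N.
Hypothesis meshM : simplicial_mesh Om M.

(** Values are convex combinations of the finitely many vertex values, so the range keeps away from
    the ends of the interval. Continuous compositions are then bounded even if the potential blows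
    up at an end. *)
Lemma pwaff_range (s : 'rV[R]_d -> R) (lo hi : R) : pwaff M s ->
  (forall x, closure Om x -> lo < s x < hi) ->
  exists m1 m2 : R, [/\ lo < m1, m1 <= m2, m2 < hi &
    forall x, closure Om x -> m1 <= s x <= m2] \/ closure Om = set0.
Proof.
move=> ps sr; have [c0|/set0P[x0 cx0]] := eqVneq (closure Om) set0.
  by exists 0, 0; right.
pose sv i := s (@vtx _ _ M i).
pose m1 := \big[Num.min/s x0]_i sv i; pose m2 := \big[Num.max/s x0]_i sv i.
exists m1, m2; left.
have sr' i : lo < sv i < hi by exact/sr/vtx_closure.
have /andP[s01 s02] := sr _ cx0.
have m12 x : closure Om x -> m1 <= s x <= m2.
  move=> /(closureP meshM)[K KM Kx]; have [a [b sE]] := ps K KM.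
  have [l [l0 lK l1 lx]] := Kx.
  have -> : s x = \sum_i l i * sv i.
    rewrite sE// -lx -[LHS]/(aff a b _) aff_comb//; apply: eq_bigr => i _.
    have [iK|iK] := boolP (i \in K); last by rewrite lK// !mul0r.
    by rewrite /sv sE//; exact: (cell_vtx meshM).
  rewrite -[m1]mul1r -[m2]mul1r -l1 !mulr_suml; apply/andP; split.
    by apply: ler_sum => i _; rewrite ler_wpM2l// bigmin_le.
  by apply: ler_sum => i _; rewrite ler_wpM2l// le_bigmax.
split => //.
- rewrite /m1; elim/big_ind : _ => // [u v|i _]; first by rewrite lt_min => -> ->.
  by have /andP[] := sr' i.
- by have /andP[h1 h2] := m12 _ cx0; exact: le_trans h1 h2.
- rewrite /m2; elim/big_ind : _ => // [u v|i _]; first by rewrite gt_max => -> ->.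
  by have /andP[] := sr' i.
Qed.

Lemma good_comp (h : R -> R) (s : 'rV[R]_d -> R) (lo hi : R) : pwaff M s ->
  (forall x, closure Om x -> lo < s x < hi) ->
  (forall t, lo < t < hi -> {for t, continuous h}) ->
  good Om M (fun x => h (s x)).
Proof.
move=> ps sr ch; have [m1 [m2 [[lm m12 mh sm]|c0]]] := pwaff_range ps sr; last first.
  have U0 : offskel Om M = set0 by rewrite /offskel c0 set0D.
  split; first by rewrite U0; exact: measurable_fun_set0.
  by exists 0 => x; rewrite U0.
have cw : {within `[m1, m2], continuous h}.
  apply: continuous_in_subspaceT => t /set_mem/=; rewrite in_itv/= => /andP[h1 h2].
  by apply: ch; rewrite (lt_le_trans lm h1) (le_lt_trans h2 mh).
split.
  apply: (@measurable_comp _ _ _ _ _ _ `[m1, m2]%classic).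
  - exact: measurable_itv.
  - by move=> _ [x [cx _] <-] /=; rewrite in_itv/=; exact: sm.
  - by apply: subspace_continuous_measurable_fun => //; exact: measurable_itv.
  - by have [] := good_pwaff meshM ps.
have [c1 _ hc1] := EVT_max m12 cw; have [c2 _ hc2] := EVT_min m12 cw.
exists (`|h c1| + `|h c2|) => x [cx _].
have sx : s x \in `[m1, m2] by rewrite in_itv/=; exact: sm.
have := hc1 _ sx; have := hc2 _ sx.
have := ler_norm (h c1); have := ler_norm (- h c2); rewrite normrN => a1 a2 a3 a4.
rewrite ler_norml; apply/andP; split; have := normr_ge0 (h c1); have := normr_ge0 (h c2); lra.
Qed.

End composition.

(** * Energy law *)

Section energy_dissipation.
Context {R : realType} {d : nat}.
Variables (Om : set 'rV[R]_d) (P : problem R d) (M : mesh R d).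
Hypothesis d_gt0 : (0 < d)%N.
Hypothesis meshM : simplicial_mesh Om M.
Hypothesis domOm : polytopal_lipschitz_domain Om.
Hypothesis admP : admissible Om P.

Notation mu := (@lebesgue_rV R d).
Notation U := (offskel Om M).
Notation good := (good Om M).
Notation mxgood := (mxgood Om M).
Notation pwaff := (pwaff M).
Notation pwaff_vec := (pwaff_vec M).

Section L2_mx_theory.
Variables (p q : nat).
Implicit Types (F G H : 'rV[R]_d -> 'M[R]_(p, q)).

Lemma L2_mxC F G : L2_mx Om F G = L2_mx Om G F.
Proof. by apply: eq_Rintegral => x _; exact: mxdotC. Qed.

Lemma L2_mx_ge0 F : 0 <= L2_mx Om F F.
Proof. by apply: Rintegral_ge0 => x _; exact: mxdot_ge0. Qed.

Lemma L2_mx_comb F G F' H t : mxgood F -> mxgood G -> mxgood H ->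
  (forall x, U x -> F' x = F x + t *: G x) ->
  L2_mx Om F' H = L2_mx Om F H + t * L2_mx Om G H.
Proof.
move=> gF gG gH F'E.
have gFH := good_mxdot gF gH; have gGH := good_mxdot gG gH.
rewrite /L2_mx -(Rint_Z d_gt0 meshM domOm)// -(Rint_D d_gt0 meshM domOm)//; last first.
  exact: goodZ.
by apply: (Rint_ext d_gt0 meshM domOm) => x Ux; rewrite F'E// mxdotDl mxdotZl.
Qed.

Lemma mxgood_comb F G F' t : mxgood F -> mxgood G ->
  (forall x, U x -> F' x = F x + t *: G x) -> mxgood F'.
Proof.
move=> gF gG F'E i j; apply: eq_good (goodD (gF i j) (goodZ t (gG i j))) => x Ux.
by rewrite F'E// !mxE.
Qed.

Lemma L2_mx_sqr_comb F G F' t : mxgood F -> mxgood G ->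
  (forall x, U x -> F' x = F x + t *: G x) ->
  L2_mx Om F' F' = L2_mx Om F F + 2 * t * L2_mx Om F G + t ^+ 2 * L2_mx Om G G.
Proof.
move=> gF gG F'E; have gF' := mxgood_comb gF gG F'E.
rewrite (L2_mx_comb gF gG gF' F'E) L2_mxC (L2_mx_comb gF gG gF F'E).
rewrite (L2_mxC G F') (L2_mx_comb gF gG gG F'E) (L2_mxC G F); ring.
Qed.

End L2_mx_theory.

Lemma energy1E s n : pwaff s -> pwaff_vec n -> energy1 Om P s n =
  2^-1 * (kappa P * L2_mx Om (fun x => tensor (n x) (grad s x))
                             (fun x => tensor (n x) (grad s x))
          + L2_mx Om (fun x => s x *: mxgrad n x) (fun x => s x *: mxgrad n x)).
Proof.
move=> ps pn; rewrite /energy1 /L2_mx; congr (_ * _).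
have gT := mxgood_tensor meshM pn ps.
have gG := mxgoodZ (good_pwaff meshM ps) (mxgood_mxgrad meshM pn).
rewrite -(Rint_Z d_gt0 meshM domOm); last exact: good_mxdot.
rewrite -(Rint_D d_gt0 meshM domOm); last exact: good_mxdot; last first.
  exact/goodZ/good_mxdot.
apply: eq_Rintegral => x _; rewrite !sqr_enorm mxdotZl mxdotZr; ring.
Qed.

Lemma kappa_gt0 : 0 < kappa P. Proof. exact: (adm_kappa admP). Qed.

(** Expanding the energy at [n + taun t] produces half of the quadratic terms in [t], while the
    tested equation supplies them in full with the opposite sign; the surplus half is dropped. *)
Lemma inner_step_energy (m : metric R) (taun : R) s n n' t : 0 < taun ->
  pwaff s -> pwaff_vec n -> pwaff_vec t ->
  tangent_step Om P M m taun s n t ->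
  (forall x, closure Om x -> n' x = n x + taun *: t x) ->
  energy1 Om P s n' + taun * star Om M m t t <= energy1 Om P s n.
Proof.
move=> t0 ps pn pt [Kt tE] n'E.
have pn' := pwaff_vec_comb meshM pn pt n'E.
rewrite !energy1E//; have := tE _ Kt.
set aF := fun x => tensor (n x) (grad s x); set aG := fun x => tensor (t x) (grad s x).
set bF := fun x => s x *: mxgrad n x; set bG := fun x => s x *: mxgrad t x.
have gaF : mxgood aF by exact: (mxgood_tensor meshM).
have gaG : mxgood aG by exact: (mxgood_tensor meshM).
have gs := good_pwaff meshM ps.
have gbF : mxgood bF by exact: (mxgoodZ gs (mxgood_mxgrad meshM pn)).
have gbG : mxgood bG by exact: (mxgoodZ gs (mxgood_mxgrad meshM pt)).
rewrite (@L2_mx_sqr_comb _ _ aF aG (fun x => tensor (n' x) (grad s x)) taun)//; last first.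
  move=> x Ux; apply/matrixP => i j; rewrite /aF /aG /tensor /= n'E; last by case: Ux.
  by rewrite !mxE !big_ord1 !mxE; ring.
rewrite (@L2_mx_sqr_comb _ _ bF bG (fun x => s x *: mxgrad n' x) taun)//; last first.
  move=> x Ux; rewrite /bF /bG (mxgrad_comb meshM pn pt n'E Ux).
  by rewrite scalerDr !scalerA mulrC.
have := L2_mx_ge0 aG; have := L2_mx_ge0 bG; have k0 := kappa_gt0.
move: (L2_mx Om aG aG) (L2_mx Om bG bG) (L2_mx Om aF aG) (L2_mx Om bF bG) => A B C D.
move: (L2_mx Om aF aF) (L2_mx Om bF bF) (star _ _ _ _ _) => E F S B0 A0 H.
have kA : 0 <= kappa P * A by rewrite mulr_ge0// ltW.
have tA : 0 <= taun * (taun * (kappa P * A)) by rewrite !mulr_ge0// ltW.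
have tB : 0 <= taun * (taun * B) by rewrite !mulr_ge0// ltW.
have H' : taun * S = taun * (- (kappa P * C) - D) - taun * (taun * (kappa P * A))
    - taun * (taun * B).
  have -> : S = - (kappa P * C) - D - taun * kappa P * A - taun * B by rewrite -H; ring.
  ring.
rewrite H'; lra.
Qed.

Let lo := split_lo P.
Let hi := split_hi P.
Notation range s := (forall x, closure Om x -> split_lo P < s x < split_hi P).

Lemma split_phys t : lo < t < hi -> s_low d < t < 1.
Proof.
have [h1 h2 _ _ _ _] := adm_split admP => /andP[ht1 ht2].
by rewrite (le_lt_trans h1 ht1) (lt_le_trans ht2 h2).
Qed.

Lemma psi_derivable t : lo < t < hi -> derivable (psi P) t 1.
Proof. by move=> /split_phys /(dw_C2 (adm_psi admP))[]. Qed.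

Lemma dpsi_derivable t : lo < t < hi -> derivable (derive1 (psi P)) t 1.
Proof. by move=> /split_phys /(dw_C2 (adm_psi admP))[]. Qed.

Lemma near_split t : lo < t < hi -> \near t, lo < t < hi.
Proof. by move=> ht; apply: near_in_itvoo; rewrite in_itv. Qed.

Lemma derivable_quadratic (a2 a1 a0 t : R) :
  is_derive t 1 (fun s => a2 * s ^+ 2 + a1 * s + a0) (2 * a2 * t + a1).
Proof.
apply: is_derive_eq; rewrite /GRing.scale/=; ring.
Qed.

Lemma psic_quadratic : exists a b, forall t,
  derivable (psic P) t 1 /\ derive1 (psic P) t = a * t + b.
Proof.
have [_ _ _ _ _ [a2 [a1 [a0 [_ cE]]]]] := adm_split admP.
have -> : psic P = fun s => a2 * s ^+ 2 + a1 * s + a0 by apply/funext.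
exists (2 * a2), a1 => t; have [h1 h2] := derivable_quadratic a2 a1 a0 t.
by rewrite derive1E.
Qed.

(** The splitting grants [psie] convexity only; differentiability comes from [psie = psic - psi] on
    the open interval of the splitting. *)
Lemma psie_derivable t : lo < t < hi -> derivable (psie P) t 1 /\
  derive1 (psie P) t = derive1 (psic P) t - derive1 (psi P) t.
Proof.
move=> ht; have [_ _ cE _ _ _] := adm_split admP.
have [a [b /(_ t)[dc _]]] := psic_quadratic.
have dp := psi_derivable ht.
have nE : \near t, (psic P - psi P) t = psie P t.
  apply: filterS (near_split ht) => u hu.
  by rewrite !fctE (cE _ hu) opprB addrC subrK.
split; first by apply: near_eq_derivable nE _; exact: derivableB.
by rewrite !derive1E -(near_eq_derive _ nE) deriveB.
Qed.

Lemma good_psi s : pwaff s -> range s -> good (fun x => psi P (s x)).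
Proof.
move=> ps rs; apply: (good_comp meshM ps rs) => t /psi_derivable.
by move=> /derivable1_diffP; exact: differentiable_continuous.
Qed.

Lemma good_dpsic s : pwaff s -> good (fun x => derive1 (psic P) (s x)).
Proof.
have [a [b h]] := psic_quadratic => ps.
apply: eq_good (goodD (goodZ a (good_pwaff meshM ps)) (good_cst Om M b)) => x _.
by have [_ ->] := h (s x).
Qed.

Lemma good_dpsie s : pwaff s -> range s -> good (fun x => derive1 (psie P) (s x)).
Proof.
move=> ps rs; have gp : good (fun x => derive1 (psi P) (s x)).
  apply: (good_comp meshM ps rs) => t /dpsi_derivable.
  by move=> /derivable1_diffP; exact: differentiable_continuous.
apply: eq_good (goodB (good_dpsic ps) gp) => x [cx _].
by have [_ ->] := psie_derivable (rs _ cx).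
Qed.

Lemma energy2_ge0 s : range s -> 0 <= energy2 Om P s.
Proof.
move=> rs; apply: Rintegral_ge0 => x Ox; apply: (dw_ge0 (adm_psi admP)).
by apply/split_phys/rs; exact: subset_closure.
Qed.

Lemma energy1_ge0 s n : 0 <= energy1 Om P s n.
Proof.
rewrite /energy1 mulr_ge0 ?invr_ge0//; apply: Rintegral_ge0 => x _.
by rewrite addr_ge0// mulr_ge0 ?sqr_ge0// ltW// kappa_gt0.
Qed.

Lemma energy_ge0 s n : range s -> 0 <= energy Om P s n.
Proof. by move=> rs; rewrite addr_ge0 ?energy1_ge0 ?energy2_ge0. Qed.

(** Tangent inequalities for [psic] at the new value and for [psie] at the old one, the points where
    the implicit-explicit scheme evaluates the two derivatives. *)
Lemma psi_splitting_le u v : lo < u < hi -> lo < v < hi ->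
  psi P v - psi P u <= (derive1 (psic P) v - derive1 (psie P) u) * (v - u).
Proof.
move=> hu hv; have [_ _ cE cc ce _] := adm_split admP.
have [a [b h]] := psic_quadratic.
rewrite (cE _ hu) (cE _ hv).
have := convex_tangent cc hv hu (h v).1.
have := convex_tangent ce hu hv (psie_derivable hu).1; lra.
Qed.

Lemma energy2_le s s' : pwaff s -> pwaff s' -> range s -> range s' ->
  energy2 Om P s' - energy2 Om P s <=
  L2_scal Om (fun x => derive1 (psic P) (s' x)) (fun x => s' x - s x)
  - L2_scal Om (fun x => derive1 (psie P) (s x)) (fun x => s' x - s x).
Proof.
move=> ps ps' rs rs'; rewrite /energy2 /L2_scal.
have gs : good (fun x => s' x - s x) by apply: goodB; exact: (good_pwaff meshM).
have gc := goodM (good_dpsic ps') gs; have ge := goodM (good_dpsie ps rs) gs.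
rewrite -!(Rint_B d_gt0 meshM domOm)//; [|exact: good_psi..].
apply: (Rint_le d_gt0 meshM domOm).
- by apply: goodB; exact: good_psi.
- exact: goodB.
move=> x [cx _]; rewrite -mulrBl.
by apply: psi_splitting_le; [exact: rs|exact: rs'].
Qed.

Lemma scalar_step_energy taus s n s' : 0 < taus ->
  pwaff s -> range s -> range s' -> pwaff_vec n -> Vh Om M s ->
  (forall i, GammaD P (@vtx _ _ M i) ->
     s (@vtx _ _ M i) = nodal_interp M (gdat P) (@vtx _ _ M i)) ->
  scalar_step Om P M taus s n s' ->
  energy Om P s' n <= energy Om P s n.
Proof.
move=> t0 ps rs rs' pn Vs ds [Vs' ds' stepE].
have ps' : pwaff s' by case: Vs'.
pose w x := s' x - s x.
have pw : pwaff w.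
  by apply: (@pwaff_comb _ _ _ _ meshM s' s _ (-1)) => // x _; rewrite mulN1r.
have Vw : VhD Om (GammaD P) M w.
  split; first split => //.
    have [cs' _] := Vs'; have [cs _] := Vs.
    by move=> x; apply: continuousB; [exact: cs'|exact: cs].
  by move=> i Gi; rewrite /w ds'// ds// subrr.
(* Expanding about the new value [s'] gives the squares of the increment the favourable sign. *)
have sE x : closure Om x -> s x = s' x + (-1) * w x by rewrite /w => _; ring.
have := stepE _ Vw; have := energy2_le ps ps' rs rs'.
rewrite /energy !energy1E// -/w.
set aF := fun x => tensor (n x) (grad s' x); set aG := fun x => tensor (n x) (grad w x).
set bF := fun x => s' x *: mxgrad n x; set bG := fun x => w x *: mxgrad n x.
have gaF : mxgood aF by exact: (mxgood_tensor meshM).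
have gaG : mxgood aG by exact: (mxgood_tensor meshM).
have gbF : mxgood bF by exact: (mxgoodZ (good_pwaff meshM ps') (mxgood_mxgrad meshM pn)).
have gbG : mxgood bG by exact: (mxgoodZ (good_pwaff meshM pw) (mxgood_mxgrad meshM pn)).
rewrite (@L2_mx_sqr_comb _ _ aF aG (fun x => tensor (n x) (grad s x)) (-1))//; last first.
  move=> x Ux; rewrite /aF /aG /tensor (grad_comb meshM ps' pw sE Ux).
  by rewrite mulmxDr -scalemxAr.
rewrite (@L2_mx_sqr_comb _ _ bF bG (fun x => s x *: mxgrad n x) (-1))//; last first.
  move=> x Ux; rewrite /bF /bG scalerA -scalerDl -sE//.
  by case: Ux.
have := L2_mx_ge0 aG; have := L2_mx_ge0 bG; have k0 := kappa_gt0.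
have : 0 <= L2_scal Om (fun x => (s' x - s x) / taus) w.
  apply: Rintegral_ge0 => x _; rewrite /w mulrAC -expr2 divr_ge0 ?sqr_ge0//.
  exact: ltW.
move: (L2_scal _ _ w) => S S0.
move: (L2_mx Om aG aG) (L2_mx Om bG bG) (L2_mx Om aF aG) (L2_mx Om bF bG) => A B C D.
move: (L2_mx Om aF aF) (L2_mx Om bF bF) => E F B0 A0.
have kA : 0 <= kappa P * A by rewrite mulr_ge0// ltW.
lra.
Qed.

End energy_dissipation.

(** * Pythagoras and the telescoped energy law for the iterates *)

Section algorithm_invariant.
Context {R : realType} {d : nat}.
Variables (Om : set 'rV[R]_d) (P : problem R d) (M : mesh R d).
Variables (m : metric R) (taun taus tol sigma : R).
Variables (s : nat -> 'rV[R]_d -> R) (n : nat -> 'rV[R]_d -> 'rV[R]_d).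
Hypothesis d_gt0 : (0 < d)%N.
Hypothesis run : algorithm_run Om P M m taun taus tol sigma s n.

Notation vert := 'I_(nvtx M).
Notation field := ('rV[R]_d -> 'rV[R]_d).
Notation sq v := (mxdot v v).

Let meshM : simplicial_mesh Om M. Proof. exact: run_mesh run. Qed.
Let domOm : polytopal_lipschitz_domain Om. Proof. exact: run_domain run. Qed.
Let admP : admissible Om P. Proof. exact: run_data run. Qed.
Let taun_gt0 : 0 < taun. Proof. exact: run_taun run. Qed.
Let taus_gt0 : 0 < taus. Proof. exact: run_taus run. Qed.

Lemma VhD_vec_pwaff (t : field) : VhD_vec Om (GammaD P) M t -> pwaff_vec M t.
Proof. by move=> Vt k; have [[]] := Vt k. Qed.

(** The inner loop prescribes fields on the closure of [Om] only. The energy does not see other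
    values, since off the skeleton a point of the closure is interior to a cell and the gradient is
    determined there. *)
Lemma energy1_eq (u : 'rV[R]_d -> R) (v v' : field) : pwaff M u -> pwaff_vec M v ->
  (forall x, closure Om x -> v' x = v x) -> energy1 Om P u v' = energy1 Om P u v.
Proof.
move=> pu pv v'E; pose e (w : field) x := kappa P * enorm (tensor (w x) (grad u x)) ^+ 2
   + u x ^+ 2 * enorm (mxgrad w x) ^+ 2.
suff E : \int[lebesgue_rV d]_(x in Om) e v' x = \int[lebesgue_rV d]_(x in Om) e v x.
  by rewrite /energy1 -/(e v') -/(e v) E.
rewrite /e; apply: (Rint_ext d_gt0 meshM domOm) => x Ux.
have E1 : v' x = v x by apply: v'E; case: Ux.
have v'E0 y : closure Om y -> v' y = v y + 0 *: v y.
  by move=> cy; rewrite scale0r addr0 v'E.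
have E2 : mxgrad v' x = mxgrad v x.
  by rewrite (mxgrad_comb meshM pv pv v'E0 Ux) scale0r addr0.
by rewrite E1 E2.
Qed.

(** Keeping the list [ts] of updates lets the vertex identity and the energy law refer to the same
    fields; any comparison of nodal values with the metric can then be summed over it. *)
Lemma inner_loop_invariant (u : 'rV[R]_d -> R) (v v' : field) :
  pwaff M u -> pwaff_vec M v -> inner_loop Om P M m taun tol u v v' ->
  exists ts : seq field,
    [/\ {in ts, forall t, VhD_vec Om (GammaD P) M t}, pwaff_vec M v',
        forall i, sq (v' (@vtx _ _ M i)) =
          sq (v (@vtx _ _ M i)) + taun ^+ 2 * \sum_(t <- ts) sq (t (@vtx _ _ M i)) &
        energy1 Om P u v' + taun * \sum_(t <- ts) star Om M m t t
        <= energy1 Om P u v].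
Proof.
move=> pu pv [nl [tl [ell [n0 stepE _ _ v'E]]]].
suff H l : (l <= ell.+1)%N -> exists ts : seq field,
    [/\ {in ts, forall t, VhD_vec Om (GammaD P) M t}, pwaff_vec M (nl l),
        forall i, sq (nl l (@vtx _ _ M i)) =
          sq (v (@vtx _ _ M i)) + taun ^+ 2 * \sum_(t <- ts) sq (t (@vtx _ _ M i)) &
        energy1 Om P u (nl l) + taun * \sum_(t <- ts) star Om M m t t
        <= energy1 Om P u v].
  have [ts [h1 h2 h3 h4]] := H _ (leqnn _); exists ts.
  have v'E' x : closure Om x -> v' x = nl ell.+1 x by move=> cx; rewrite v'E ?mem_set.
  split.
  - exact: h1.
  - move=> k; apply: (pwaff_eq meshM (h2 k)) => x cx; by rewrite v'E'.
  - by move=> i; rewrite v'E'//; exact: (vtx_closure meshM).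
  - by rewrite (energy1_eq pu h2 v'E').
elim: l => [_|l IH ll].
  have n0' x : closure Om x -> nl 0%N x = v x by move=> cx; rewrite n0 ?mem_set.
  exists [::]; split.
  - by [].
  - by move=> k; apply: (pwaff_eq meshM (pv k)) => x cx; rewrite n0'.
  - by move=> i; rewrite big_nil mulr0 addr0 n0'//; exact: (vtx_closure meshM).
  - by rewrite big_nil mulr0 addr0 (energy1_eq pu pv n0').
have [ts [h1 h2 h3 h4]] := IH (ltnW ll).
have [tstep nE] := stepE l ll.
have nE' x : closure Om x -> nl l.+1 x = nl l x + taun *: tl l x.
  by move=> cx; rewrite nE ?mem_set.
have [Vt ort] := tstep.1; have pt := VhD_vec_pwaff Vt.
exists (tl l :: ts); split.
- by move=> t; rewrite inE => /orP[/eqP->//|/h1].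
- exact: (pwaff_vec_comb meshM h2 pt nE').
- move=> i; rewrite nE'; last exact: (vtx_closure meshM).
  rewrite big_cons mxdotDl !mxdotDr h3 !(mxdotZl, mxdotZr).
  by rewrite (mxdotC (tl l _) (nl l _)) ort; ring.
- rewrite big_cons mulrDr addrA; apply: le_trans h4; rewrite lerD2r.
  exact: (inner_step_energy d_gt0 meshM domOm admP taun_gt0 pu h2 pt tstep nE').
Qed.

(** The boundary values of [s j] are carried along because the next scalar increment must vanish at
    the Dirichlet vertices to be a test function. *)
Lemma algorithm_invariant j :
  exists ts : seq field,
    [/\ {in ts, forall t, VhD_vec Om (GammaD P) M t}, pwaff_vec M (n j),
        forall i, sq (n j (@vtx _ _ M i)) =
          1 + taun ^+ 2 * \sum_(t <- ts) sq (t (@vtx _ _ M i)),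
        Vh Om M (s j) /\ dirichlet_s P M (s j) &
        energy Om P (s j) (n j) + taun * \sum_(t <- ts) star Om M m t t
        <= energy Om P (s 0%N) (n 0%N)].
Proof.
have alg := run_iterates run.
elim: j => [|j [ts [h1 h2 h3 [h4 h5] h6]]].
  exists [::]; split.
  - by [].
  - by move=> k; have [] := alg_n0 alg k.
  - by move=> i; rewrite big_nil mulr0 addr0 -sqr_enorm (alg_n0_unit alg) expr1n.
  - by split; [exact: alg_s0 alg|exact: alg_s0_bc alg].
  - by rewrite big_nil mulr0 addr0.
have ps : pwaff M (s j) by case: h4.
have [ts' [k1 k2 k3 k4]] := inner_loop_invariant ps h2 (alg_inner alg j).
have sc := alg_scalar alg j; have [Vs' ds' _] := sc.
exists (ts' ++ ts); split.
- by move=> t; rewrite mem_cat => /orP[/k1|/h1].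
- exact: k2.
- by move=> i; rewrite k3 h3 big_cat/=; ring.
- by split.
- have := scalar_step_energy d_gt0 meshM domOm admP taus_gt0 ps (alg_range alg j)
    (alg_range alg j.+1) k2 h4 h5 sc.
  rewrite big_cat/= mulrDr addrA => H; apply: le_trans h6; rewrite lerD2r.
  apply: le_trans (lerD H (lexx _)) _.
  by rewrite /energy addrAC lerD2r.
Qed.

(* The energy law controls the sum of the squared metric norms of all tangential
   updates, so a bound of [F] by the metric norm sums up to a bound by the
   initial energy. *)
Lemma sum_updates_le j : exists ts : seq field,
    [/\ {in ts, forall t, VhD_vec Om (GammaD P) M t}, pwaff_vec M (n j),
        forall i, sq (n j (@vtx _ _ M i)) =
          1 + taun ^+ 2 * \sum_(t <- ts) sq (t (@vtx _ _ M i)) &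
        forall (F : field -> R) C, 0 <= C ->
        (forall t, VhD_vec Om (GammaD P) M t -> F t <= C * star Om M m t t) ->
        taun ^+ 2 * \sum_(t <- ts) F t
        <= C * taun * energy Om P (s 0%N) (n 0%N)].
Proof.
have [ts [h1 h2 h3 _ h5]] := algorithm_invariant j; exists ts; split => // F C C0 FC.
have alg := run_iterates run.
have e0 := energy_ge0 admP (n j) (alg_range alg j).
apply: (@le_trans _ _ (taun ^+ 2 * \sum_(t <- ts) C * star Om M m t t)).
  rewrite ler_wpM2l ?sqr_ge0// big_seq [leRHS]big_seq; apply: ler_sum => t /h1.
  exact: FC.
rewrite -mulr_sumr; move: h5; set S := \sum_(t <- ts) star _ _ _ _ _ => h5.
rewrite (_ : taun ^+ 2 * (C * S) = C * taun * (taun * S)); last by ring.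
rewrite ler_wpM2l ?mulr_ge0 ?(ltW taun_gt0)//.
by apply: le_trans h5; rewrite lerDr.
Qed.

Lemma initial_energy_ge0 : 0 <= energy Om P (s 0%N) (n 0%N).
Proof. exact: energy_ge0 (alg_range (run_iterates run) 0%N). Qed.

End algorithm_invariant.

(** * Local estimates on shape-regular simplices *)

Section local_estimates.
Context {R : realType} {d : nat}.
Variables (Om : set 'rV[R]_d) (M : mesh R d) (sigma : R).
Hypothesis d_gt0 : (0 < d)%N.
Hypothesis meshM : simplicial_mesh Om M.
Hypothesis domOm : polytopal_lipschitz_domain Om.
Hypothesis sigma_gt0 : 0 < sigma.
Hypothesis shapeM : shape_regular sigma M.

Notation vert := 'I_(nvtx M).
Notation mu := (@lebesgue_rV R d).
Notation U := (offskel Om M).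
Notation good := (good Om M).

Lemma d_gt0R : 0 < d%:R :> R. Proof. by rewrite ltr0n. Qed.

Lemma cell_diam (K : {set vert}) x y : cell K x -> cell K y ->
  enorm (x - y) <= diam (cell K).
Proof.
move=> Kx Ky; apply: sup_upper_bound; last by exists (x, y).
split; first by exists (enorm (x - y)), (x, y).
exists (d%:R * (2 * mesh_bound M)) => _ [[u v] [/= Ku Kv] <-].
apply: enorm_le_coord => [|i]; first by rewrite mulr_ge0// mesh_bound_ge0.
rewrite !mxE (le_trans (ler_normB _ _))// mulr2n mulrDl mul1r.
by rewrite lerD// (cell_bounded _ Ku, cell_bounded _ Kv).
Qed.

Lemma diam_gt0 K : K \in cells M -> 0 < diam (cell K).
Proof.
move=> KM; have [cK _] := mesh_simplex meshM KM.
have /card_gt0P[i iK] : (0 < #|K|)%N by rewrite cK.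
have /card_gt0P[j] : (0 < #|K :\ i|)%N.
  by have := cardsD1 i K; rewrite iK cK add1n => -[<-].
rewrite !inE => /andP[ji jK].
apply: lt_le_trans (cell_diam (cell_vtx meshM KM iK) (cell_vtx meshM KM jK)).
rewrite lt_neqAle enorm_ge0 andbT eq_sym; apply: contra ji => /eqP e0.
have := sqr_enorm (vtx i - vtx j); rewrite e0 expr2 mul0r => /esym/mxdot_eq0/eqP.
by rewrite subr_eq0 => /eqP/(mesh_vtx_inj meshM)->.
Qed.

Lemma hmin_le K : K \in cells M -> hmin M <= diam (cell K).
Proof. by move=> KM; exact: bigmin_le_cond. Qed.

Lemma hmin_le_hmax : hmin M <= hmax M.
Proof. exact: bigmin_le_id. Qed.

Lemma cells_neq0 : exists K, K \in cells M.
Proof.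
have [x Ox] := dom_nonempty domOm.
by have /(closureP meshM)[K KM _] : closure Om x by [apply: subset_closure]; exists K.
Qed.

Lemma hmin_gt0 : 0 < hmin M.
Proof.
have h K : K \in cells M -> 0 < diam (cell K) by exact: diam_gt0.
rewrite /hmin; elim/big_ind : _ => // [|u v u0 v0]; last by rewrite lt_min u0 v0.
have [K KM] := cells_neq0; apply: lt_le_trans (h _ KM) _.
exact: le_bigmax_cond.
Qed.

(** Shape regularity gives inradius at least [diam / (2 sigma)]. Half of it is surely attained by
    some ball, and a ball of radius [d * a] contains the cube of half side [a]; this yields
    [4 * sigma * d]. *)
Definition core_radius (K : {set vert}) : R := diam (cell K) / (4 * sigma * d%:R).

Lemma core_radius_gt0 K : K \in cells M -> 0 < core_radius K.
Proof. by move=> KM; rewrite divr_gt0 ?diam_gt0// !mulr_gt0// d_gt0R. Qed.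

Lemma inner_cube K : K \in cells M -> exists x0 : 'rV[R]_d,
  forall y : 'rV[R]_d, (forall i, `|y 0 i - x0 0 i| <= core_radius K) -> cell K y.
Proof.
move=> KM; have D0 := diam_gt0 KM; have := shapeM KM.
rewrite /inradius; set E := [set r | _] => Dle.
have E0 : 0 < sup E.
  rewrite ltNge; apply/negP => E0; move: (lt_le_trans D0 Dle); apply/negP.
  by rewrite -leNgt mulr_ge0_le0// ?(ltW sigma_gt0)// mulr_ge0_le0.
(* [sup] takes the value 0 on a set without supremum, so positivity also shows that [E] is nonempty
   and bounded. *)
have hE : has_sup E by apply: contrapT => /sup_out sE; move: E0; rewrite sE ltxx.
have E2 : 0 < sup E / 2 by rewrite divr_gt0.
have [r [r0 [x0 x0P]] rE] := sup_adherent E2 hE.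
exists x0 => y yx; apply: x0P.
apply: (@le_trans _ _ (d%:R * core_radius K)).
  by apply: enorm_le_coord => [|i]; [exact/ltW/core_radius_gt0|rewrite !mxE].
have -> : d%:R * core_radius K = diam (cell K) / (4 * sigma).
  by rewrite /core_radius; field; rewrite !gt_eqF// d_gt0R.
rewrite ler_pdivrMr ?mulr_gt0//; apply: le_trans Dle _.
have rE' : sup E <= 2 * r by lra.
have : sigma * sup E <= sigma * (2 * r) by rewrite ler_pM2l.
lra.
Qed.

Lemma good_indic (A : set 'rV[R]_d) : measurable A -> good (\1_A).
Proof.
move=> mA; split; first exact: measurable_indic.
by exists 1 => x _; rewrite indicE; case: (_ \in _); rewrite ?normr1 ?normr0.
Qed.

Lemma measure_fin (A : set 'rV[R]_d) : measurable A -> A `<=` closure Om ->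
  mu A \is a fin_num.
Proof.
move=> mA AO; rewrite ge0_fin_numE//; apply: le_lt_trans (closure_finite meshM).
by apply: le_measure; rewrite ?inE//; exact: (measurable_closure meshM).
Qed.

Lemma Rint_indic (A : set 'rV[R]_d) : measurable A -> A `<=` closure Om ->
  \int[mu]_(x in Om) \1_A x = fine (mu A).
Proof.
move=> mA AO; rewrite (Rintegral_Omega d_gt0 meshM domOm).
have <- : (\int[mu]_(x in closure Om) (\1_A x)%:E = mu A)%E.
  by rewrite integral_indic ?setIidl//; exact: (measurable_closure meshM).
by rewrite [in RHS](integral_setD_null _ _ (measurable_skel M) (skel_null d_gt0 meshM)).
Qed.

Lemma measurable_cellM K : K \in cells M -> measurable (cell K).
Proof. exact: (measurable_cell meshM). Qed.

Lemma cell_closure K : K \in cells M -> cell K `<=` closure Om.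
Proof. by move=> KM x Kx; apply/(closureP meshM); exists K. Qed.

Lemma measure_cell_le K : K \in cells M ->
  fine (mu (cell K)) <= (2 * diam (cell K)) ^+ d.
Proof.
move=> KM; have D0 := diam_gt0 KM.
have [cK _] := mesh_simplex meshM KM.
have /card_gt0P[i iK] : (0 < #|K|)%N by rewrite cK.
rewrite -lee_fin fineK; last first.
  by apply: measure_fin; [exact: measurable_cellM KM|exact: cell_closure].
rewrite -(lebesgue_cube (vtx i - const_mx (diam (cell K)))) ?mulr_gt0//.
apply: le_measure; rewrite ?inE.
- exact: measurable_cellM KM.
- exact: measurable_cube.
move=> x Kx j; have := cell_diam Kx (cell_vtx meshM KM iK).
move=> /(le_trans (entry_le_enorm _ 0 j)); rewrite !mxE ler_norml => /andP[]; lra.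
Qed.

Lemma measure_cell_ge K : K \in cells M ->
  core_radius K ^+ d <= fine (mu (cell K)).
Proof.
move=> KM; have [x0 x0P] := inner_cube KM; have a0 := core_radius_gt0 KM.
rewrite -lee_fin fineK; last first.
  by apply: measure_fin; [exact: measurable_cellM KM|exact: cell_closure].
rewrite -(lebesgue_cube x0)//; apply: le_measure; rewrite ?inE.
- exact: measurable_cube.
- exact: measurable_cellM KM.
move=> x Kx; apply: x0P => i; have /andP[] := Kx i; rewrite ler_norml; lra.
Qed.

(* In the inner cube, the orthant chosen by the signs of the coefficients is a
   region where |v| dominates its value at the centre plus the oscillation. *)
Lemma affine_lower_bound K (A : 'rV[R]_d) b : K \in cells M ->
  exists T, exists c : 'rV[R]_d,
    [/\ 0 <= T, cube c (core_radius K / 2) `<=` cell K,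
        forall y, cube c (core_radius K / 2) y -> T <= `|aff A b y| &
        forall z, cell K z -> `|aff A b z| <= (1 + 8 * sigma * d%:R) * T].
Proof.
move=> KM; have [x0 x0P] := inner_cube KM; have a0 := core_radius_gt0 KM.
set a := core_radius K in x0P a0 *.
pose v0 := aff A b x0.
pose sg : R := if 0 <= v0 then 1 else -1.
have sg1 : `|sg| = 1 by rewrite /sg; case: ifP; rewrite ?normrN normr1.
have sgv : sg * v0 = `|v0|.
  rewrite /sg; case: ifPn => [h|]; first by rewrite mul1r ger0_norm.
  by rewrite -ltNge => h; rewrite ltr0_norm// mulN1r.
pose eps i := 0 <= sg * A 0 i.
pose c : 'rV[R]_d := \row_i (x0 0 i + if eps i then a / 2 else - a).
pose S := \sum_i `|A 0 i|.
have S0 : 0 <= S by apply: sumr_ge0.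
have affE y : aff A b y = v0 + \sum_i A 0 i * (y 0 i - x0 0 i).
  rewrite /v0 /aff !mxdot_rV addrAC -big_split/=; congr (_ + _).
  by apply: eq_bigr => i _; ring.
have cubeE y i : cube c (a / 2) y -> if eps i then a / 2 <= y 0 i - x0 0 i <= a
    else - a <= y 0 i - x0 0 i <= - (a / 2).
  by move=> /(_ i); rewrite mxE; case: ifP => _ /andP[h1 h2]; apply/andP; split; lra.
exists (`|v0| + a / 2 * S), c; split.
- by rewrite addr_ge0// mulr_ge0// divr_ge0// ltW.
- move=> y cy; apply: x0P => i; have := cubeE y i cy; rewrite ler_norml.
  by case: ifP => _ /andP[h1 h2]; apply/andP; split; lra.
- move=> y cy; rewrite (_ : `|aff A b y| = `|sg * aff A b y|); last by rewrite normrM sg1 mul1r.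
  apply: le_trans (ler_norm _).
  rewrite affE mulrDr sgv lerD2l /S !mulr_sumr; apply: ler_sum => i _.
  have nA : `|A 0 i| = `|sg * A 0 i| by rewrite normrM sg1 mul1r.
  rewrite mulrA nA.
  have := cubeE y i cy; case: ifPn => [h|]; last rewrite -ltNge => h.
    by rewrite (ger0_norm h) => /andP[h1 _]; rewrite (mulrC (a / 2)) ler_wpM2l.
  rewrite (ltr0_norm h) => /andP[_ h1]; rewrite (mulrC (a / 2)).
  have : (- (sg * A 0 i)) * (a / 2) <= (- (sg * A 0 i)) * (- (y 0 i - x0 0 i)).
    by rewrite ler_wpM2l ?oppr_ge0 ?(ltW h)//; lra.
  by rewrite mulrNN.
move=> z Kz; rewrite affE; apply: le_trans (ler_normD _ _) _.
have x0K : cell K x0 by apply: x0P => i; rewrite subrr normr0 ltW.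
have h1 : `|\sum_i A 0 i * (z 0 i - x0 0 i)| <= diam (cell K) * S.
  apply: le_trans (ler_norm_sum _ _ _) _; rewrite mulr_sumr; apply: ler_sum => i _.
  rewrite normrM mulrC ler_wpM2r//.
  by have := le_trans (entry_le_enorm _ 0 i) (cell_diam Kz x0K); rewrite !mxE.
have Da : diam (cell K) = 4 * sigma * d%:R * a.
  by rewrite /a /core_radius; field; rewrite !gt_eqF// d_gt0R.
have sd0 : 0 < sigma * d%:R by rewrite mulr_gt0// d_gt0R.
have aS : 0 <= a * S by rewrite mulr_ge0// ltW.
have vv : 0 <= `|v0| by [].
have k1 : 0 <= sigma * d%:R * `|v0| by rewrite mulr_ge0// ltW.
have k2 : 0 <= sigma * d%:R * (a * S) by rewrite mulr_ge0// ltW.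
rewrite Da in h1; rewrite -lerBrDl; apply: le_trans h1 _; nra.
Qed.

(** The diameter is [8 * sigma * d] times the side of the subcube in [affine_lower_bound], which
    gives the first factor; the second is the squared ratio between the maximum over the cell and
    the lower bound on the subcube. *)
Definition local_cst : R :=
  (8 * sigma * d%:R) ^+ d * (1 + 8 * sigma * d%:R) ^+ 2.

Lemma local_cst_gt0 : 0 < local_cst.
Proof.
have h : 0 < 8 * sigma * d%:R by rewrite !mulr_gt0// d_gt0R.
by rewrite mulr_gt0// exprn_gt0// addr_gt0.
Qed.

Lemma local_sup (v : 'rV[R]_d -> R) K z : pwaff M v -> K \in cells M -> cell K z ->
  diam (cell K) ^+ d * v z ^+ 2 <=
  local_cst * \int[mu]_(x in Om) (\1_(cell K) x * v x ^+ 2).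
Proof.
move=> pv KM Kz; have [A [b vE]] := pv K KM.
have [T [c [T0 cK cT zT]]] := affine_lower_bound A b KM.
have a0 := core_radius_gt0 KM; set a := core_radius K in cK cT a0.
have a20 : 0 < a / 2 by rewrite divr_gt0.
have mc : measurable (cube c (a / 2)) by exact: measurable_cube.
have low : T ^+ 2 * (a / 2) ^+ d <= \int[mu]_(x in Om) (\1_(cell K) x * v x ^+ 2).
  have -> : (a / 2) ^+ d = \int[mu]_(x in Om) \1_(cube c (a / 2)) x.
    rewrite Rint_indic ?lebesgue_cube//.
    by apply: subset_trans cK _; exact: cell_closure.
  rewrite -(Rint_Z d_gt0 meshM domOm); last exact: good_indic.
  apply: (Rint_le d_gt0 meshM domOm).
  - exact/goodZ/good_indic.
  - apply: goodM; first exact: (good_indic (measurable_cellM KM)).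
    exact/goodX/(good_pwaff meshM).
  - move=> x Ux; rewrite [in leLHS]indicE; have [/set_mem cx|_] := boolP (x \in _).
      rewrite mulr1 indicE mem_set ?mul1r; last exact: cK.
      rewrite vE; last exact: cK.
      rewrite -[leRHS]real_normK ?num_real// lerXn2r ?nnegrE//.
      exact: cT.
    by rewrite mulr0 mulr_ge0// ?sqr_ge0// indicE.
pose k := 8 * sigma * d%:R.
have k0 : 0 < k by rewrite !mulr_gt0// d_gt0R.
have h1 : v z ^+ 2 <= (1 + k) ^+ 2 * T ^+ 2.
  rewrite -exprMn -[leLHS]real_normK ?num_real// lerXn2r ?nnegrE//.
    by rewrite mulr_ge0// addr_ge0// ltW.
  by rewrite vE//; exact: zT.
have -> : diam (cell K) = k * (a / 2).
  by rewrite /a /k /core_radius; field; rewrite !gt_eqF// d_gt0R.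
rewrite /local_cst -/k exprMn -!(mulrA (k ^+ d)) ler_wpM2l ?exprn_ge0 ?(ltW k0)//.
apply: (@le_trans _ _ ((1 + k) ^+ 2 * (T ^+ 2 * (a / 2) ^+ d))); last first.
  by rewrite ler_wpM2l// sqr_ge0.
by rewrite [leRHS]mulrA (mulrC _ (v z ^+ 2)) ler_wpM2r// exprn_ge0// ltW.
Qed.

Lemma Rint_cells F : good F ->
  \sum_(K in cells M) \int[mu]_(x in Om) (\1_(cell K) x * F x) = \int[mu]_(x in Om) F x.
Proof.
move=> gF.
have gK K : K \in cells M -> good (fun x => \1_(cell K) x * F x).
  by move=> KM; apply: goodM => //; exact: (good_indic (measurable_cellM KM)).
transitivity (\int[mu]_(x in Om) (\sum_(K in cells M) \1_(cell K) x * F x)).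
  by rewrite (Rint_sum d_gt0 meshM domOm).
apply: (Rint_ext d_gt0 meshM domOm) => x Ux.
have [K KM Kx] := offskel_cell meshM Ux.
rewrite (bigD1 K)//= indicE mem_set// mul1r big1 ?addr0// => L /andP[LM LK].
rewrite indicE memNset ?mul0r// => Lx; move/eqP: LK; apply.
by case: Ux => _ sx; exact: (cell_unique meshM LM KM Lx Kx).
Qed.

Lemma Rint_cell_le F K : good F -> (forall x, U x -> 0 <= F x) -> K \in cells M ->
  \int[mu]_(x in Om) (\1_(cell K) x * F x) <= \int[mu]_(x in Om) F x.
Proof.
move=> gF F0 KM; apply: (Rint_le d_gt0 meshM domOm) => //.
  by apply: goodM => //; exact: (good_indic (measurable_cellM KM)).
move=> x Ux; rewrite indicE; case: (_ \in _); rewrite ?mul1r// mul0r; exact: F0.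
Qed.

End local_estimates.

(** * From nodal values to norms of the director *)

Section norm_bounds.
Context {R : realType} {d : nat}.
Variables (Om : set 'rV[R]_d) (P : problem R d) (M : mesh R d).
Variables (m : metric R) (taun taus tol sigma : R).
Variables (s : nat -> 'rV[R]_d -> R) (n : nat -> 'rV[R]_d -> 'rV[R]_d).
Hypothesis d_gt0 : (0 < d)%N.
Hypothesis sigma_gt0 : 0 < sigma.
Hypothesis run : algorithm_run Om P M m taun taus tol sigma s n.

Notation vert := 'I_(nvtx M).
Notation field := ('rV[R]_d -> 'rV[R]_d).
Notation mu := (@lebesgue_rV R d).
Notation sq v := (mxdot v v).
Notation E0 := (energy Om P (s 0%N) (n 0%N)).

Let meshM : simplicial_mesh Om M. Proof. exact: run_mesh run. Qed.
Let domOm : polytopal_lipschitz_domain Om. Proof. exact: run_domain run. Qed.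
Let shapeM : shape_regular sigma M. Proof. exact: run_shape run. Qed.
Let taun_gt0 : 0 < taun. Proof. exact: run_taun run. Qed.

Lemma Lp_norm1E (f : 'rV[R]_d -> R) :
  Lp_norm Om 1%:E f = (\int[mu]_(x in Om) `|f x|%:E)%E.
Proof.
rewrite /Lp_norm Lnorm1 [RHS]integral_mkcond; apply: eq_integral => x _.
by rewrite /patch indicE; case: (_ \in _); rewrite /= ?mulr1 ?mulr0 ?normr0.
Qed.

Lemma sqr_Lp_norm2 (f : 'rV[R]_d -> R) :
  (Lp_norm Om 2%:E f `^ 2 = \int[mu]_(x in Om) (f x ^+ 2)%:E)%E.
Proof.
rewrite /Lp_norm poweR_Lnorm// [RHS]integral_mkcond; apply: eq_integral => x _.
rewrite /patch indicE; case: (_ \in _); rewrite /= ?mulr1 ?mulr0.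
  by rewrite -[2]/(2%:R) powR_mulrn// real_normK ?num_real.
by rewrite normr0 powR0.
Qed.

Lemma Lp_normy_le (f : 'rV[R]_d -> R) B : 0 <= B ->
  (forall x, Om x -> `|f x| <= B) -> (Lp_norm Om +oo%E f <= B%:E)%E.
Proof.
move=> B0 fB; rewrite /Lp_norm unlock; case: ifPn => // _.
apply: ess_sup_ler => x; rewrite lee_fin indicE.
have [/set_mem/fB|_] := boolP (x \in Om); first by rewrite mulr1.
by rewrite mulr0 normr0.
Qed.

Lemma pwaff_comb_cell (v : 'rV[R]_d -> R) K l x : pwaff M v -> K \in cells M ->
  barycentric (@vtx _ _ M) K x l -> v x = \sum_i l i * v (@vtx _ _ M i).
Proof.
move=> pv KM [l0 lK l1 lx]; have [a [b vE]] := pv K KM.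
rewrite vE; last by exists l.
rewrite -lx -[LHS]/(aff a b _) aff_comb//; apply: eq_bigr => i _.
have [iK|iK] := boolP (i \in K); last by rewrite lK// !mul0r.
by rewrite vE//; exact: (cell_vtx meshM).
Qed.

(** The difference of the two sides is the variance of [a] under the weights [l]. *)
Lemma jensen_sqr (I : finType) (l a : I -> R) : (forall i, 0 <= l i) ->
  \sum_i l i = 1 -> (\sum_i l i * a i) ^+ 2 <= \sum_i l i * a i ^+ 2.
Proof.
move=> l0 l1; set c := \sum_i l i * a i.
rewrite -subr_ge0 (_ : _ - _ = \sum_i l i * (a i - c) ^+ 2).
  by apply: sumr_ge0 => i _; rewrite mulr_ge0// sqr_ge0.
transitivity (\sum_i l i * a i ^+ 2 - 2 * c * c + c ^+ 2 * \sum_i l i).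
  by rewrite l1; ring.
have -> : 2 * c * c = \sum_i 2 * c * (l i * a i) by rewrite -mulr_sumr.
by rewrite [c ^+ 2 * _]mulr_sumr -sumrB -big_split; apply: eq_bigr => i _ /=; ring.
Qed.

Lemma sup_of_nodal_bound j (B : R) : 0 <= B ->
  (forall i, sq (n j (@vtx _ _ M i)) <= 1 + B) -> pwaff_vec M (n j) ->
  (Lp_norm Om +oo%E (fun x => enorm (n j x)) <= (1 + B)%:E)%E.
Proof.
move=> B0 nB pn; have B1 : 0 <= 1 + B by rewrite addr_ge0.
apply: Lp_normy_le => // x Ox.
have /(closureP meshM)[K KM [l lb]] : closure Om x by exact: subset_closure.
have [l0 _ l1 _] := lb.
rewrite ger0_norm ?enorm_ge0// -(@ler_pXn2r _ 2)// ?nnegrE ?enorm_ge0//.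
(* The nodal hypothesis bounds the squared length by [1 + B]; since [1 + B >= 1], this is at most
   the square of the target. *)
rewrite sqr_enorm; apply: (@le_trans _ _ (1 + B)); last first.
  by rewrite expr2 ler_peMr// lerDl.
apply: (@le_trans _ _ (\sum_i l i * sq (n j (@vtx _ _ M i)))).
  rewrite mxdot_rV; under [leRHS]eq_bigr do rewrite mxdot_rV mulr_sumr.
  rewrite exchange_big; apply: ler_sum => k _ /=.
  rewrite -expr2 (pwaff_comb_cell (pn k) KM lb); under eq_bigr do rewrite -expr2.
  exact: jensen_sqr.
have -> : 1 + B = \sum_i l i * (1 + B) by rewrite -mulr_suml l1 mul1r.
apply: ler_sum => i _.
by rewrite ler_wpM2l.
Qed.

Lemma sup_bound j C : 0 <= C ->
  (forall t, VhD_vec Om (GammaD P) M t -> forall i,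
     sq (t (@vtx _ _ M i)) <= C * star Om M m t t) ->
  (Lp_norm Om +oo%E (fun x => enorm (n j x)) <= (1 + C * taun * E0)%:E)%E.
Proof.
move=> C0 tC; have [ts [h1 h2 h3 h4]] := sum_updates_le d_gt0 run j.
apply: sup_of_nodal_bound => //.
  have e0 := initial_energy_ge0 run.
  by rewrite mulr_ge0// mulr_ge0// ltW.
move=> i; rewrite h3 lerD2l.
apply: (h4 (fun t => sq (t (@vtx _ _ M i)))) => // t /tC; exact.
Qed.

Lemma star_ge0 t : 0 <= star Om M m t t.
Proof.
case: m => [|al] /=; first exact: L2_mx_ge0.
apply: Rintegral_ge0 => x _; rewrite mxdotZl mulr_ge0 ?powR_ge0//.
exact: mxdot_ge0.
Qed.

Lemma good_sq (t : field) : pwaff_vec M t -> good Om M (fun x => sq (t x)).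
Proof. by move=> pt; apply: good_mxdot; exact: (mxgood_vec meshM). Qed.

Lemma local_sup_vec K i (t : field) : pwaff_vec M t -> K \in cells M -> i \in K ->
  diam (cell K) ^+ d * sq (t (@vtx _ _ M i)) <=
  local_cst (d := d) sigma * \int[mu]_(x in Om) (\1_(cell K) x * sq (t x)).
Proof.
move=> pt KM iK; have gK := good_indic Om M (measurable_cellM meshM KM).
rewrite mxdot_rV mulr_sumr.
have -> : \int[mu]_(x in Om) (\1_(cell K) x * sq (t x)) =
    \sum_k \int[mu]_(x in Om) (\1_(cell K) x * t x 0 k ^+ 2).
  have gk k : good Om M (fun x => \1_(cell K) x * t x 0 k ^+ 2).
    by apply: goodM => //; exact/goodX/(good_pwaff meshM).
  rewrite -(Rint_sum d_gt0 meshM domOm)//; apply: eq_Rintegral => x _.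
  by rewrite mxdot_rV mulr_sumr; apply: eq_bigr => k _; rewrite expr2.
rewrite mulr_sumr; apply: ler_sum => k _; rewrite -expr2.
exact: (local_sup d_gt0 meshM domOm sigma_gt0 shapeM (pt k) KM (cell_vtx meshM KM iK)).
Qed.

Lemma L2_sup_bound (t : field) i : pwaff_vec M t ->
  sq (t (@vtx _ _ M i)) <=
  local_cst (d := d) sigma * hmin M ^- d * L2_mx Om t t.
Proof.
move=> pt; have [K KM iK] := mesh_vtx_used meshM i.
have h0 := hmin_gt0 d_gt0 meshM domOm; have c0 := local_cst_gt0 d_gt0 sigma_gt0.
rewrite mulrAC ler_pdivlMr ?exprn_gt0// mulrC.
apply: (@le_trans _ _ (diam (cell K) ^+ d * sq (t (vtx i)))).
  rewrite ler_wpM2r ?mxdot_ge0// lerXn2r ?nnegrE ?(ltW h0)// ?hmin_le//.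
  exact/ltW/(diam_gt0 d_gt0 meshM).
apply: le_trans (local_sup_vec pt KM iK) _; rewrite ler_wpM2l ?(ltW c0)//.
apply: (Rint_cell_le d_gt0 meshM domOm) => //; first exact: good_sq.
by move=> x _; exact: mxdot_ge0.
Qed.

(** A cell has measure at most [(2 diam)^d] and has [d + 1] vertices, each estimated by
    [local_sup_vec]. *)
Definition L1_cst : R := 2 ^+ d * d.+1%:R * local_cst (d := d) sigma.

(** Barycentric coordinates are at most 1, so the left side dominates the integral of the nodal
    interpolant of [|t|^2]. *)
Lemma lumped_bound (t : field) : pwaff_vec M t ->
  \sum_(K in cells M) \sum_(i in K)
    fine (mu (cell K)) * sq (t (@vtx _ _ M i)) <= L1_cst * L2_mx Om t t.
Proof.
move=> pt; rewrite /L2_mx -(Rint_cells d_gt0 meshM domOm (good_sq pt)).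
rewrite mulr_sumr; apply: ler_sum => K KM.
have [cK _] := mesh_simplex meshM KM.
have D0 := diam_gt0 d_gt0 meshM KM.
set I := Rintegral _ _ _.
have -> : L1_cst * I = \sum_(i in K) 2 ^+ d * (local_cst (d := d) sigma * I).
  by rewrite sumr_const cK -[RHS]mulr_natl /L1_cst; move: (local_cst _) => c; ring.
rewrite {}/I; apply: ler_sum => i iK.
apply: (@le_trans _ _ ((2 * diam (cell K)) ^+ d * sq (t (vtx i)))).
  by rewrite ler_wpM2r ?mxdot_ge0// (measure_cell_le d_gt0 meshM).
by rewrite exprMn -mulrA ler_wpM2l ?exprn_ge0//; exact: local_sup_vec.
Qed.

(** The interpolant picks coordinates from an unspecified cell containing [x]. Conformity provides
    coordinates in the common face, and these are valid in both cells, so uniqueness identifies the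
    two choices. *)
Lemma nodal_interp_cell (f : 'rV[R]_d -> R) K x : K \in cells M -> cell K x ->
  exists l, barycentric (@vtx _ _ M) K x l /\
    nodal_interp M f x = \sum_i l i * f (@vtx _ _ M i).
Proof.
move=> KM [l lb]; rewrite /nodal_interp; case: xgetP => [l' l'E [K' K'M lb']|/(_ l)[]]; last first.
  by exists K.
exists l; split => //; suff -> : l' = l by [].
have : (cell K `&` cell K') x by split; [exists l|exists l'].
rewrite (mesh_conforming meshM KM K'M) => -[k [k0 kK k1 kx]].
have kb L : L \in cells M -> (K :&: K' \subset L) -> barycentric (@vtx _ _ M) L x k.
  move=> LM sL; split => // i iL; apply: kK; apply: contra iL.
  exact: (fintype.subsetP sL).
rewrite (barycentric_lam meshM KM lb) (barycentric_lam meshM K'M lb').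
rewrite -(barycentric_lam meshM KM (kb _ KM (subsetIl _ _))).
by rewrite -(barycentric_lam meshM K'M (kb _ K'M (subsetIr _ _))).
Qed.

Lemma L1_bound j (Cs : R) : 0 < Cs ->
  (forall t, VhD_vec Om (GammaD P) M t ->
     (Lp_norm Om 2%:E (fun x => enorm (t x)) <= (Cs * star_norm Om M m t)%:E)%E) ->
  (Lp_norm Om 1%:E (nodal_interp M (fun x => enorm (n j x) ^+ 2 - 1)%R)
   <= (L1_cst * Cs ^+ 2 * taun * E0)%:E)%E.
Proof.
move=> Cs0 hC; have [ts [h1 h2 h3 h4]] := sum_updates_le d_gt0 run j.
have c0 := local_cst_gt0 d_gt0 sigma_gt0.
have L0 : 0 <= L1_cst by apply: mulr_ge0 (ltW c0); rewrite mulr_ge0// exprn_ge0.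
pose F (t : field) := \sum_(K in cells M) \sum_(i in K)
    fine (mu (cell K)) * sq (t (@vtx _ _ M i)).
have FC t : VhD_vec Om (GammaD P) M t -> F t <= L1_cst * Cs ^+ 2 * star Om M m t t.
  move=> Vt; have pt := VhD_vec_pwaff Vt.
  apply: le_trans (lumped_bound pt) _; rewrite -mulrA ler_wpM2l//.
  rewrite -lee_fin -(integral_good d_gt0 meshM domOm (good_sq pt)).
  under eq_integral do rewrite -sqr_enorm.
  rewrite -sqr_Lp_norm2.
  have -> : (Cs ^+ 2 * star Om M m t t)%:E = ((Cs * star_norm Om M m t)%:E `^ 2)%E.
    rewrite /= -[2]/(2%:R) powR_mulrn; last by rewrite mulr_ge0 ?sqrtr_ge0// ltW.
    by rewrite exprMn sqr_sqrtr// star_ge0.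
  apply: gt0_ler_poweR => //; rewrite ?in_itv/= ?leey ?andbT//.
  - exact: Lnorm_ge0.
  - by rewrite lee_fin mulr_ge0 ?sqrtr_ge0// ltW.
  - exact: hC.
have := h4 F _ _ FC; rewrite mulr_ge0 ?sqr_ge0// => /(_ isT) hF.
rewrite Lp_norm1E; apply: (@le_trans _ _ (taun ^+ 2 * \sum_(t <- ts) F t)%:E); last first.
  by rewrite lee_fin.
pose c (K : {set vert}) := \sum_(i in K) taun ^+ 2 * \sum_(t <- ts) sq (t (@vtx _ _ M i)).
have c_ge0 K : 0 <= c K.
  by apply: sumr_ge0 => i _; rewrite mulr_ge0 ?sqr_ge0// sumr_ge0// => t _; exact: mxdot_ge0.
have gK K : K \in cells M -> good Om M (fun x => c K * \1_(cell K) x).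
  by move=> KM; apply: goodZ; exact: (good_indic Om M (measurable_cellM meshM KM)).
(* The interpolant is dominated by a cellwise constant function; this comparison asks for no
   measurability of the interpolant. *)
apply: (@le_trans _ _ (\int[mu]_(x in Om) (\sum_(K in cells M) c K * \1_(cell K) x)%:E)%E).
  apply: ge0_le_integral_arbitrary => [x _|x Ox]; first by rewrite lee_fin.
  have /(closureP meshM)[K KM Kx] : closure Om x by exact: subset_closure.
  have [l [lb ->]] := nodal_interp_cell (fun x => enorm (n j x) ^+ 2 - 1) KM Kx.
  have [l0 lK l1 _] := lb.
  under eq_bigr do rewrite sqr_enorm h3 addrC addKr.
  rewrite lee_fin (bigD1 K)//= indicE mem_set// mulr1 ler_wpDr//.
    by apply: sumr_ge0 => L _; rewrite mulr_ge0// indicE.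
  rewrite ger0_norm; last first.
    apply: sumr_ge0 => i _; rewrite mulr_ge0// mulr_ge0 ?sqr_ge0// sumr_ge0// => t _.
    exact: mxdot_ge0.
  rewrite (bigID (mem K))/= [X in _ + X]big1 ?addr0; last first.
    by move=> i iK; rewrite lK// mul0r.
  apply: ler_sum => i iK; rewrite ler_piMl//.
    by rewrite mulr_ge0 ?sqr_ge0// sumr_ge0// => t _; exact: mxdot_ge0.
  by rewrite -l1 (bigD1 i)//= lerDl sumr_ge0.
rewrite (integral_good d_gt0 meshM domOm); last exact: good_sum.
rewrite lee_fin le_eqVlt; apply/orP; left; apply/eqP.
rewrite (Rint_sum d_gt0 meshM domOm)// /F.
rewrite [in RHS]exchange_big/= mulr_sumr.
transitivity (\sum_(K in cells M) fine (mu (cell K)) * c K).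
  apply: eq_bigr => K KM; rewrite (Rint_Z d_gt0 meshM domOm).
    rewrite (Rint_indic d_gt0 meshM domOm (measurable_cellM meshM KM)); last first.
      exact: (cell_closure meshM KM).
    by rewrite mulrC.
  exact: (good_indic Om M (measurable_cellM meshM KM)).
apply: eq_bigr => K KM; rewrite exchange_big /c !mulr_sumr; apply: eq_bigr => i iK /=.
by rewrite -mulr_sumr mulrCA.
Qed.

End norm_bounds.

(** * Discrete Sobolev inequality *)

Section segment_lipschitz.
Context {R : realType}.

(* Induction on the number of pieces: the last point of the piece containing
   the left end lies in another piece, by closedness. *)
Lemma finite_cover_lipschitz (T : finType) (S : {set T}) (I : T -> set R)
    (g : R -> R) (L a b : R) : a <= b ->
  (forall t, a <= t <= b -> exists2 k, k \in S & I k t) ->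
  (forall k, k \in S -> closed (I k)) ->
  (forall k s t, k \in S -> I k s -> I k t -> `|g s - g t| <= L * `|s - t|) ->
  `|g b - g a| <= L * (b - a).
Proof.
move: {2}#|S| (erefl #|S|) => N; elim: N S a => [|N IH] S a cS ab cov clo lip.
  have /cov[k] : a <= a <= b by rewrite lexx ab.
  by rewrite (cards0_eq cS) inE.
have /cov[k kS ka] : a <= a <= b by rewrite lexx ab.
pose A := I k `&` [set t | a <= t <= b].
have A0 : A !=set0 by exists a; split => //=; rewrite lexx ab.
have ubA : has_ubound A by exists b => t [_ /andP[]].
have clA : closed A.
  apply: closedI; first exact: clo.
  rewrite (_ : [set _ | _] = `[a, b]%classic); first exact: interval_closed.
  by apply/seteqP; split => t /=; rewrite in_itv.
have := closure_sup A0 ubA; rewrite -((closure_id _).1 clA) => -[Is /andP[as1 s1b]].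
set s1 := sup A in Is as1 s1b.
have ga : `|g s1 - g a| <= L * (s1 - a).
  by rewrite -[X in L * X]ger0_norm ?subr_ge0//; exact: (lip k).
have [<-//|s1b'] := eqVneq s1 b.
have {s1b'} s1b' : s1 < b by rewrite lt_neqAle s1b' s1b.
have cov' t : s1 < t -> t <= b -> exists2 k', k' \in S :\ k & I k' t.
  move=> st tb; have at_ : a <= t by rewrite (le_trans as1)// ltW.
  have /cov[k' k'S It] : a <= t <= b by rewrite at_ tb.
  exists k' => //; rewrite !inE k'S andbT; apply/eqP => kk; subst k'.
  have : t <= s1 by apply: ub_le_sup => //; split => //=; rewrite at_ tb.
  by rewrite leNgt st.
have clS : closed (\bigcup_(k' in [set` S :\ k]) I k').
  apply: closed_bigcup; first exact: finite_finset.
  by move=> k'; rewrite /= !inE => /andP[_]; exact: clo.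
have cS' : (\bigcup_(k' in [set` S :\ k]) I k') s1.
  rewrite ((closure_id _).1 clS) => B /nbhs_ballP[e /= e0 eB].
  pose t := Num.min b (s1 + e / 2).
  have e2 : 0 < e / 2 by rewrite divr_gt0.
  have st : s1 < t by rewrite lt_min s1b' ltrDl.
  have [k' k'S It] : exists2 k', k' \in S :\ k & I k' t.
    by apply: cov' => //; rewrite ge_min lexx.
  exists t; split; first by exists k'.
  apply: eB; rewrite /ball/= distrC gtr0_norm ?subr_gt0//.
  rewrite ltrBlDl; apply: (@le_lt_trans _ _ (s1 + e / 2)).
    by rewrite ge_min lexx orbT.
  by rewrite ltrD2l ltr_pdivrMr// ltr_pMr// ltr1n.
have gb : `|g b - g s1| <= L * (b - s1).
  apply: (IH (S :\ k)) => //.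
  - by have := cardsD1 k S; rewrite kS cS add1n => -[<-].
  - move=> t /andP[st tb]; have [->|ts] := eqVneq t s1.
      by have [k' k'S Ik'] := cS'; exists k'.
    by apply: cov' => //; rewrite lt_neqAle eq_sym ts st.
  - by move=> k'; rewrite !inE => /andP[_]; exact: clo.
  - by move=> k' u v; rewrite !inE => /andP[_ k'S]; exact: lip.
rewrite (_ : g b - g a = (g b - g s1) + (g s1 - g a)); last by ring.
apply: le_trans (ler_normD _ _) _; apply: le_trans (lerD gb ga) _.
by rewrite -mulrDr addrA subrK.
Qed.

End segment_lipschitz.

(** * Lipschitz bounds and inverse estimates for gradients *)

Section gradient_bounds.
Context {R : realType} {d : nat}.
Variables (Om : set 'rV[R]_d) (M : mesh R d) (sigma : R).
Hypothesis d_gt0 : (0 < d)%N.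
Hypothesis meshM : simplicial_mesh Om M.
Hypothesis domOm : polytopal_lipschitz_domain Om.

Notation vert := 'I_(nvtx M).
Notation mu := (@lebesgue_rV R d).
Notation U := (offskel Om M).

Definition dirichlet_energy (f : 'rV[R]_d -> R) : R :=
  \int[mu]_(x in Om) mxdot (grad f x) (grad f x).

Lemma good_grad_sqr f : pwaff M f -> good Om M (fun x => mxdot (grad f x) (grad f x)).
Proof.
by move=> pf; apply: good_mxdot => i j; rewrite ord1; exact: (good_grad meshM).
Qed.

Lemma closed_segment_cell (K : {set vert}) (x v : 'rV[R]_d) : K \in cells M ->
  closed [set t : R | cell K (x + t *: v)].
Proof.
move=> KM; rewrite (_ : [set t | _] = \bigcap_(i in [set: vert])
    [set t | 0 <= lam K i x + t * mxdot (lamgrad K i) v]).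
  apply: closed_bigI => i _.
  rewrite (_ : [set t | _] = (fun t : R => lam K i x + t * mxdot (lamgrad K i) v) @^-1`
      [set t | 0 <= t])//.
  apply: preimage_closed; last exact: closed_ge.
  by move=> t _; apply: cvgD; [exact: cvg_cst|apply: cvgM; [exact: cvg_id|exact: cvg_cst]].
apply/seteqP; split => t /= h.
  by move=> i _ /=; have := (cellP meshM _ KM).1 h i; rewrite /lam affD.
by apply/(cellP meshM _ KM) => i; rewrite /lam affD; exact: h.
Qed.

(** The segment may run inside the skeleton, where no gradient is available to integrate. Instead it
    is covered by closed pieces, one per cell, on each of which [f] is affine. *)
Lemma pwaff_lipschitz f a b L x y : 0 <= L ->
  (forall K z, K \in cells M -> cell K z -> f z = aff (a K) (b K) z) ->
  (forall K, K \in cells M -> enorm (a K) <= L) ->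
  (forall t, 0 <= t <= 1 -> closure Om (x + t *: (y - x))) ->
  `|f y - f x| <= L * enorm (y - x).
Proof.
move=> L0 fE aL seg; pose g t := f (x + t *: (y - x)).
have -> : f y - f x = g 1 - g 0 by rewrite /g scale1r scale0r addr0 (addrC x) subrK.
have := @finite_cover_lipschitz R _ (cells M) (fun K => [set t : R | cell K (x + t *: (y - x))])
  g (L * enorm (y - x)) 0 1 ler01.
rewrite subr0 mulr1; apply.
- by move=> t /seg/(closureP meshM)[K KM Kt]; exists K.
- by move=> K KM; exact: closed_segment_cell.
- move=> K s t KM /= Ks Kt; rewrite /g !(fE K)// !affD.
  set D := mxdot _ _; set c := aff _ _ _.
  rewrite (_ : c + s * D - (c + t * D) = (s - t) * D); last by ring.
  rewrite {}/c {}/D.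
  rewrite normrM mulrC ler_wpM2r//.
  have h (w : 'rV[R]_d) : mxdot (a K) w <= L * enorm w.
    by apply: le_trans (mxdot_le_enorm _ _) _; rewrite ler_wpM2r ?enorm_ge0 ?aL.
  rewrite ler_norml h andbT lerNl -mxdotNr; apply: le_trans (h _) _.
  by rewrite enormN.
Qed.

Hypothesis sigma_gt0 : 0 < sigma.
Hypothesis shapeM : shape_regular sigma M.

(** The gradient is constant on the cell, and the cell contains a cube of side [core_radius K],
    which is at least [hmin / (4 sigma d)]. *)
Lemma cell_gradient_bound f K A b : pwaff M f -> K \in cells M ->
  (forall z, cell K z -> f z = aff A b z) ->
  mxdot A A <= (4 * sigma * d%:R) ^+ d * hmin M ^- d * dirichlet_energy f.
Proof.
move=> pf KM fE; have h0 := hmin_gt0 d_gt0 meshM domOm.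
have gf := good_grad_sqr pf.
have c0 : 0 < 4 * sigma * d%:R by rewrite !mulr_gt0 ?ltr0n.
have e1 : mxdot A A * fine (mu (cell K)) <= dirichlet_energy f.
  apply: le_trans (Rint_cell_le d_gt0 meshM domOm gf (fun x _ => mxdot_ge0 _) KM).
  have mK := measurable_cellM meshM KM.
  rewrite -(Rint_indic d_gt0 meshM domOm mK (cell_closure meshM KM)).
  rewrite -(Rint_Z d_gt0 meshM domOm); last exact: good_indic.
  rewrite le_eqVlt; apply/orP; left; apply/eqP; apply: (Rint_ext d_gt0 meshM domOm).
  move=> x [_ sx]; rewrite indicE; have [/set_mem Kx|_] := boolP (x \in _).
    by rewrite (grad_cell meshM KM Kx sx fE) mulr1 mul1r.
  by rewrite mulr0 mul0r.
have e2 : hmin M ^+ d / (4 * sigma * d%:R) ^+ d <= fine (mu (cell K)).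
  apply: le_trans (measure_cell_ge d_gt0 meshM sigma_gt0 shapeM KM).
  rewrite -expr_div_n lerXn2r// ?nnegrE ?divr_ge0 ?(ltW h0) ?(ltW c0)//.
    exact/ltW/(diam_gt0 d_gt0 meshM KM).
  by rewrite ler_pM2r ?invr_gt0//; exact: hmin_le.
have e3 : mxdot A A * (hmin M ^+ d / (4 * sigma * d%:R) ^+ d) <= dirichlet_energy f.
  by apply: le_trans e1; rewrite ler_wpM2l// mxdot_ge0.
move: e3; rewrite mulrA ler_pdivrMr ?exprn_gt0// => e3.
by rewrite mulrAC ler_pdivlMr ?exprn_gt0// [leRHS]mulrC.
Qed.

End gradient_bounds.

(** * Means over moving cubes *)

Section moving_cubes.
Context {R : realType} {d : nat}.
Variables (Om : set 'rV[R]_d) (M : mesh R d).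
Hypothesis d_gt0 : (0 < d)%N.
Hypothesis meshM : simplicial_mesh Om M.
Hypothesis domOm : polytopal_lipschitz_domain Om.

Notation vert := 'I_(nvtx M).
Notation mu := (@lebesgue_rV R d).
Notation U := (offskel Om M).
Notation Q := (@unit_cube R d).
Notation cl := (closure Om).

Variables (f : 'rV[R]_d -> R) (a : {set vert} -> 'rV[R]_d) (b : {set vert} -> R).
Variable L : R.
Hypothesis fE : forall K z, K \in cells M -> cell K z -> f z = aff (a K) (b K) z.
Hypothesis L_ge0 : 0 <= L.
Hypothesis aL : forall K, K \in cells M -> enorm (a K) <= L.

(** Pulled back to the unit cube, of measure 1, so that the domain of integration stays fixed while
    the cube moves and changes size. *)
Definition cube_mean (g : 'rV[R]_d -> R) x r : R :=
  \int[mu]_(u in Q) g (hom x r u).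

Let mQ : measurable Q. Proof. exact: measurable_unit_cube. Qed.

Let pf : pwaff M f.
Proof. by move=> K KM; exists (a K), (b K) => x Kx; rewrite (fE KM Kx). Qed.

Lemma measurable_pwaff_closure : measurable_fun cl f.
Proof.
move=> _ Y mY; rewrite (_ : cl `&` f @^-1` Y =
    \bigcup_(K in [set` cells M]) (cell K `&` (setT `&` aff (a K) (b K) @^-1` Y))).
  apply: fin_bigcup_measurable => [|K KM]; first exact: finite_finset.
  apply: measurableI; first exact: (measurable_cell meshM).
  exact: measurable_affine_form.
apply/seteqP; split => x /=.
  move=> [/(closureP meshM)[K KM Kx] fY]; exists K => //; split => //; split => //=.
  by rewrite -fE.
move=> [K KM [Kx [_ /=]]]; rewrite -fE// => fY; split => //.
by apply/(closureP meshM); exists K.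
Qed.

Lemma pwaff_bounded : exists C, forall x, cl x -> `|f x| <= C.
Proof.
have /choice[C CP] : forall K, exists C, forall x, cell K x -> `|aff (a K) (b K) x| <= C.
  by move=> K; exact: aff_bounded.
exists (\sum_(K in cells M) `|C K|) => x /(closureP meshM)[K KM Kx].
rewrite (fE KM Kx); apply: le_trans (CP _ _ Kx) _; apply: le_trans (ler_norm _) _.
by rewrite (bigD1 K)//= lerDl sumr_ge0.
Qed.

Lemma cube_integrable x r : (forall u, Q u -> cl (hom x r u)) ->
  mu.-integrable Q (EFin \o (f \o hom x r)).
Proof.
move=> xr; apply: measurable_bounded_integrable => //.
- by rewrite lebesgue_unit_cube ltry.
- apply: (@measurable_comp _ _ _ _ _ _ cl).
  + exact: (measurable_closure meshM).
  + by move=> _ [u Qu <-]; exact: xr.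
  + exact: measurable_pwaff_closure.
  + by apply: measurable_funS (measurable_hom x r).
- have [C CP] := pwaff_bounded.
  exists C; split; first exact: num_real.
  by move=> y Cy u Qu /=; apply: le_trans (CP _ (xr _ Qu)) (ltW Cy).
Qed.

Lemma hom_dirichlet_le x r : 0 < r -> (forall u, Q u -> cl (hom x r u)) ->
  (\int[mu]_(u in Q `\` hom x r @^-1` skel M)
     (mxdot (grad f (hom x r u)) (grad f (hom x r u)))%:E
   <= (r ^- d * dirichlet_energy Om f)%:E)%E.
Proof.
move=> r0 xr; pose F y := (mxdot (grad f y) (grad f y))%:E.
have gF := good_grad_sqr meshM pf.
have mF : measurable_fun U F by apply/measurable_EFinP; case: gF.
have F0 y : (0 <= F y)%E by rewrite lee_fin mxdot_ge0.
have cubeU : cube x r `\` skel M `<=` U.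
  move=> y [cy sy]; split => //; rewrite -(_ : hom x r (r^-1 *: (y - x)) = y).
    apply: xr; rewrite -(hom_cube x r0) /=.
    by rewrite /hom scalerA divff ?gt_eqF// scale1r addrC subrK.
  by rewrite /hom scalerA divff ?gt_eqF// scale1r addrC subrK.
have mC : measurable (cube x r `\` skel M).
  by apply: measurableD; [exact: measurable_cube|exact: measurable_skel].
have -> : Q `\` hom x r @^-1` skel M = hom x r @^-1` (cube x r `\` skel M).
  by rewrite -(hom_cube x r0).
have mFC := measurable_funS (measurable_offskel meshM) cubeU mF.
have := @ge0_integral_pushforward _ _ _ _ R _ (measurable_hom x r) mu
  (cube x r `\` skel M) F mC mFC (fun y _ => F0 y).
move=> <-.
have rd0 : 0 <= r ^- d by rewrite invr_ge0 exprn_ge0// ltW.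
rewrite (@eq_measure_integral _ _ _ _ (mscale (NngNum rd0) mu)); last 2 first.
- exact: measurable_hom.
- by move=> mf B mB _; exact: (lebesgue_rV_hom x r0 mB).
rewrite ge0_integral_mscale//=.
rewrite EFinM lee_wpmul2l ?lee_fin//.
rewrite -(integral_good d_gt0 meshM domOm gF) (integral_Omega d_gt0 meshM domOm).
by apply: ge0_subset_integral => //; exact: (measurable_offskel meshM).
Qed.

Variables (x0 x1 : 'rV[R]_d) (r0 r1 rho V G : R).
Hypothesis rho_gt0 : 0 < rho.
Hypothesis r0_ge : rho <= r0.
Hypothesis r1_ge : rho <= r1.

Let X t : 'rV[R]_d := x0 + t *: (x1 - x0).
Let r t : R := r0 + t * (r1 - r0).
(** Velocity of the point with reference position [u]; it is constant in time because corner and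
    side vary affinely. *)
Let v (u : 'rV[R]_d) : 'rV[R]_d := (x1 - x0) + (r1 - r0) *: u.
Let y t (u : 'rV[R]_d) : 'rV[R]_d := hom (X t) (r t) u.

Hypothesis incl : forall t u, 0 <= t <= 1 -> Q u -> cl (y t u).
Hypothesis v_le : forall u, Q u -> enorm (v u) <= V.
Hypothesis V_gt0 : 0 < V.
Hypothesis G_gt0 : 0 < G.
Hypothesis G_ge : dirichlet_energy Om f <= G ^+ 2.

Let yE s t u : y s u = y t u + (s - t) *: v u.
Proof. by apply/rowP => i; rewrite /y /v /hom /X /r !mxE; ring. Qed.

(** Freezing the motion outside [[0, 1]] makes the mean a Lipschitz function on the whole line, so
    difference quotients make sense for every increment. *)
Let clamp (t : R) : R := Num.max 0 (Num.min 1 t).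

Let clamp01 t : 0 <= clamp t <= 1.
Proof. by rewrite le_max lexx/= ge_max ler01 ge_min lexx. Qed.

Let clampE t : 0 <= t <= 1 -> clamp t = t.
Proof. by move=> /andP[t0 t1]; rewrite /clamp (min_idPr t1) (max_idPr t0). Qed.

Let clamp_lip s t : `|clamp s - clamp t| <= `|s - t|.
Proof.
wlog st : s t / s <= t.
  by move=> h; have [/h//|/ltW/h] := leP s t; rewrite distrC (distrC t).
rewrite (distrC s) (ger0_norm (_ : 0 <= t - s)) ?subr_ge0// ler_norml.
rewrite /clamp !maxEle !minEle.
by apply/andP; split; case: (leP 1 s) => h1; case: (leP 1 t) => h2;
  rewrite ?ler01; case: (leP 0 s) => h3; case: (leP 0 t) => h4; lra.
Qed.

Let lip s t u : Q u ->
  `|f (y (clamp s) u) - f (y (clamp t) u)| <= L * V * `|s - t|.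
Proof.
move=> Qu; apply: (@le_trans _ _ (L * enorm (y (clamp s) u - y (clamp t) u))).
  apply: (pwaff_lipschitz meshM L_ge0 fE aL) => c c01.
  have -> : y (clamp t) u + c *: (y (clamp s) u - y (clamp t) u) =
      y (clamp t + c * (clamp s - clamp t)) u.
    rewrite (yE (clamp s) (clamp t)) (yE (_ + _) (clamp t)).
    by apply/rowP => i; rewrite !mxE; ring.
  apply: incl => //; have /andP[] := clamp01 s; have /andP[] := clamp01 t.
  move: c01 => /andP[c0 c1] t0 t1 s0 s1; apply/andP; split; nra.
rewrite (yE (clamp s) (clamp t)) addrC addKr enormZ -mulrA ler_wpM2l//.
by rewrite mulrC ler_pM ?enorm_ge0 ?v_le.
Qed.

Let r_ge t : 0 <= t <= 1 -> rho <= r t.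
Proof.
move=> /andP[t0 t1]; rewrite /r.
have := mulr_ge0 t0 (_ : 0 <= r1 - rho); rewrite subr_ge0 => /(_ r1_ge).
have := @mulr_ge0 R (1 - t) (r0 - rho); rewrite !subr_ge0 => /(_ t1 r0_ge); lra.
Qed.

Let phi (t : R) : R := cube_mean f (X (clamp t)) (r (clamp t)).

Let int_phi t : mu.-integrable Q (EFin \o (fun u => f (y (clamp t) u))).
Proof. by apply: cube_integrable => u Qu; exact: incl. Qed.

Let Q_finite : (mu Q < +oo)%E. Proof. by rewrite lebesgue_unit_cube ltry. Qed.

Let int_cst (c : R) : mu.-integrable Q (EFin \o (fun=> c)).
Proof.
apply: measurable_bounded_integrable => //.
by exists `|c|; split; [exact: num_real|move=> z cz w _; exact: ltW].
Qed.

Let phi_lip s t : `|phi s - phi t| <= L * V * `|s - t|.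
Proof.
rewrite /phi /cube_mean -RintegralB//; [|exact: int_phi|exact: int_phi].
have iB : mu.-integrable Q (EFin \o (fun u => f (y (clamp s) u) - f (y (clamp t) u))).
  exact: integrableB (int_phi s) (int_phi t).
apply: le_trans (le_normr_Rintegral mQ iB) _.
apply: (@le_trans _ _ (\int[mu]_(u in Q) (L * V * `|s - t|))).
  by apply: le_Rintegral => //; [exact: integrable_norm|exact: lip].
by rewrite Rintegral_cst// lebesgue_unit_cube mulr1.
Qed.

Let B t : set 'rV[R]_d := hom (X t) (r t) @^-1` skel M.

Let mB t : measurable (B t).
Proof.
rewrite -[X in measurable X]setTI; apply: measurable_hom => //; exact: measurable_skel.
Qed.

Let B_null t : 0 <= t <= 1 -> mu (B t) = 0%E.
Proof.
move=> t01; rewrite lebesgue_rV_hom ?(lt_le_trans rho_gt0) ?r_ge//; last exact: measurable_skel.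
by rewrite (skel_null d_gt0 meshM) mule0.
Qed.

Let psi (t : R) (u : 'rV[R]_d) : R := mxdot (grad f (y t u)) (v u).

(** Off the preimage of the skeleton the moving point is interior to a cell. There [f] is affine
    along a short piece of the path, so the quotient is eventually equal to its limit. *)
Let quot_cvg t (h : R^nat) u : 0 < t < 1 -> (forall n, h n != 0) ->
  h n @[n --> \oo] --> 0 -> (Q `\` B t) u ->
  (f (y (clamp (t + h n)) u) - f (y (clamp t) u)) / h n @[n --> \oo] --> psi t u.
Proof.
move=> /andP[t0 t1] h0 hh [Qu Bu].
have t01 : 0 <= t <= 1 by rewrite !ltW.
have cly := incl t01 Qu.
have [K KM Ky] := (closureP meshM _).1 cly.
have nbK := nbhs_cell meshM KM (cell_off_skel meshM KM Ky Bu).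
have [e e0 eK] := nbhs_coord nbK.
have gE : grad f (y t u) = a K by apply: (grad_cell meshM KM Ky Bu (b := b K)) => z; exact: fE.
apply: cvg_trans (_ : cst (psi t u) @ \oo --> psi t u); last exact: cvg_cst.
apply: near_eq_cvg.
have V0 : 0 < enorm (v u) + 1 by rewrite ltr_wpDl// enorm_ge0.
pose eps := Num.min (Num.min t (1 - t)) (e / (enorm (v u) + 1)).
have eps0 : 0 < eps by rewrite !lt_min t0 subr_gt0 t1 divr_gt0.
have /cvgr0Pnorm_lt/(_ _ eps0) hn := hh.
near=> n; have : `|h n| < eps by near: n.
rewrite !lt_min -andbA => /and3P[hn1 hn2 hn3].
have c1 : clamp (t + h n) = t + h n.
  apply: clampE; move: hn1 hn2; rewrite !ltr_norml => /andP[? ?] /andP[? ?].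
  by apply/andP; split; lra.
rewrite /cst c1 (clampE t01) (yE (t + h n) t) (addrC t) addrK.
have Ky' : cell K (y t u + h n *: v u).
  apply: eK => i.
  have -> : (y t u + h n *: v u) 0 i - y t u 0 i = h n * v u 0 i.
    by move: (y t u) (v u) => w w'; rewrite !mxE; ring.
  rewrite normrM.
  apply: le_lt_trans (_ : `|h n| * (enorm (v u) + 1) < _); last by rewrite -ltr_pdivlMr.
  by rewrite ler_wpM2l// (le_trans (entry_le_enorm _ 0 i))// lerDl.
rewrite (fE KM Ky) (fE KM Ky') affD /psi gE addrAC subrr add0r.
by rewrite mulrAC divff ?h0// mul1r.
Unshelve. all: by end_near. Qed.


Let mD t : measurable (Q `\` B t). Proof. exact: measurableD. Qed.

Let D_finite t : (mu (Q `\` B t) < +oo)%E.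
Proof. by apply: le_lt_trans Q_finite; apply: le_measure; rewrite ?inE// => u []. Qed.

Let D_integrable t (g : 'rV[R]_d -> R) C : measurable_fun (Q `\` B t) g ->
  (forall u, (Q `\` B t) u -> `|g u| <= C) -> mu.-integrable (Q `\` B t) (EFin \o g).
Proof.
move=> mg gC; apply: measurable_bounded_integrable => //.
exists C; split; first exact: num_real.
by move=> z Cz u Du; apply: le_trans (gC _ Du) (ltW Cz).
Qed.

Let y_offskel t u : 0 <= t <= 1 -> (Q `\` B t) u -> U (y t u).
Proof. by move=> t01 [Qu Bu]; split => //; exact: incl. Qed.

Let grad_le t u : 0 <= t <= 1 -> (Q `\` B t) u -> enorm (grad f (y t u)) <= L.
Proof.
move=> t01 Du; have [K KM Ky] := offskel_cell meshM (y_offskel t01 Du).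
have [_ sy] := y_offskel t01 Du.
by rewrite (grad_cell meshM KM Ky sy (b := b K) (a := a K)) ?aL// => z; exact: fE.
Qed.

Let measurable_grad t j : 0 <= t <= 1 ->
  measurable_fun (Q `\` B t) (fun u => grad f (y t u) 0 j).
Proof.
move=> t01; apply: (@measurable_comp _ _ _ _ _ _ U (fun z => grad f z 0 j)).
- exact: (measurable_offskel meshM).
- by move=> _ [u Du <-]; exact: y_offskel.
- by have [] := good_grad meshM j pf.
- by apply: measurable_funS (measurable_hom _ _).
Qed.

Let measurable_psi t : 0 <= t <= 1 -> measurable_fun (Q `\` B t) (psi t).
Proof.
move=> t01; rewrite (_ : psi t = fun u => \sum_j grad f (y t u) 0 j * v u 0 j); last first.
  by apply/funext => u; rewrite /psi mxdot_rV.
apply: measurable_sum => j; apply: measurable_funM; first exact: measurable_grad.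
have := @measurable_hom R d (x1 - x0) (r1 - r0).
move=> /(measurableT_comp (@measurable_rV_coord R d j)).
exact: measurable_funS.
Qed.

Let psi_le t u : 0 <= t <= 1 -> (Q `\` B t) u ->
  `|psi t u| <= enorm (grad f (y t u)) * V.
Proof.
move=> t01 [Qu Bu]; rewrite /psi.
have h (w : 'rV[R]_d) : mxdot w (v u) <= enorm w * V.
  by apply: le_trans (mxdot_le_enorm _ _) _; rewrite ler_wpM2l ?enorm_ge0 ?v_le.
by rewrite ler_norml h andbT lerNl -mxdotNl -(enormN (grad _ _)) h.
Qed.

Let psi_integrable t : 0 <= t <= 1 -> mu.-integrable (Q `\` B t) (EFin \o psi t).
Proof.
move=> t01; apply: (@D_integrable t (psi t) (L * V)); first exact: measurable_psi.
move=> u Du; apply: le_trans (psi_le t01 Du) _.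
by rewrite ler_wpM2r ?(ltW V_gt0)// grad_le.
Qed.

Let Psi t : R := \int[mu]_(u in Q `\` B t) psi t u.

Let Psi_le t : 0 <= t <= 1 -> `|Psi t| <= V * (Num.sqrt (rho ^- d) * G).
Proof.
move=> t01; set S := _ * G.
have rd0 : 0 < rho ^- d by rewrite invr_gt0 exprn_gt0.
have S0 : 0 < S by rewrite mulr_gt0 ?sqrtr_gt0.
pose F2 u := mxdot (grad f (y t u)) (grad f (y t u)).
have mF2 : measurable_fun (Q `\` B t) F2.
  rewrite (_ : F2 = fun u => \sum_j grad f (y t u) 0 j * grad f (y t u) 0 j).
    by apply: measurable_sum => j; apply: measurable_funM; exact: measurable_grad.
  by apply/funext => u; rewrite /F2 mxdot_rV.
have F2L u : (Q `\` B t) u -> `|F2 u| <= L ^+ 2.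
  move=> Du; rewrite ger0_norm ?mxdot_ge0// /F2 -sqr_enorm.
  by rewrite lerXn2r ?nnegrE ?enorm_ge0//; exact: grad_le.
have iF2 : mu.-integrable (Q `\` B t) (EFin \o F2).
  exact: (@D_integrable t F2 (L ^+ 2)).
have rt := r_ge t01; have rt0 := lt_le_trans rho_gt0 rt.
have IF2 : \int[mu]_(u in Q `\` B t) F2 u <= S ^+ 2.
  apply: (@le_trans _ _ (r t ^- d * dirichlet_energy Om f)).
    rewrite -lee_fin /Rintegral fineK; last exact: integrable_fin_num.
    by apply: hom_dirichlet_le => // u; exact: incl.
  rewrite exprMn sqr_sqrtr ?(ltW rd0)// ler_pM ?invr_ge0 ?exprn_ge0 ?(ltW rt0)//.
    by apply: Rintegral_ge0 => x _; exact: mxdot_ge0.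
  by rewrite lef_pV2 ?posrE ?exprn_gt0// lerXn2r ?nnegrE ?(ltW rho_gt0) ?(ltW rt0).
have i1 : mu.-integrable (Q `\` B t) (EFin \o (fun u => V / (2 * S) * F2 u)).
  apply: (@D_integrable t _ (V / (2 * S) * L ^+ 2)).
    exact: measurable_funM.
  have c0 : 0 <= V / (2 * S) by apply: divr_ge0; [exact: ltW|rewrite mulr_ge0// ltW].
  by move=> u Du; rewrite normrM (ger0_norm c0) ler_wpM2l ?F2L.
have i2 : mu.-integrable (Q `\` B t) (EFin \o (fun=> V * S / 2)).
  by apply: (@D_integrable t _ `|V * S / 2|).
apply: le_trans (le_normr_Rintegral (mD t) (psi_integrable t01)) _.
(* Young's inequality [V e <= V / (2 S) e^2 + V S / 2], weighted so that both terms integrate to at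
   most [V S / 2]; this is the Cauchy-Schwarz bound. *)
apply: (@le_trans _ _ (\int[mu]_(u in Q `\` B t) (V / (2 * S) * F2 u + V * S / 2))).
  apply: le_Rintegral => //.
  - by apply: integrable_norm => //; exact: psi_integrable.
  - exact: integrableD i1 i2.
  - move=> u Du; apply: le_trans (psi_le t01 Du) _.
    rewrite /F2 -sqr_enorm; set e := enorm _.
    rewrite -subr_ge0 (_ : _ - _ = V / (2 * S) * (e - S) ^+ 2).
      by rewrite mulr_ge0 ?sqr_ge0// divr_ge0// ?mulr_ge0// ltW.
    by field; rewrite gt_eqF.
rewrite RintegralD// RintegralZl// Rintegral_cst//.
have m1 : fine (mu (Q `\` B t)) <= 1.
  rewrite -lee_fin fineK ?ge0_fin_numE// -(lebesgue_unit_cube d).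
  by apply: le_measure; rewrite ?inE// => u [].
have h1 : V / (2 * S) * (\int[mu]_(u in Q `\` B t) F2 u) <= V / (2 * S) * S ^+ 2.
  by rewrite ler_wpM2l// divr_ge0// ?mulr_ge0// ltW.
have h2 : V * S / 2 * fine (mu (Q `\` B t)) <= V * S / 2 * 1.
  by rewrite ler_wpM2l// divr_ge0// mulr_ge0// ltW.
apply: le_trans (lerD h1 h2) _; rewrite le_eqVlt; apply/orP; left; apply/eqP.
by field; rewrite gt_eqF.
Qed.

(** Dominated convergence: the quotients converge off the null set [B t] and are bounded by the
    Lipschitz constant [L * V]. *)
Let phi_derive (t : R) : 0 < t < 1 -> is_derive t (1 : R) phi (Psi t).
Proof.
move=> t01; have /andP[t0 t1] := t01.
have t01' : 0 <= t <= 1 by rewrite !ltW.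
suff C : (fun h : R => h^-1 *: ((phi \o shift t) (h *: 1) - phi t)) @ 0^' --> Psi t.
  by apply: DeriveDef; [apply/cvg_ex; exists (Psi t)|exact: cvg_lim C].
apply/cvgr_dnbhsP => h [h0 hh].
pose q n u := (f (y (clamp (t + h n)) u) - f (y (clamp t) u)) / h n.
have iq n : mu.-integrable Q (EFin \o q n).
  have := integrableZr mQ (h n)^-1 (integrableB mQ (int_phi (t + h n)) (int_phi t)).
  by apply: eq_integrable.
have qE n : (h n)^-1 *: ((phi \o shift t) (h n *: 1) - phi t) =
    fine (\int[mu]_(u in Q `\` B t) (q n u)%:E).
  rewrite /shift/= /GRing.scale/= mulr1 (addrC (h n)).
  rewrite -(integral_setD_null _ _ (mB t) (B_null t01')).
  rewrite -[RHS]/(\int[mu]_(u in Q) q n u) /q RintegralZr//; last first.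
    exact: integrableB (int_phi _) (int_phi _).
  by rewrite mulrC RintegralB//; exact: int_phi.
rewrite (_ : (fun n => _) = fine \o (fun n => \int[mu]_(u in Q `\` B t) (q n u)%:E)%E); last first.
  by apply/funext => n /=; exact: qE.
apply: fine_cvg.
have -> : (Psi t)%:E = (\int[mu]_(u in Q `\` B t) (psi t u)%:E)%E.
  by rewrite /Psi /Rintegral fineK//; apply: integrable_fin_num => //; exact: psi_integrable.
apply: (@dominated_cvg _ _ _ mu _ (mD t) (fun n u => (q n u)%:E) _ (fun=> (L * V)%:E)).
- move=> n; have mq : measurable_fun Q (EFin \o q n) := measurable_int mu (iq n).
  exact: (measurable_funS mQ (@subDsetl _ Q (B t)) mq).
- move=> u Du; apply/fine_cvgP; split; first by near=> n.
  exact: (quot_cvg t01 h0 hh Du).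
- by [].
- by apply: (@D_integrable t _ `|L * V|).
- move=> n u [Qu _]; rewrite lee_fin /q normrM normfV ler_pdivrMr ?normr_gt0//.
  apply: le_trans (lip _ _ Qu) _.
  by rewrite addrC addKr.
Unshelve. all: by end_near. Qed.

(** The Lipschitz constant [L] depends on the mesh but serves only for continuity and domination.
    After the mean value theorem only the Dirichlet energy remains in the bound. *)
Lemma moving_cube : `|cube_mean f x1 r1 - cube_mean f x0 r0| <=
  V * (Num.sqrt (rho ^- d) * G).
Proof.
have c01 : 0 <= (0 : R) <= 1 by rewrite lexx ler01.
have c11 : 0 <= (1 : R) <= 1 by rewrite ler01 lexx.
have -> : cube_mean f x1 r1 = phi 1.
  rewrite /phi (clampE c11) /X /r scale1r mul1r (addrC x0) (addrC r0) !subrK.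
  by [].
have -> : cube_mean f x0 r0 = phi 0.
  by rewrite /phi (clampE c01) /X /r scale0r mul0r !addr0.
have D1 (x : R) : x \in `]0, 1[ -> is_derive x (1 : R) phi (Psi x).
  by rewrite in_itv/=; exact: phi_derive.
have C1 : {within `[0, 1], continuous phi}.
  apply: continuous_subspaceT => t; apply/cvgrPdist_lt => e e0.
  have LV : 0 <= L * V by rewrite mulr_ge0// ltW.
  have LV1 : 0 < L * V + 1 by rewrite ltr_wpDl.
  near=> s; apply: le_lt_trans (phi_lip _ _) _.
  apply: (@le_lt_trans _ _ ((L * V + 1) * `|t - s|)); first by rewrite ler_wpM2r// lerDl.
  rewrite -ltr_pdivlMl// mulrC.
  by near: s; apply: cvgr_dist_lt; [exact: cvg_id|rewrite divr_gt0].
have [t] := MVT ltr01 D1 C1.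
rewrite in_itv/= subr0 mulr1 => /andP[t0 t1] ->.
by apply: Psi_le; rewrite !ltW.
Unshelve. all: by end_near. Qed.

End moving_cubes.

(** * Linking cubes uniformly in the mesh *)

Section linked_cubes.
Context {R : realType} {d : nat}.
Variable Om : set 'rV[R]_d.
Hypothesis d_gt0 : (0 < d)%N.
Hypothesis domOm : polytopal_lipschitz_domain Om.

Notation Q := (@unit_cube R d).
Implicit Types (x y z : 'rV[R]_d) (r : R) (A : set 'rV[R]_d).

(** The mesh is existentially quantified, so a constant valid for all these pairs is uniform over
    meshes. [G] is positive because the Young inequality for moving cubes divides by it. *)
Definition fe_energy_le (f : 'rV[R]_d -> R) (G : R) : Prop :=
  [/\ 0 < G, dirichlet_energy Om f <= G ^+ 2 &
      exists2 M : mesh R d, simplicial_mesh Om M & pwaff M f].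

Definition segment_closed A :=
  forall p q (t : R), A p -> A q -> 0 <= t <= 1 -> A (p + t *: (q - p)).

Lemma moving_cube_fe f G x0 x1 r0 r1 rho V : fe_energy_le f G ->
  0 < rho -> rho <= r0 -> rho <= r1 ->
  (forall t u, 0 <= t <= 1 -> Q u ->
     closure Om (hom (x0 + t *: (x1 - x0)) (r0 + t * (r1 - r0)) u)) ->
  (forall u, Q u -> enorm ((x1 - x0) + (r1 - r0) *: u) <= V) -> 0 < V ->
  `|cube_mean f x1 r1 - cube_mean f x0 r0| <= V * (Num.sqrt (rho ^- d) * G).
Proof.
move=> [G0 fG [M meshM pf]] rho0 r0_ge r1_ge incl v_le V0.
have [a [b fE]] := pwaff_coef pf.
apply: (moving_cube d_gt0 meshM domOm fE (L := \sum_(K in cells M) enorm (a K))) => //.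
  by apply: sumr_ge0 => K _; exact: enorm_ge0.
move=> K KM; rewrite (bigD1 K)//= lerDl; apply: sumr_ge0 => L _; exact: enorm_ge0.
Qed.

Lemma hom_in_cube x r u : 0 < r -> Q u -> cube x r (hom x r u).
Proof. by move=> r0; rewrite -(hom_cube x r0). Qed.

Lemma enorm_unit_cube u : Q u -> enorm u <= d%:R.
Proof.
move=> Qu; rewrite -[leRHS]mulr1; apply: enorm_le_coord => // i.
by have /andP[u0 u1] := Qu i; rewrite ger0_norm.
Qed.

(** [C] is chosen before [f] and [G], hence before the mesh; along a chain of links the constants
    add up. *)
Definition linked x r y r' := exists2 C : R, 0 <= C &
  forall f G, fe_energy_le f G -> `|cube_mean f x r - cube_mean f y r'| <= C * G.

Lemma linked_sym x r y r' : linked x r y r' -> linked y r' x r.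
Proof. by move=> [C C0 CP]; exists C => // f G fG; rewrite distrC; exact: CP. Qed.

Lemma linked_trans y r' x r z r'' :
  linked x r y r' -> linked y r' z r'' -> linked x r z r''.
Proof.
move=> [C C0 CP] [C' C'0 CP']; exists (C + C'); first exact: addr_ge0.
move=> f G fG; rewrite mulrDl; apply: le_trans (lerD (CP _ _ fG) (CP' _ _ fG)).
exact: ler_distD.
Qed.

(** Affine interpolation between the two cubes moves each point along a segment inside [A]. *)
Lemma linked_convex A x r y r' : segment_closed A -> A `<=` closure Om ->
  0 < r -> 0 < r' -> cube x r `<=` A -> cube y r' `<=` A -> linked x r y r'.
Proof.
move=> cA AO r0 r0' xA yA; apply: linked_sym.
pose rho := Num.min r r'; pose V := enorm (y - x) + `|r' - r| * d%:R + 1.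
have rho0 : 0 < rho by rewrite lt_min r0.
have V0 : 0 < V by rewrite ltr_wpDl// addr_ge0 ?enorm_ge0// mulr_ge0.
exists (V * Num.sqrt (rho ^- d)); first by rewrite mulr_ge0 ?sqrtr_ge0// ltW.
move=> f G fG; rewrite -mulrA; apply: (moving_cube_fe fG rho0) => //.
- by rewrite ge_min lexx.
- by rewrite ge_min lexx orbT.
- move=> t u t01 Qu; apply: AO.
  have := cA _ _ t (xA _ (hom_in_cube x r0 Qu)) (yA _ (hom_in_cube y r0' Qu)) t01.
  by congr A; apply/rowP => i; rewrite /hom !mxE; ring.
- move=> u Qu; apply: le_trans (enormD _ _) _; rewrite enormZ /V -addrA lerD2l.
  rewrite -[leLHS]addr0 lerD// ler_wpM2l//; exact: enorm_unit_cube.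
Qed.

Definition box z (e : R) : set 'rV[R]_d := [set w | forall i, `|w 0 i - z 0 i| < e].

Lemma nbhs_box z e : 0 < e -> nbhs z (box z e).
Proof.
move=> e0; apply: filterS (nbhs_enorm z e0) => w /= wz i.
by apply: le_lt_trans wz; have := entry_le_enorm (w - z) 0 i; rewrite !mxE.
Qed.

Lemma segment_closed_box z e : segment_closed (box z e).
Proof.
move=> p q t pz qz /andP[t0 t1] i; have := pz i; have := qz i.
rewrite !mxE !ltr_norml => /andP[q1 q2] /andP[p1 p2].
have [->|t1'] := eqVneq t 1; first by apply/andP; split; lra.
have {}t1' : t < 1 by rewrite lt_neqAle t1' t1.
by apply/andP; split; nra.
Qed.

Lemma segment_closed_cube x r : segment_closed (cube x r).
Proof.
move=> p q t px qx /andP[t0 t1] i; have /andP[p1 p2] := px i; have /andP[q1 q2] := qx i.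
by rewrite !mxE; apply/andP; split; nra.
Qed.

Lemma cube_box z w e : 0 < e -> box z (e / 2) w -> cube w (e / 4) `<=` box z e.
Proof.
move=> e0 wz y yw i; have := wz i; have /andP[h1 h2] := yw i.
by rewrite !ltr_norml => /andP[h3 h4]; apply/andP; split; lra.
Qed.

Lemma open_box z : Om z -> exists2 e : R, 0 < e & box z e `<=` Om.
Proof.
by move=> Oz; have [e e0 eO] := nbhs_coord (open_nbhs_nbhs (conj (dom_open domOm) Oz)); exists e.
Qed.

Lemma linked_same x r r' : 0 < r -> 0 < r' -> cube x r `<=` Om -> cube x r' `<=` Om ->
  linked x r x r'.
Proof.
wlog rr : r r' / r <= r'.
  move=> h r0 r0' xr xr'; have [rr|/ltW rr] := leP r r'; first exact: h.
  by apply: linked_sym; exact: h.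
move=> r0 r0' xr xr'; apply: (@linked_convex (cube x r')) => //.
- exact: segment_closed_cube.
- by move=> y /xr' /subset_closure.
- by move=> y yx i; have /andP[h1 h2] := yx i; rewrite h1 (le_trans h2)// lerD2l.
Qed.

(* Cubes around any two points of the connected set [Om] are linked: the set of
   points linked to a given one is open, and so is its complement in [Om]. *)
Lemma linked_connected x r y r' : 0 < r -> 0 < r' ->
  cube x r `<=` Om -> cube y r' `<=` Om -> linked x r y r'.
Proof.
move=> r0 r0' xr yr'.
have cube_corner w s : 0 < s -> cube w s w by move=> s0 i; rewrite lexx lerDl ltW.
pose B := [set w | Om w /\ exists2 s, 0 < s & cube w s `<=` Om /\ linked x r w s].
(* The cubes of side [e / 4] at [z] and at [w] both lie in the convex box of radius [e], hence are
   linked there. *)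
have step z e w : 0 < e -> box z e `<=` Om -> box z (e / 2) w -> B z <-> B w.
  move=> e0 eO wz.
  have zz : box z (e / 2) z by move=> i; rewrite subrr normr0 divr_gt0.
  have e4 : 0 < e / 4 by rewrite divr_gt0.
  have cz := cube_box e0 zz; have cw := cube_box e0 wz.
  have lzw : linked z (e / 4) w (e / 4).
    apply: (@linked_convex (box z e)) => //; first exact: segment_closed_box.
    by move=> p /eO; exact: subset_closure.
  split => -[Op [s s0 [ps ls]]]; split;
    [|exists (e / 4) => //; split| |exists (e / 4) => //; split].
  - by apply/eO/cw/cube_corner.
  - by move=> p /cw/eO.
  - apply: linked_trans ls _; apply: linked_trans lzw; apply: linked_same => //.
    by move=> p /cz/eO.
  - by apply/eO/cz/cube_corner.
  - by move=> p /cz/eO.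
  - apply: linked_trans ls _; apply: linked_trans (linked_sym lzw).
    by apply: linked_same => // p /cw/eO.
have oB : open B.
  rewrite openE => z Bz; have [e e0 eO] := open_box Bz.1.
  have e2 : 0 < e / 2 by rewrite divr_gt0.
  apply: filterS (nbhs_box z e2) => w wz; exact: (step z e w e0 eO wz).1 Bz.
have oOB : open (Om `\` B).
  rewrite openE => z [Oz nBz]; have [e e0 eO] := open_box Oz.
  have e2 : 0 < e / 2 by rewrite divr_gt0.
  apply: filterS (nbhs_box z e2) => w wz; split.
    by apply: eO => i; apply: lt_trans (wz i) _; rewrite ltr_pdivrMr// ltr_pMr// ltr1n.
  by move=> Bw; apply: nBz; exact: (step z e w e0 eO wz).2 Bw.
have Bx : B x.
  split; first exact/xr/cube_corner.
  exists r => //; split => //; exact: linked_same.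
have BO : B = Om.
  apply: (dom_connected domOm).
  - by exists x.
  - by exists B => //; rewrite setIidr// => w [].
  - exists (~` (Om `\` B)); first exact: open_closedC.
    apply/seteqP; split => w; first by move=> Bw; split; [exact: Bw.1|case].
    by move=> [Ow nw]; apply: contrapT => nB; apply: nw.
have : B y by rewrite BO; exact/yr'/cube_corner.
move=> [_ [s s0 [ys ls]]]; apply: linked_trans ls _; exact: linked_same.
Qed.

End linked_cubes.

(** * Cubes shrinking dyadically towards a vertex *)

Section cone.
Context {R : realType} {d : nat}.
Variables (Om : set 'rV[R]_d) (M : mesh R d) (sigma : R) (e : nat).
(** Turns [h^(2-d)] into [h^-e] with a natural exponent. *)
Hypothesis dE : d = e.+2.
Hypothesis meshM : simplicial_mesh Om M.
Hypothesis domOm : polytopal_lipschitz_domain Om.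
Hypothesis sigma_gt0 : 0 < sigma.
Hypothesis shapeM : shape_regular sigma M.

Notation Q := (@unit_cube R d).
Notation hm := (hmin M).

Variables (A : set 'rV[R]_d) (xT z : 'rV[R]_d) (aT D : R).
Hypothesis A_conv : segment_closed A.
Hypothesis AO : A `<=` closure Om.
Hypothesis zA : A z.
Hypothesis aT_gt0 : 0 < aT.
Hypothesis cubeA : cube xT aT `<=` A.
Hypothesis D_gt0 : 0 < D.
Hypothesis D_ge : forall p q, A p -> A q -> enorm (p - q) <= D.

Variables (f : 'rV[R]_d -> R) (G : R).
Hypothesis pf : pwaff M f.
Hypothesis G_gt0 : 0 < G.
Hypothesis fG : dirichlet_energy Om f <= G ^+ 2.

Let d_gt0 : (0 < d)%N. Proof. by rewrite dE. Qed.

Let expdE (x : R) : x ^+ d = x ^+ e * x ^+ 2.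
Proof. by rewrite -exprD addn2 -dE. Qed.

Let feG : fe_energy_le Om f G. Proof. by split => //; exists M. Qed.

(** Corner of the reference cube contracted towards [z] with ratio [s]; the contracted cube stays in
    the convex set [A]. *)
Let xs s : 'rV[R]_d := z + s *: (xT - z).

Let xsE s u : hom (xs s) (s * aT) u = z + s *: (hom xT aT u - z).
Proof. by apply/rowP => i; rewrite /xs /hom !mxE; ring. Qed.

Let xsA s u : 0 <= s <= 1 -> Q u -> A (hom (xs s) (s * aT) u).
Proof. by move=> s01 Qu; rewrite xsE; apply: A_conv => //; apply/cubeA/hom_in_cube. Qed.

(** Between the ratios [s / 2] and [s] a point [p] of the reference cube moves by [(s / 2) (p - z)],
    and the smaller of the two sides is [s / 2 * aT]. *)
Lemma cone_step s : 0 < s <= 1 ->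
  `|cube_mean f (xs s) (s * aT) - cube_mean f (xs (s / 2)) (s / 2 * aT)| <=
  (s / 2 * D) * (Num.sqrt ((s / 2 * aT) ^- d) * G).
Proof.
move=> /andP[s0 s1]; have s20 : 0 < s / 2 by rewrite divr_gt0.
apply: (moving_cube_fe d_gt0 domOm feG).
- exact: mulr_gt0.
- by [].
- by rewrite ler_pM2r//; lra.
- move=> t u /andP[t0 t1] Qu; apply: AO.
  have -> : hom (xs (s / 2) + t *: (xs s - xs (s / 2)))
      (s / 2 * aT + t * (s * aT - s / 2 * aT)) u =
      hom (xs (s / 2 + t * (s / 2))) ((s / 2 + t * (s / 2)) * aT) u.
    by apply/rowP => i; rewrite /hom /xs !mxE; field.
  by apply: xsA => //; apply/andP; split; nra.
- move=> u Qu.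
  have -> : xs s - xs (s / 2) + (s * aT - s / 2 * aT) *: u = (s / 2) *: (hom xT aT u - z).
    by apply/rowP => i; rewrite /hom /xs !mxE; field.
  rewrite enormZ gtr0_norm// ler_pM2l//; apply: D_ge => //.
  exact/cubeA/hom_in_cube.
- exact: mulr_gt0.
Qed.

(** From [(s / 2)^2 (s / 2 * aT)^-d = 2^e aT^-d s^-e], where [s^-e] is then replaced by its upper
    bound [hmin^-e]. *)
Definition cone_cst : R := D * Num.sqrt (2 ^+ e * aT ^- d).

Lemma cone_step_le s : 0 < s <= 1 -> hm <= s ->
  `|cube_mean f (xs s) (s * aT) - cube_mean f (xs (s / 2)) (s / 2 * aT)| <=
  cone_cst * (Num.sqrt (hm ^- e) * G).
Proof.
move=> s01 hs; have hm0 := hmin_gt0 d_gt0 meshM domOm.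
have /andP[s0 s1] := s01; have s20 : 0 < s / 2 by rewrite divr_gt0.
apply: le_trans (cone_step s01) _.
rewrite mulrA [leRHS]mulrA ler_pM2r// (mulrC _ D) -(mulrA D) /cone_cst -[leRHS]mulrA.
rewrite ler_pM2l//.
have -> (w : R) : s / 2 * Num.sqrt w = Num.sqrt ((s / 2) ^+ 2 * w).
  by rewrite sqrtrM ?sqr_ge0// sqrtr_sqr gtr0_norm.
have c0 : 0 <= 2 ^+ e * aT ^- d by rewrite mulr_ge0 ?exprn_ge0// invr_ge0 exprn_ge0// ltW.
rewrite -sqrtrM// ler_wsqrtr//.
have -> : (s / 2) ^+ 2 * (s / 2 * aT) ^- d = 2 ^+ e * aT ^- d * s ^- e.
  have [Ps PA PT] : [/\ s ^+ e != 0, aT ^+ e != 0 & (2 : R) ^+ e != 0].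
    by rewrite !expf_neq0// gt_eqF.
  rewrite !expdE !exprMn !exprVn.
  move: Ps PA PT; move: (s ^+ e) (aT ^+ e) (2 ^+ e) => S B T Ps PA PT.
  by field; rewrite Ps PA PT !gt_eqF.
rewrite ler_wpM2l//.
by rewrite lef_pV2 ?posrE ?exprn_gt0// lerXn2r// nnegrE ltW.
Qed.

Lemma cone_sum N : (forall k, (k < N)%N -> hm <= 2 ^- k) ->
  `|cube_mean f xT aT - cube_mean f (xs (2 ^- N)) (2 ^- N * aT)| <=
  N%:R * (cone_cst * (Num.sqrt (hm ^- e) * G)).
Proof.
elim: N => [|N IH] hk.
  rewrite expr0 invr1 mul1r /xs scale1r (addrC z) subrK subrr normr0.
  by rewrite mul0r.
have {}IH : _ := IH (fun k kN => hk k (ltnW kN)).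
have -> : N.+1%:R = N%:R + 1 :> R by rewrite natr1.
rewrite mulrDl mul1r.
have s01 : 0 < (2 ^- N : R) <= 1.
  by rewrite invr_gt0 exprn_gt0//= invf_le1 ?exprn_gt0// exprn_ege1// ler1n.
have := cone_step_le s01 (hk N (ltnSn N)).
have -> : (2 ^- N : R) / 2 = 2 ^- N.+1 by rewrite exprSr invfM.
move=> h; apply: le_trans (lerD IH h).
exact: ler_distD.
Qed.

(** At this scale every point of the cube is within [hmin * D] of [z], and the inverse estimate
    makes [f] Lipschitz with a constant of order [hmin^(-d/2) G]; the product is of order
    [hmin^(-e/2) G]. *)
Lemma cone_end N : 2 ^- N <= hm ->
  `|f z - cube_mean f (xs (2 ^- N)) (2 ^- N * aT)| <=
  D * Num.sqrt ((4 * sigma * d%:R) ^+ d) * (Num.sqrt (hm ^- e) * G).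
Proof.
move=> Nhm; have hm0 := hmin_gt0 d_gt0 meshM domOm.
have [a [b fE]] := pwaff_coef pf.
pose s : R := 2 ^- N; have s0 : 0 < s by rewrite invr_gt0 exprn_gt0.
have s1 : s <= 1 by rewrite invf_le1 ?exprn_gt0// exprn_ege1// ler1n.
have s01 : 0 <= s <= 1 by rewrite s1 ltW.
pose Cg : R := (4 * sigma * d%:R) ^+ d.
have Cg0 : 0 <= Cg by rewrite exprn_ge0// !mulr_ge0// ltW.
pose L := Num.sqrt (Cg * hm ^- d) * G.
have hd0 : 0 <= hm ^- d by rewrite invr_ge0 exprn_ge0// ltW.
have L0 : 0 <= L by rewrite mulr_ge0 ?sqrtr_ge0// ltW.
have aL K : K \in cells M -> enorm (a K) <= L.
  move=> KM; rewrite -(@ler_pXn2r _ 2)// ?nnegrE ?enorm_ge0// sqr_enorm exprMn.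
  rewrite sqr_sqrtr ?mulr_ge0//.
  apply: le_trans (cell_gradient_bound d_gt0 meshM domOm sigma_gt0 shapeM pf KM
    (fun w => fE K w KM)) _.
  by rewrite ler_wpM2l// mulr_ge0.
have int1 : (lebesgue_rV d).-integrable Q (EFin \o (f \o hom (xs s) (s * aT))).
  apply: (cube_integrable meshM fE) => u Qu; apply: AO; exact: xsA.
have mQ := @measurable_unit_cube R d.
have intc c : (lebesgue_rV d).-integrable Q (EFin \o (fun=> c : R)).
  apply: measurable_bounded_integrable => //.
    by rewrite lebesgue_unit_cube ltry.
  by exists `|c|; split; [exact: num_real|move=> w cw v _; exact: ltW].
have -> : f z = \int[lebesgue_rV d]_(u in Q) f z.
  by rewrite Rintegral_cst// lebesgue_unit_cube mulr1.
rewrite /cube_mean -/s -RintegralB//.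
apply: (@le_trans _ _ (\int[lebesgue_rV d]_(u in Q) (L * (s * D)))).
  have iB := integrableB mQ (intc (f z)) int1.
  apply: le_trans (le_normr_Rintegral mQ iB) _.
  apply: le_Rintegral => //; first exact: integrable_norm.
  move=> u Qu; rewrite distrC /=.
  have h1 : `|f (hom (xs s) (s * aT) u) - f z| <= L * enorm (hom (xs s) (s * aT) u - z).
    apply: (pwaff_lipschitz meshM L0 _ aL) => [K w KM|t t01]; first exact: fE.
    apply: AO; apply: A_conv => //; exact: xsA.
  apply: le_trans h1 _.
  rewrite ler_wpM2l// xsE addrC addKr enormZ gtr0_norm// ler_pM2l//.
  by apply: D_ge => //; exact/cubeA/hom_in_cube.
rewrite Rintegral_cst// lebesgue_unit_cube mulr1.
rewrite (_ : L * (s * D) = D * (s * Num.sqrt (Cg * hm ^- d)) * G); last by rewrite /L; ring.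
rewrite [leRHS]mulrA ler_pM2r// -mulrA ler_pM2l//.
apply: (@le_trans _ _ (hm * Num.sqrt (Cg * hm ^- d))).
  by rewrite ler_wpM2r// sqrtr_ge0.
have -> (w : R) : hm * Num.sqrt w = Num.sqrt (hm ^+ 2 * w).
  by rewrite sqrtrM ?sqr_ge0// sqrtr_sqr gtr0_norm.
rewrite -sqrtrM// ler_wsqrtr// mulrCA ler_wpM2l// expdE.
have he : hm ^+ e != 0 by rewrite expf_neq0// gt_eqF.
rewrite le_eqVlt; apply/orP; left; apply/eqP; move: he; move: (hm ^+ e) => H he.
by field; rewrite he gt_eqF.
Qed.

Lemma cone_bound N : 2 ^- N <= hm -> (forall k, (k < N)%N -> hm <= 2 ^- k) ->
  `|f z - cube_mean f xT aT| <=
  (N%:R * cone_cst + D * Num.sqrt ((4 * sigma * d%:R) ^+ d)) * (Num.sqrt (hm ^- e) * G).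
Proof.
move=> h1 h2; rewrite mulrDl [leRHS]addrC -(mulrA N%:R).
apply: le_trans (lerD (cone_end h1) (cone_sum h2)).
by rewrite (distrC (cube_mean f xT aT)) ler_distD.
Qed.

End cone.

(** * Assembly over a fixed simplicial cover *)

Section discrete_sobolev.
Context {R : realType} {d : nat}.
Variables (Om : set 'rV[R]_d) (e : nat).
Hypothesis dE : d = e.+2.
Hypothesis domOm : polytopal_lipschitz_domain Om.

Let d_gt0 : (0 < d)%N. Proof. by rewrite dE. Qed.

Lemma segment_closed_hull (T : finType) (p : T -> 'rV[R]_d) (A : {set T}) :
  segment_closed (hull p A).
Proof.
move=> _ _ t [l [l0 lA l1 <-]] [k [k0 kA k1 <-]] /andP[t0 t1].
exists (fun i => l i + t * (k i - l i)); split.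
- move=> i; have := l0 i; have := k0 i; move: (l i) (k i) => x y x0 y0.
  rewrite (_ : _ + _ = (1 - t) * x + t * y); last by ring.
  by rewrite addr_ge0// mulr_ge0// subr_ge0.
- by move=> i iA; rewrite lA// kA// subrr mulr0 addr0.
- by rewrite big_split/= -mulr_sumr sumrB l1 k1 subrr mulr0 addr0.
- rewrite -sumrB scaler_sumr -big_split; apply: eq_bigr => i _ /=.
  by rewrite scalerDl -scalerA scalerBl.
Qed.

(** At the barycentre all barycentric coordinates equal [1 / (d + 1)], so it is an interior
    point. *)
Lemma hull_box (T : finType) (p : T -> 'rV[R]_d) (A : {set T}) :
  #|A| = d.+1 -> affinely_independent p A ->
  exists x : 'rV[R]_d, exists2 r : R, 0 < r & box x r `<=` hull p A.
Proof.
move=> cA ind; have [a [b [h1 h2 h3]]] := affine_independent_dual cA ind.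
pose l (i : T) : R := if i \in A then d.+1%:R^-1 else 0.
pose x := \sum_i l i *: p i.
have l1 : \sum_i l i = 1.
  by rewrite -big_mkcond/= sumr_const cA -[LHS]mulr_natr mulVf ?pnatr_eq0.
have lE : l = fun i => aff (a i) (b i) x.
  apply: (barycentric_unique ind).
  - by move=> i iA; rewrite /l (negPf iA).
  - by move=> i iA; rewrite h1.
  - by rewrite l1 h2.
  - by rewrite h3.
have xpos i : i \in A -> 0 < aff (a i) (b i) x.
  by move=> iA; rewrite -[X in 0 < X]/((fun i => aff (a i) (b i) x) i) -lE /l iA invr_gt0.
have [r r0 rP] := nbhs_coord (nbhs_aff_pos xpos).
exists x, r => // y /rP yP; exists (fun i => aff (a i) (b i) y); split => //.
  by move=> i; have [/yP//|iA] := boolP (i \in A); rewrite h1.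
by move=> i iA; rewrite h1.
Qed.

(** The covering simplices lie only in the closure, while linking by connectedness needs cubes in
    the open set [Om]; density of [Om] in its closure provides a suitable corner near [x]. *)
Lemma cube_in_simplex (A : set 'rV[R]_d) x r : 0 < r -> box x r `<=` A ->
  A `<=` closure Om ->
  exists y : 'rV[R]_d, exists2 s : R, 0 < s & cube y s `<=` A /\ cube y s `<=` Om.
Proof.
move=> r0 xA AO; have xx : box x r x by move=> i; rewrite subrr normr0.
have r2 : 0 < r / 2 by rewrite divr_gt0.
have [y [Oy yx]] := AO _ (xA _ xx) _ (nbhs_box x r2).
have [r1 r10 r1O] := open_box domOm Oy.
pose s := Num.min (r / 2) r1.
have s0 : 0 < s by rewrite lt_min r2.
have yy : box y (s / 2) y by move=> i; rewrite subrr normr0 divr_gt0.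
have s4 : 0 < s / 4 by rewrite divr_gt0.
have cs := cube_box s0 yy.
have [s1 s2] : s <= r / 2 /\ s <= r1 by split; rewrite ge_min lexx ?orbT.
exists y, (s / 4) => //; split => w /cs ws.
- apply: xA => i; have := ws i; have := yx i; rewrite !ltr_norml.
  by move=> /andP[? ?] /andP[? ?]; apply/andP; split; lra.
- by apply: r1O => i; apply: lt_le_trans (ws i) s2.
Qed.

(** [N] is the least exponent with [2^-N <= h]. By minimality [2^-(N-1)] still exceeds [h] if
    [N > 0], which gives the logarithmic bound with the extra 1. *)
Lemma dyadic_scale (h : R) : 0 < h -> exists N : nat,
  [/\ 2 ^- N <= h, forall k, (k < N)%N -> h <= 2 ^- k &
      N%:R <= 1 + `|ln h| / ln 2].
Proof.
move=> h0.
have ex : exists N, (2 ^- N : R) <= h.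
  exists (Num.bound h^-1); rewrite -[leRHS]invrK lef_pV2 ?posrE ?exprn_gt0 ?invr_gt0//.
  have hb : h^-1 < (Num.bound h^-1)%:R by apply: archi_boundP; rewrite invr_ge0 ltW.
  by rewrite (le_trans (ltW hb))// -natrX ler_nat ltnW// ltn_expl.
have [N hN minN] := ex_minnP ex; exists N; split => //.
  by move=> k kN; rewrite leNgt; apply/negP => /ltW/minN; rewrite leqNgt kN.
have ln2 : 0 < ln (2 : R) by rewrite ln_gt0// ltr1n.
case: N hN minN => [|N] hN minN; first by rewrite addr_ge0// divr_ge0// ltW.
rewrite -natr1 addrC lerD2l ler_pdivlMr//.
have hlt : h < 2 ^- N by rewrite ltNge; apply/negP => /minN; rewrite ltnn.
have : ln h < ln (2 ^- N) by rewrite ltr_ln ?posrE// invr_gt0 exprn_gt0.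
rewrite lnV ?posrE ?exprn_gt0// lnXn// -mulr_natl => hl.
rewrite -normrN; apply: le_trans (ler_norm _); lra.
Qed.

Lemma discrete_sobolev (sigma lambda0 : R) : 0 < sigma -> 0 < lambda0 ->
  exists2 c : R, 0 < c & forall (M : mesh R d) f,
    simplicial_mesh Om M -> shape_regular sigma M -> pwaff M f ->
    lambda0 <= `|ln (hmin M)| ->
    forall i0 i, f (@vtx _ _ M i0) = 0 ->
    f (@vtx _ _ M i) ^+ 2 <=
    c * (hmin M ^- e * `|ln (hmin M)| ^+ 2) * dirichlet_energy Om f.
Proof.
move=> sigma0 lambda00.
have [np [p [S [indS covS]]]] := dom_polytopal domOm.
(* The cover need not be conforming; it is packed as a mesh only to reuse [mesh_bound]. *)
pose MS : mesh R d := Mesh p S.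
have hullO T : T \in S -> hull p T `<=` closure Om.
  by move=> TS x Tx; rewrite covS; exists T.
pose D : R := d%:R * (2 * mesh_bound MS) + 1.
have D0 : 0 < D by rewrite ltr_wpDl// mulr_ge0// mulr_ge0// mesh_bound_ge0.
have Dge x y : closure Om x -> closure Om y -> enorm (x - y) <= D.
  rewrite covS => -[T _ Tx] [T' _ Ty]; apply: le_trans (_ : d%:R * (2 * mesh_bound MS) <= _).
    apply: enorm_le_coord => [|i]; first by rewrite mulr_ge0// mesh_bound_ge0.
    rewrite !mxE (le_trans (ler_normB _ _))// mulr2n mulrDl mul1r.
    by apply: lerD; [exact: (@cell_bounded _ _ MS T)|exact: (@cell_bounded _ _ MS T')].
  by rewrite lerDl.
have /choice[xr xrP] : forall T : {set 'I_np}, exists xr : 'rV[R]_d * R, T \in S ->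
    [/\ 0 < xr.2, cube xr.1 xr.2 `<=` hull p T & cube xr.1 xr.2 `<=` Om].
  move=> T; have [TS|/negP nTS] := boolP (T \in S); last by exists (0, 0).
  have [cT indT] := indS _ TS; have [x [r r0 xT]] := hull_box cT indT.
  have [y [s s0 [h1 h2]]] := cube_in_simplex r0 xT (hullO _ TS).
  by exists (y, s).
(* One constant for each pair of reference cubes; there are finitely many pairs, and the mesh is not
   yet chosen. *)
have /choice[Cl ClP] : forall TT : {set 'I_np} * {set 'I_np}, exists C : R, 0 <= C /\
    (TT.1 \in S -> TT.2 \in S -> forall f G, fe_energy_le Om f G ->
      `|cube_mean f (xr TT.1).1 (xr TT.1).2 - cube_mean f (xr TT.2).1 (xr TT.2).2| <= C * G).
  move=> [T T'] /=; have [TS|/negP nTS] := boolP (T \in S); last by exists 0.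
  have [T'S|/negP nTS] := boolP (T' \in S); last by exists 0.
  have [r0 _ cO] := xrP _ TS; have [r0' _ cO'] := xrP _ T'S.
  by have [C C0 CP] := linked_connected d_gt0 domOm r0 r0' cO cO'; exists C.
pose A1 : R := \sum_(T in S) cone_cst (d := d) e (xr T).2 D.
pose A2 : R := D * Num.sqrt ((4 * sigma * d%:R) ^+ d).
(* Since [hmin <= D], the factor [sqrt (D^e)] turns a constant into a multiple of [hmin^(-e/2)]. *)
pose A3 : R := (\sum_TT Cl TT) * Num.sqrt (D ^+ e).
have cone0 T : 0 <= cone_cst (d := d) e (xr T).2 D by rewrite mulr_ge0 ?sqrtr_ge0// ltW.
have A10 : 0 <= A1 by apply: sumr_ge0.
have A20 : 0 <= A2 by rewrite mulr_ge0 ?sqrtr_ge0// ltW.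
have A30 : 0 <= A3.
  by rewrite mulr_ge0 ?sqrtr_ge0//; apply: sumr_ge0 => TT _; have [] := ClP TT.
have ln2 : 0 < ln (2 : R) by rewrite ln_gt0// ltr1n.
(* The 2 counts the cones at [i] and at [i0]; [1 <= |ln hmin| / lambda0] makes every term a multiple
   of [|ln hmin|], including the 1 in the bound for [N]. *)
pose K0 := 2 * ((lambda0^-1 + (ln 2)^-1) * A1 + A2 / lambda0) + A3 / lambda0.
have K00 : 0 <= K0.
  rewrite addr_ge0 ?divr_ge0 ?(ltW lambda00)// mulr_ge0// addr_ge0//.
    by rewrite mulr_ge0// addr_ge0 ?invr_ge0 ?ltW.
  by rewrite divr_ge0 ?(ltW lambda00).
exists (K0 ^+ 2 + 1); first by rewrite ltr_wpDl ?sqr_ge0.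
move=> M f meshM shapeM pf lamh i0 i f0.
have h0 := hmin_gt0 d_gt0 meshM domOm; set h := hmin M in h0 lamh *.
have [N [N1 N2 N3]] := dyadic_scale h0.
have hD : h <= D.
  have [K KM] := cells_neq0 meshM domOm; apply: le_trans (hmin_le KM) _.
  apply: ge_sup => [|_ [[x y] [/= Kx Ky] <-]].
    have [x Kx] : exists x, cell K x.
      have [cK _] := mesh_simplex meshM KM.
      have /card_gt0P[k kK] : (0 < #|K|)%N by rewrite cK.
      by exists (vtx k); exact: (cell_vtx meshM).
    by exists (enorm (x - x)), (x, x).
  by apply: Dge; apply/(closureP meshM); exists K.
pose H := Num.sqrt (h ^- e).
have he0 : 0 < h ^- e by rewrite invr_gt0 exprn_gt0.
have H0 : 0 < H by rewrite sqrtr_gt0.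
have lnh0 : 0 < `|ln h| := lt_le_trans lambda00 lamh.
have main G : 0 < G -> dirichlet_energy Om f <= G ^+ 2 ->
    `|f (vtx i)| <= K0 * `|ln h| * (H * G).
  move=> G0 fG; have fe : fe_energy_le Om f G by split => //; exists M.
  have cone (j : 'I_(nvtx M)) : exists2 T, T \in S &
      `|f (vtx j) - cube_mean f (xr T).1 (xr T).2| <= (N%:R * A1 + A2) * (H * G).
    have : closure Om (@vtx _ _ M j) by exact: (vtx_closure meshM).
    rewrite covS => -[T TS Tj]; exists T => //.
    have [r0 cT cO] := xrP _ TS.
    apply: le_trans (cone_bound dE meshM domOm sigma0 shapeM (@segment_closed_hull _ p T)
      (hullO _ TS) Tj r0 cT D0 (fun x y Tx Ty => Dge _ _ (hullO _ TS _ Tx) (hullO _ TS _ Ty))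
      pf G0 fG N1 N2) _.
    rewrite ler_pM2r ?mulr_gt0// lerD2r ler_wpM2l// /A1 (bigD1 T)//= lerDl.
    by apply: sumr_ge0.
  have [T TS fT] := cone i; have [T' T'S fT'] := cone i0.
  have [C0 CP] := ClP (T, T'); have {}CP := CP TS T'S _ _ fe.
  have G_le : Cl (T, T') * G <= A3 * (H * G).
    rewrite mulrA ler_pM2r// /A3 -mulrA -[leLHS]mulr1 ler_pM//.
      by rewrite (bigD1 (T, T'))//= lerDl; apply: sumr_ge0 => TT _; have [] := ClP TT.
    rewrite -sqrtrM ?exprn_ge0 ?(ltW D0)// -sqrtr1 ler_wsqrtr//.
    by rewrite ler_pdivlMr ?exprn_gt0// mul1r lerXn2r// nnegrE ltW.
  have HG : 0 < H * G by rewrite mulr_gt0.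
  have fi : `|f (vtx i)| <= (2 * (N%:R * A1 + A2) + A3) * (H * G).
    rewrite -[f (vtx i)]subr0 -f0.
    apply: le_trans (ler_distD (cube_mean f (xr T).1 (xr T).2) _ _) _.
    have h3 := ler_distD (cube_mean f (xr T').1 (xr T').2)
      (cube_mean f (xr T).1 (xr T).2) (f (vtx i0)).
    rewrite distrC in fT'; have h4 := le_trans CP G_le.
    rewrite /= in h4; rewrite mulrDl mulr_natl mulrnAl mulr2n -addrA; apply: lerD => //.
    by apply: le_trans h3 _; rewrite addrC; exact: lerD.
  apply: le_trans fi _; rewrite ler_pM2r//.
  have l1 : 1 <= `|ln h| / lambda0 by rewrite ler_pdivlMr// mul1r.
  have N4 : N%:R <= (lambda0^-1 + (ln 2)^-1) * `|ln h|.
    apply: le_trans N3 _; rewrite mulrDl (mulrC _^-1) (mulrC _^-1 `|_|) lerD2r.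
    exact: l1.
  have N5 : N%:R * A1 <= (lambda0^-1 + (ln 2)^-1) * `|ln h| * A1 by rewrite ler_wpM2r.
  have B2 : A2 <= `|ln h| / lambda0 * A2 by rewrite ler_peMl.
  have B3 : A3 <= `|ln h| / lambda0 * A3 by rewrite ler_peMl.
  rewrite /K0; move: N5 B2 B3.
  move: (lambda0^-1) ((ln 2)^-1) (`|ln h|) => u v w N5 B2 B3.
  by move: N5 B2 B3; nra.
set W := h ^- e * `|ln h| ^+ 2.
have W0 : 0 <= W by rewrite mulr_ge0 ?sqr_ge0// ltW.
have E0 : 0 <= dirichlet_energy Om f.
  by apply: Rintegral_ge0 => x _; exact: mxdot_ge0.
apply: (@le_trans _ _ (K0 ^+ 2 * W * dirichlet_energy Om f)); last first.
  by rewrite ler_wpM2r// ler_wpM2r// lerDl.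
(* The Dirichlet energy may vanish while [main] requires [G > 0], so [G^2] is taken as the energy
   plus a small [del]. *)
apply/ler_addgt0Pr => eps eps0.
have KW0 : 0 <= K0 ^+ 2 * W by rewrite mulr_ge0// sqr_ge0.
pose del := eps / (K0 ^+ 2 * W + 1).
have KW1 : 0 < K0 ^+ 2 * W + 1 by rewrite ltr_wpDl.
have del0 : 0 < del by rewrite divr_gt0.
have ED : 0 < dirichlet_energy Om f + del by rewrite ltr_wpDl.
have := main (Num.sqrt (dirichlet_energy Om f + del)).
rewrite sqrtr_gt0 sqr_sqrtr ?(ltW ED)// lerDl => /(_ ED (ltW del0)) B.
apply: (@le_trans _ _ (K0 ^+ 2 * W * (dirichlet_energy Om f + del))).
  rewrite -[leLHS]real_normK ?num_real//.
  have -> : K0 ^+ 2 * W * (dirichlet_energy Om f + del) =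
      (K0 * `|ln h| * (H * Num.sqrt (dirichlet_energy Om f + del))) ^+ 2.
    by rewrite !exprMn /H !sqr_sqrtr ?(ltW ED) ?(ltW he0)// /W; ring.
  rewrite lerXn2r// nnegrE; apply: le_trans B; exact: normr_ge0.
rewrite mulrDr lerD2l /del mulrCA ger_pMr// ler_pdivrMr// mul1r lerDl.
exact: ler01.
Qed.

End discrete_sobolev.

(** * The weighted H^1 metric *)

Section weighted_H1_metric.
Context {R : realType} {d : nat}.
Variables (Om : set 'rV[R]_d) (P : problem R d) (M : mesh R d) (alpha : R).
Hypothesis d_gt0 : (0 < d)%N.
Hypothesis meshM : simplicial_mesh Om M.
Hypothesis domOm : polytopal_lipschitz_domain Om.

(** Without such a vertex a nonzero constant field would be admissible, and its gradient vanishes,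
    contradicting definiteness. *)
Lemma dirichlet_vertex : metric_ok Om P M (H1_metric alpha) ->
  exists i, GammaD P (@vtx _ _ M i).
Proof.
move=> [_ definite]; apply: contrapT => /forallNP noD.
pose phi (x : 'rV[R]_d) : 'rV[R]_d := delta_mx 0 (Ordinal d_gt0).
have Vphi : VhD_vec Om (GammaD P) M phi.
  move=> k; split; last by move=> i /noD.
  split; first by move=> x; exact: cvg_cst.
  by move=> K KM; exists 0, (phi 0 0 k) => x _; rewrite mxdot0l add0r.
have sphi : star Om M (H1_metric alpha) phi phi = 0.
  rewrite /= /L2_mx /Rintegral integral0_eq// => x _.
  have -> : mxgrad phi x = 0.
    apply/matrixP => i j; rewrite [LHS]mxE [RHS]mxE.
    rewrite (@derive_aff _ _ _ 0 (phi 0 0 i)) ?mxdot0l//.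
    by apply: (@filterE _ (nbhs x)) => y; rewrite /aff mxdot0l add0r.
  by rewrite mxdotC mxdot0l.
have [x Ox] := dom_nonempty domOm.
have := definite _ Vphi sphi x; rewrite mem_set; last exact: subset_closure.
move=> /(_ isT)/rowP/(_ (Ordinal d_gt0)); rewrite !mxE !eqxx => /eqP.
by rewrite oner_eq0.
Qed.

Lemma star_H1 t : pwaff_vec M t -> star Om M (H1_metric alpha) t t =
  hmax M `^ alpha * \sum_k dirichlet_energy Om (fun x => t x 0 k).
Proof.
move=> pt; rewrite /dirichlet_energy -(Rint_sum d_gt0 meshM domOm); last first.
  by move=> k _; exact: (good_grad_sqr meshM).
rewrite -(Rint_Z d_gt0 meshM domOm); last first.
  by apply: good_sum => k _; exact: (good_grad_sqr meshM).
rewrite /= /L2_mx; apply: eq_Rintegral => x _; rewrite mxdotZl; congr (_ * _).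
apply: eq_bigr => k _; rewrite mxdot_rV; apply: eq_bigr => j _.
by rewrite !mxE.
Qed.

End weighted_H1_metric.

Theorem proposition4p4 (R : realType) (d : nat) (sigma : R)
    (hd : d = 2%N \/ d = 3%N) (hsigma : 0 < sigma) :
  (* L^1 bound on the violation of the unit-length constraint *)
  (forall Cstar : R, 0 < Cstar ->
    exists2 C1 : R, 0 < C1 &
    forall (Omega : set 'rV[R]_d) (P : problem R d) (M : mesh R d)
      (m : metric R) (taun taus tol : R)
      (s : nat -> 'rV[R]_d -> R) (n : nat -> 'rV[R]_d -> 'rV[R]_d),
    algorithm_run Omega P M m taun taus tol sigma s n ->
    (forall phi : 'rV[R]_d -> 'rV[R]_d, VhD_vec Omega (GammaD P) M phi ->
      (Lp_norm Omega 2%:E (fun x => enorm (phi x))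
       <= (Cstar * star_norm Omega M m phi)%:E)%E) ->
    forall j : nat, (1 <= j)%N ->
      (Lp_norm Omega 1%:E (nodal_interp M (fun x => enorm (n j x) ^+ 2 - 1)%R)
       <= (C1 * taun * energy Omega P (s 0%N) (n 0%N))%:E)%E)
  /\
  (* L^oo bound, L^2 metric *)
  (exists2 c : R, 0 < c &
    forall (Omega : set 'rV[R]_d) (P : problem R d) (M : mesh R d)
      (taun taus tol Cup : R)
      (s : nat -> 'rV[R]_d -> R) (n : nat -> 'rV[R]_d -> 'rV[R]_d),
    algorithm_run Omega P M L2_metric taun taus tol sigma s n ->
    0 < Cup ->
    taun * hmin M ^- d <= Cup ->
    forall j : nat, (1 <= j)%N ->
      (Lp_norm Omega +oo%E (fun x => enorm (n j x))
       <= (1 + (c * Cup) * energy Omega P (s 0%N) (n 0%N))%:E)%E)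
  /\
  (* L^oo bound, weighted H^1 metric; the CFL condition is void if hmin = 1,
     hence the lower bound lambda0 for |log hmin| *)
  (forall (Omega : set 'rV[R]_d) (lambda0 : R),
    polytopal_lipschitz_domain Omega -> 0 < lambda0 ->
    exists2 c : R, 0 < c &
    forall (P : problem R d) (M : mesh R d) (alpha taun taus tol Cup : R)
      (s : nat -> 'rV[R]_d -> R) (n : nat -> 'rV[R]_d -> 'rV[R]_d),
    algorithm_run Omega P M (H1_metric alpha) taun taus tol sigma s n ->
    lambda0 <= `|ln (hmin M)| ->
    0 < Cup ->
    taun * hmin M `^ (2 - d%:R - alpha) * `|ln (hmin M)| ^+ 2 <= Cup ->
    forall j : nat, (1 <= j)%N ->
      (Lp_norm Omega +oo%E (fun x => enorm (n j x))
       <= (1 + (c * Cup) * energy Omega P (s 0%N) (n 0%N))%:E)%E).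
Proof.
have [e dE] : exists e, d = e.+2 by case: hd => ->; [exists 0%N|exists 1%N].
have d_gt0 : (0 < d)%N by rewrite dE.
have lc0 := local_cst_gt0 (d := d) d_gt0 hsigma.
split; [|split].
- move=> Cs Cs0; exists (L1_cst (d := d) sigma * Cs ^+ 2).
    by rewrite mulr_gt0 ?exprn_gt0// mulr_gt0// mulr_gt0 ?exprn_gt0 ?ltr0n.
  move=> Om P M m taun taus tol s n run hC j _.
  exact: (L1_bound d_gt0 hsigma run).
- exists (local_cst (d := d) sigma) => // Om P M taun taus tol Cup s n run Cup0 cfl j _.
  have hm0 := hmin_gt0 d_gt0 (run_mesh run) (run_domain run).
  have hd0 : 0 < hmin M ^- d by rewrite invr_gt0 exprn_gt0.
  apply: le_trans (sup_bound d_gt0 run j (C := local_cst (d := d) sigma * hmin M ^- d) _ _) _.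
  + by rewrite mulr_ge0 ?(ltW lc0) ?(ltW hd0).
  + move=> t Vt i; exact: (L2_sup_bound d_gt0 hsigma run i (VhD_vec_pwaff Vt)).
  + rewrite lee_fin lerD2l ler_wpM2r ?(initial_energy_ge0 run)//.
    by rewrite -mulrA ler_pM2l// mulrC.
- move=> Om lambda0 domOm lambda00.
  have [c c0 cP] := discrete_sobolev dE domOm hsigma lambda00.
  exists c => // P M alpha taun taus tol Cup s n run lamh Cup0 cfl j _.
  have meshM := run_mesh run.
  have hm0 := hmin_gt0 d_gt0 meshM domOm.
  have [i0 Gi0] := dirichlet_vertex d_gt0 domOm (run_metric run).
  have al0 : 0 < alpha by have [/andP[]] := run_metric run.
  set W := hmin M ^- e * `|ln (hmin M)| ^+ 2.
  have W0 : 0 <= W by rewrite mulr_ge0 ?sqr_ge0// invr_ge0 exprn_ge0// ltW.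
  have pw : hmin M `^ (2 - d%:R - alpha) = hmin M ^- e * hmin M `^ (- alpha).
    rewrite powRD; last by apply/implyP => _; rewrite gt_eqF.
    congr (_ * _); rewrite (_ : 2 - d%:R = - e%:R); last by rewrite dE -addn2 natrD; ring.
    by rewrite powRN powR_mulrn// ltW.
  apply: le_trans (sup_bound d_gt0 run j (C := c * (W * hmin M `^ (- alpha))) _ _) _.
  + by rewrite mulr_ge0 ?(ltW c0)// mulr_ge0 ?powR_ge0.
  + move=> t Vt i; have pt := VhD_vec_pwaff Vt.
    rewrite (star_H1 alpha d_gt0 meshM domOm pt) mxdot_rV.
    set DE := \sum_k dirichlet_energy _ _.
    have DE0 : 0 <= DE.
      apply: sumr_ge0 => k _; apply: Rintegral_ge0 => x _; exact: mxdot_ge0.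
    apply: (@le_trans _ _ (c * W * DE)).
      rewrite mulr_sumr; apply: ler_sum => k _; rewrite -expr2.
      apply: (cP M (fun x => t x 0 k) meshM (run_shape run) (pt k) lamh i0 i).
      by have [_ ->] := Vt k.
    (* The metric is weighted by [hmax^alpha] whereas the CFL condition involves [hmin^-alpha]; as
       [alpha > 0], their product is at least 1. *)
    have hh : 1 <= hmin M `^ (- alpha) * hmax M `^ alpha.
      rewrite powRN mulrC ler_pdivlMr ?powR_gt0// mul1r.
      have hM := hmin_le_hmax M; have hM0 := le_trans (ltW hm0) hM.
      by apply: ge0_ler_powR; rewrite ?nnegrE ?(ltW al0) ?(ltW hm0).
    move: (hmin M `^ (- alpha)) (hmax M `^ alpha) hh => x y xy.
    rewrite (_ : c * (W * x) * (y * DE) = c * W * DE * (x * y)); last by ring.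
    by rewrite ler_peMr// (mulr_ge0 (mulr_ge0 (ltW c0) W0) DE0).
  + rewrite lee_fin lerD2l ler_wpM2r ?(initial_energy_ge0 run)//.
    rewrite -mulrA ler_pM2l//; apply: le_trans cfl.
    by rewrite pw /W le_eqVlt; apply/orP; left; apply/eqP; ring.
Qed.
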